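(* Let $P_i=(x_i:y_i:z_i)$, $i=1,\dots,8$, be eight distinct points in the projective plane $\mathbb{P}^2$, no three on a line and no six on a conic. Consider the bracket monomial $$F(1,2,3,4,5,6,7;8)= \begin{array}{l} \phantom{\cdot}\,[128][238][348][458][568][678][718]\\ \cdot\,[124][235][346][457][561][672][713]\\ \cdot\,[126][237][341][452][563][674][715], \end{array}$$ the product of all $21$ displayed brackets, and for a permutation $\pi$ of $\{1,\dots,8\}$ let $F(\pi(1),\ldots,\pi(7);\pi(8))$ be obtained from it by replacing each index $i$ by $\pi(i)$. Then the Cayley-Bacharach point $P_9$ of $P_1,\dots,P_8$ is given by the formula $$\sum_{\pi\in S_8}\operatorname{sign}(\pi)\cdot F(\pi(1),\ldots,\pi(7);\pi(8))\cdot P_{\pi(8)},$$ where $\pi$ runs over all $40320$ permutations in the symmetric group $S_8$.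
   Context: Brackets. For indices $i,j,k$, $[ijk]$ denotes the determinant of the $3\times3$ matrix with rows $(x_i,y_i,z_i)$, $(x_j,y_j,z_j)$, $(x_k,y_k,z_k)$. Cayley-Bacharach point. If $P_1,\dots,P_8$ are eight distinct points in $\mathbb{P}^2$, no three on a line and no six on a conic, then there is a unique ninth point $P_9$ such that every cubic curve through $P_1,\dots,P_8$ also contains $P_9$; it is the ninth intersection point of any two distinct cubics through $P_1,\dots,P_8$. It is called the Cayley-Bacharach point of $P_1,\dots,P_8$. In the formula, each $P_i$ stands for the vector of homogeneous coordinates $(x_i,y_i,z_i)$, and the sum is a vector of homogeneous coordinates for $P_9$. *)

(* Defs.v *)
From HB Require Import structures.
From mathcomp Require Import all_boot all_order all_fingroup all_algebra.
From mathcomp Require Import mpoly.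

Set Implicit Arguments.
Unset Strict Implicit.
Unset Printing Implicit Defensive.

Import GRing.Theory.
Local Open Scope ring_scope.

(* A point of the projective plane over K is given by a nonzero row vector of *)
(* homogeneous coordinates; u and v represent the same point iff they span    *)
(* the same line, i.e. (u == v)%MS.                                           *)

Section PlaneCurves.
Variable K : fieldType.

Definition vanishes_at (f : {mpoly K[3]}) (p : 'rV[K]_3) : Prop :=
  f.@[fun i => p 0 i] = 0.

Definition is_curve (d : nat) (f : {mpoly K[3]}) : Prop :=
  f \is d.-homog /\ f != 0.

(* No n of the points lie on a curve of degree d. *)
Definition no_on_curve (I : finType) (n d : nat) (P : I -> 'rV[K]_3) : Prop :=
  forall A : {set I}, #|A| = n ->
    ~ exists f, is_curve d f /\ forall i, i \in A -> vanishes_at f (P i).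

(* Two forms define the same curve iff they are proportional. *)
Definition distinct_curves (f g : {mpoly K[3]}) : Prop :=
  forall c : K, c != 0 -> f <> c *: g.

(* The local ring of the projective plane at p, inside the field of fractions *)
(* of K[x, y, z].                                                             *)
Definition in_local_ring (p : 'rV[K]_3) (h : {fraction {mpoly K[3]}}) : Prop :=
  exists (d : nat) (a b : {mpoly K[3]}),
    [/\ a \is d.-homog, b \is d.-homog, ~ vanishes_at b p
      & h = tofrac a / tofrac b].

(* The ideal of the local ring at p generated by local equations f / l ^ d    *)
(* and g / l ^ e of curves of degrees d and e, for a linear form l with       *)
(* l(p) != 0 (the ideal does not depend on l).                                *)
Definition in_local_ideal (p : 'rV[K]_3) (d : nat) (f : {mpoly K[3]})
    (e : nat) (g : {mpoly K[3]}) (h : {fraction {mpoly K[3]}}) : Prop :=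
  exists (l : {mpoly K[3]}) (u v : {fraction {mpoly K[3]}}),
    [/\ l \is 1.-homog, ~ vanishes_at l p,
        in_local_ring p u, in_local_ring p v
      & h = u * (tofrac f / tofrac l ^+ d) + v * (tofrac g / tofrac l ^+ e)].

(* The intersection multiplicity at p of the curves f = 0 and g = 0, of       *)
(* degrees d and e, is m: the quotient of the local ring at p by the ideal    *)
(* of f and g has a K-basis b of size m.                                      *)
Definition intersection_mult (p : 'rV[K]_3) (d : nat) (f : {mpoly K[3]})
    (e : nat) (g : {mpoly K[3]}) (m : nat) : Prop :=
  exists b : 'I_m -> {fraction {mpoly K[3]}},
    (forall i, in_local_ring p (b i)) /\
    forall h, in_local_ring p h ->
      exists! c : 'rV[K]_m,
        in_local_ideal p d f e g
          (h - \sum_(i < m) tofrac ((c 0 i)%:MP : {mpoly K[3]}) * b i).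

Definition cubic_through (I : finType) (P : I -> 'rV[K]_3)
    (f : {mpoly K[3]}) : Prop :=
  is_curve 3 f /\ forall i, vanishes_at f (P i).

(* Q may coincide with one of the P i, which is then a double intersection    *)
(* point of the cubics; this is why multiplicities are needed: the            *)
(* intersection cycle of any two distinct cubics through P 0, ..., P 7 is     *)
(* P 0 + ... + P 7 + Q. This determines Q.                                    *)
Definition is_cayley_bacharach_point (P : 'I_8 -> 'rV[K]_3) (Q : 'rV[K]_3)
    : Prop :=
  [/\ Q != 0,
      forall f, cubic_through P f -> vanishes_at f Q
    & forall f g, cubic_through P f -> cubic_through P g ->
        distinct_curves f g ->
        forall R : 'rV[K]_3, R != 0 ->
          intersection_mult R 3 f 3 g
            (#|[set i | (P i == R)%MS]| + (Q == R)%MS)%N].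

End PlaneCurves.

Section Brackets.
Variable K : fieldType.

(* Indices of points are written 1, ..., 8: index k is the ordinal k - 1. *)
Definition idx (k : nat) : 'I_8 := inord k.-1.

Definition bracket (P : 'I_8 -> 'rV[K]_3) (i j k : 'I_8) : K :=
  \det (\matrix_(r < 3) tnth [tuple P i; P j; P k] r).

(* F(s(1), ..., s(7); s(8)) *)
Definition F (P : 'I_8 -> 'rV[K]_3) (s : 'S_8) : K :=
  let br (i j k : nat) := bracket P (s (idx i)) (s (idx j)) (s (idx k)) in
    br 1%N 2%N 8%N * br 2%N 3%N 8%N * br 3%N 4%N 8%N * br 4%N 5%N 8%N
    * br 5%N 6%N 8%N * br 6%N 7%N 8%N * br 7%N 1%N 8%N
  * (br 1%N 2%N 4%N * br 2%N 3%N 5%N * br 3%N 4%N 6%N * br 4%N 5%N 7%N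
    * br 5%N 6%N 1%N * br 6%N 7%N 2%N * br 7%N 1%N 3%N)
  * (br 1%N 2%N 6%N * br 2%N 3%N 7%N * br 3%N 4%N 1%N * br 4%N 5%N 2%N
    * br 5%N 6%N 3%N * br 6%N 7%N 4%N * br 7%N 1%N 5%N).

End Brackets.

(* Main.v *)
(* The sum is a polynomial of degree 8 in each point, and a bracket monomial contains every pair
   of points in at least two brackets; being skew, the sum is divisible by the cube of the
   distance of any two points. Hence, in the frame where P1, P2, P3 are the coordinate points, it
   is for each of the other five points an octic with triple points at the seven remaining ones.
   Such an octic is determined by its values at few sample points, so an interpolation reduces the
   identification of the sum with 840 (Cx Dy Dz, Dx Cy Dz, Dx Dy Cz) to a computation with
   integers. Here Cx = 0 says that P1, P4, ..., P8 lie on a conic, and Dx = 0 that a cubic through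
   the eight points is singular at P1.
   Projecting from P1, two cubics through the points become x^2 y + x q + n and x^2 z + x q' + n'
   with binary forms q, q', n, n'. The directions of the other base points are the roots of their
   resultant, a binary octic whose extreme coefficients give the direction of the last root. If
   no member of the pencil is singular at some P_i, this root comes from a ninth base point; doing
   the same from P2 shows that it is the point above. If some member is singular at P_i, the
   formula gives P_i, which is a double base point. *)

(* Expanding 40320 products of 21 brackets in 15 free coordinates is avoided: both sides are
   evaluated at integer points only. The interpolation rests on 45 = 7 * 6 + 3: an octic has 45
   coefficients, a triple point imposes 6 conditions, and three frame points, four further points
   and three values give a square system. It is not invertible for all positions of the points. So
   the points are moved along segments that start at integer samples; over the polynomial ring the
   determinant is nonzero because its value at the start is. Seven samples provide four starting
   points and three test values, and invertibility is checked modulo 37. General position enters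
   through one fact: no cubic of the pencil splits off a line, since a line holds at most two of the
   points and a conic at most five. Intersection multiplicities are found from local equations: they
   give 1 at a base point where no member is singular, and 2 at the at most one P_i where some
   member is. *)
Require Import Defs.
From Stdlib Require Import ZArith.
From mathcomp Require Import all_boot all_order all_fingroup all_algebra.
From mathcomp Require Import mpoly ring zify ssrZ.
Set Implicit Arguments.
Unset Strict Implicit.
Unset Printing Implicit Defensive.
Import GRing.Theory.
Local Open Scope ring_scope.

(** * Alternating sums *)

Section AlternatingSums.
Variables (X : Type) (R : comNzRingType) (step : seq X -> R).

Fixpoint weight (acc l : seq X) : R :=
  if l is x :: l' then step (x :: acc) * weight (x :: acc) l' else 1.

(** Depth-first evaluation of a signed sum over all orderings of [l]: [acc] holds the entries chosen
    so far in reverse, [w] the product of their steps. A branch is cut once its partial product is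
    zero. The operations are arguments so that the code can run on [Z] with its own arithmetic. *)
Fixpoint altsum (mul sub : R -> R -> R) (isz : R -> bool) (n : nat)
    (acc l : seq X) (w : R) : R :=
  if n is n'.+1 then
    (fix pick pre l := if l is x :: l' then
       sub (let w' := mul w (step (x :: acc)) in
            if isz w' then 0
            else altsum mul sub isz n' (x :: acc) (rev pre ++ l') w')
           (pick (x :: pre) l')
     else 0) [::] l
  else w.

Lemma altsumE (isz : R -> bool) (iszP : forall x, isz x -> x = 0) n acc
    (P : 'I_n -> X) w :
  altsum *%R (fun x y => x - y) isz n acc [seq P i | i <- enum 'I_n] w
  = w * \sum_(s : 'S_n) (-1) ^+ s * weight acc [seq P (s i) | i <- enum 'I_n].
Proof.
elim: n acc P w => [|n IHn] acc P w.
  rewrite (big_pred1 1%g) => [|s]; last by apply/esym/eqP/permP => -[].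
  by rewrite odd_perm1 enum_ord0 /= !mulr1.
pose g x l := let w' := w * step (x :: acc) in if isz w' then 0
            else altsum *%R (fun x y => x - y) isz n (x :: acc) l w'.
pose pick := fix pick pre l := if l is x :: l' then
       g x (rev pre ++ l') - pick (x :: pre) l' else 0.
(* The nested subtraction a - (b - (c - ...)) produces the sign of moving entry j to the front. *)
have pickE pre l : pick pre l = \sum_(j < size l)
    (-1) ^+ j * (if drop j l is x :: l' then g x (rev pre ++ take j l ++ l') else 0).
  elim: l pre => [|x l IHl] pre; first by rewrite big_ord0.
  rewrite [LHS]/= IHl big_ord_recl expr0 mul1r /= -sumrN; congr (_ + _).
  apply: eq_bigr => j _; rewrite exprS mulN1r mulNr; congr (- (_ * _)).
  by case: (drop _ _) => // y l'; rewrite rev_cons cat_rcons.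
transitivity (pick [::] [seq P i | i <- enum 'I_n.+1]); first by [].
have dropE (j : 'I_n.+1) : drop j [seq P i | i <- enum 'I_n.+1]
    = P j :: drop j.+1 [seq P i | i <- enum 'I_n.+1].
  rewrite (drop_nth (P j)); last by rewrite size_map size_enum_ord.
  by rewrite (nth_map j) ?size_enum_ord // nth_ord_enum.
have restE : forall j : 'I_n.+1, take j [seq P i | i <- enum 'I_n.+1] ++
    drop j.+1 [seq P i | i <- enum 'I_n.+1]
  = [seq P (lift j i) | i <- enum 'I_n].
  move=> j; apply: (@eq_from_nth _ (P j)) => [|k].
    rewrite size_cat size_take size_drop !(size_map _ (enum _)) !size_enum_ord ltn_ord.
    by rewrite subSS subnKC // -ltnS.
  rewrite size_cat size_take size_drop size_map size_enum_ord ltn_ord.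
  rewrite subSS (subnKC (ltn_ord j : j <= n)%N) => kn.
  rewrite nth_cat size_take size_map size_enum_ord ltn_ord.
  rewrite (nth_map (Ordinal kn)) ?size_enum_ord //.
  rewrite (nth_ord_enum _ (Ordinal kn)).
  case: ltnP => kj.
    rewrite nth_take // (nth_map j) ?size_enum_ord ?(ltn_trans kj) //.
    congr P; apply: val_inj; rewrite /= nth_enum_ord ?(ltn_trans kj) //.
    by rewrite /bump leqNgt kj.
  rewrite nth_drop (nth_map j) ?size_enum_ord; last first.
    by rewrite addSn subnKC.
  congr P; apply: val_inj; rewrite /= nth_enum_ord addSn subnKC //.
  by rewrite /bump kj.
rewrite pickE size_map size_enum_ord.
transitivity (\sum_(j < n.+1) \sum_(s : 'S_n) w * ((-1) ^+ (odd j (+) s) *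
   weight acc (P j :: [seq P (lift j (s i)) | i <- enum 'I_n]))).
  apply: eq_bigr => j _; rewrite dropE /= restE /g.
  set w' := w * _.
  have E : (if isz w' then 0 else altsum *%R (fun x y => x - y) isz n (P j :: acc) [seq P (lift j i) | i <- enum 'I_n] w')
     = w' * \sum_(s : 'S_n) (-1) ^+ s * weight (P j :: acc) [seq P (lift j (s i)) | i <- enum 'I_n].
    case: ifP => [/iszP -> | _]; first by rewrite mul0r.
    exact: (IHn _ (fun i => P (lift j i))).
  rewrite E mulrA mulr_sumr; apply: eq_bigr => s _.
  rewrite signr_addb signr_odd /w' {E w'}.
  move: ((-1) ^+ j) ((-1) ^+ s) (step _) (weight _ _) => a b c d; ring.
rewrite mulr_sumr pair_bigA /=.
(* A permutation of n + 1 elements is encoded by the image j of 0 and a permutation of the rest; its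
   sign is that of the rest times (-1) ^ j. *)
pose ulsf (js : 'I_n.+1 * 'S_n) := lift_perm ord0 js.1 js.2.
pose unl (s : 'S_n.+1) (k : 'I_n) := odflt k (unlift (s ord0) (s (lift ord0 k))).
have unl_inj s : injective (unl s).
  move=> i j; rewrite /unl.
  case: unliftP => [a Ea|/perm_inj/eqP]; last by rewrite lift_eqF.
  case: unliftP => [b Eb|/perm_inj/eqP]; last by rewrite lift_eqF.
  by move=> /= Eab; move: Ea; rewrite Eab -Eb => /perm_inj/lift_inj.
rewrite [RHS](reindex ulsf) /=; last first.
  exists (fun s : 'S_n.+1 => (s ord0, perm (@unl_inj s))) => [[j s] _|s _].
    rewrite /ulsf /=; congr (_, _); first by rewrite lift_perm_id.
    apply/permP => i; rewrite permE /unl lift_perm_lift lift_perm_id.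
    by rewrite liftK.
  apply/permP => i; rewrite /ulsf /=; case: (unliftP ord0 i) => [k ->|->].
    rewrite lift_perm_lift permE /unl; case: unliftP => [a -> //|/perm_inj/eqP].
    by rewrite lift_eqF.
  by rewrite lift_perm_id.
apply: eq_bigr => -[j s] _ /=; rewrite /ulsf odd_lift_perm /=.
congr (_ * (_ * _)); rewrite enum_ordSl /= lift_perm_id; congr (_ * weight _ _).
by rewrite -map_comp; apply: eq_map => i /=; rewrite lift_perm_lift.
Qed.

End AlternatingSums.

(** * The bracket polynomial *)

(* The point listed last in the formula has index 0. *)
Definition triples : seq (nat * nat * nat) :=
  [:: (1, 2, 0); (2, 3, 0); (3, 4, 0); (4, 5, 0); (5, 6, 0); (6, 7, 0); (7, 1, 0);
      (1, 2, 4); (2, 3, 5); (3, 4, 6); (4, 5, 7); (5, 6, 1); (6, 7, 2); (7, 1, 3);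
      (1, 2, 6); (2, 3, 7); (3, 4, 1); (4, 5, 2); (5, 6, 3); (6, 7, 4); (7, 1, 5)]%N.

Section AlternatingBracketSum.
Variable R : comNzRingType.
Implicit Types (u v w : R * R * R) (p : 'I_8 -> R * R * R).

Definition br u v w : R :=
  u.1.1 * (v.1.2 * w.2 - v.2 * w.1.2) - u.1.2 * (v.1.1 * w.2 - v.2 * w.1.1)
  + u.2 * (v.1.1 * w.1.2 - v.1.2 * w.1.1).

Definition coord (k : nat) u : R :=
  if k is k'.+1 then if k' is _.+1 then u.2 else u.1.2 else u.1.1.

Definition bracket_term k p : R :=
  (\prod_(t <- triples) br (p (inord t.1.1)) (p (inord t.1.2)) (p (inord t.2)))
  * coord k (p (inord 0)).

Definition bracket_sum k p : R :=
  \sum_(s : 'S_8) (-1) ^+ s * bracket_term k (p \o s).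

Lemma eq_bracket_sum k p p' : p =1 p' -> bracket_sum k p = bracket_sum k p'.
Proof.
move=> e; apply: eq_bigr => s _; rewrite /bracket_term /= e; congr (_ * (_ * _)).
by apply: eq_bigr => t _ /=; rewrite !e.
Qed.

Lemma bracket_sum_perm k p (t : 'S_8) :
  bracket_sum k (p \o t) = (-1) ^+ t * bracket_sum k p.
Proof.
rewrite /bracket_sum mulr_sumr [RHS](reindex_inj (mulIg t)) /=.
apply: eq_bigr => s _; rewrite odd_permM mulrA -signr_addb addbC addbK.
congr (_ * _); rewrite /bracket_term /= permM; congr (_ * _).
by apply: eq_bigr => r _ /=; rewrite !permM.
Qed.

Lemma big_prod_dvd (I : eqType) (r : seq I) (P : pred I) (f : I -> R) d :
  (forall i, i \in r -> P i -> exists c, f i = d * c) ->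
  exists c, \prod_(i <- r) f i = d ^+ count P r * c.
Proof.
elim: r => [|i r IHr] Pf; first by exists 1; rewrite big_nil mulr1.
have [|c Ec] := IHr; first by move=> j jr; apply: Pf; rewrite inE jr orbT.
rewrite big_cons Ec /=; case: (boolP (P i)) => Pi.
  have [|b ->] := Pf i _ Pi; first by rewrite inE eqxx.
  by exists (b * c); rewrite exprD expr1; ring.
by exists (f i * c); rewrite add0n; ring.
Qed.

Lemma triples_incidence (a b : 'I_8) : a != b ->
  (2 <= count (fun t => [&& (nat_of_ord a \in [:: t.1.1; t.1.2; t.2])
       & (nat_of_ord b \in [:: t.1.1; t.1.2; t.2])]) triples)%N.
Proof.
case: a => a a8; case: b => b b8; rewrite -val_eqE /=.
by move: a a8 b b8; do 8?[case=> [|] //]; move=> _; do 8?[case=> [|] //].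
Qed.

Definition pt_add u v : R * R * R := (u.1.1 + v.1.1, u.1.2 + v.1.2, u.2 + v.2).
Definition pt_scale c u : R * R * R := (c * u.1.1, c * u.1.2, c * u.2).

(** A bracket with both rows u - d v and u + d v is, up to sign, 2 d times a bracket with rows u and
    v, and [triples_incidence] provides two such brackets. *)
Lemma bracket_term_dvd k p (i j : 'I_8) d u v : i != j ->
  p i = pt_add u (pt_scale (- d) v) -> p j = pt_add u (pt_scale d v) ->
  exists c, bracket_term k p = d ^+ 2 * c.
Proof.
move=> ij pi pj.
have [|c Ec] := @big_prod_dvd _ triples
  (fun t => [&& (nat_of_ord i \in [:: t.1.1; t.1.2; t.2])
     & (nat_of_ord j \in [:: t.1.1; t.1.2; t.2])])
  (fun t => br (p (inord t.1.1)) (p (inord t.1.2)) (p (inord t.2))) d.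
  move=> [[x y] z] _ /= /andP[]; rewrite !inE.
  have ijn : (i == j :> nat) = false by apply/negbTE.
  have jin : (j == i :> nat) = false by rewrite eq_sym.
  case/or3P=> /eqP <-; rewrite ?jin ?orbF /= => /orP[]/eqP <-;
    rewrite !inord_val pi pj /br /pt_add /pt_scale /=.
  - by set w := p _; exists (br u v w - br v u w); rewrite /br; ring.
  - by set w := p _; exists (br u w v - br v w u); rewrite /br; ring.
  - by set w := p _; exists (br v u w - br u v w); rewrite /br; ring.
  - by set w := p _; exists (br w u v - br w v u); rewrite /br; ring.
  - by set w := p _; exists (br v w u - br u w v); rewrite /br; ring.
  - by set w := p _; exists (br w v u - br w u v); rewrite /br; ring.
have /subnKC E := triples_incidence ij.
rewrite /bracket_term Ec -E exprD.
by exists (d ^+ (count (fun t => [&& (nat_of_ord i \in [:: t.1.1; t.1.2; t.2])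
     & (nat_of_ord j \in [:: t.1.1; t.1.2; t.2])]) triples - 2) * c * coord k (p (inord 0))); ring.
Qed.
End AlternatingBracketSum.

Definition map_pt (R S : Type) (f : R -> S) (u : R * R * R) : S * S * S :=
  (f u.1.1, f u.1.2, f u.2).

Lemma br_map (R S : comNzRingType) (f : {rmorphism R -> S}) u v w :
  br (map_pt f u) (map_pt f v) (map_pt f w) = f (br u v w).
Proof. by rewrite /br /map_pt rmorphD rmorphB 3!rmorphM 3!rmorphB 6!rmorphM. Qed.

Lemma bracket_sum_map (R S : comNzRingType) (f : {rmorphism R -> S}) k
    (p : 'I_8 -> R * R * R) :
  bracket_sum k (fun i => map_pt f (p i)) = f (bracket_sum k p).
Proof.
rewrite rmorph_sum; apply: eq_bigr => s _; rewrite rmorphM rmorph_sign rmorphM.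
rewrite rmorph_prod; congr (_ * (_ * _)); last by case: k => [|[|k]].
by apply: eq_bigr => t _; rewrite /= br_map.
Qed.

Lemma map_pt_line (R S : comNzRingType) (f : {rmorphism R -> S}) c u v :
  map_pt f (pt_add u (pt_scale c v))
  = pt_add (map_pt f u) (pt_scale (f c) (map_pt f v)).
Proof. by rewrite /map_pt /= !rmorphD !rmorphM. Qed.

Definition pt_polyC (R : nzRingType) := map_pt (@polyC R).

Lemma bracket_sum_dvd (R : comNzRingType) k (p : 'I_8 -> R * R * R) (i j : 'I_8) d u v :
  i != j -> p i = pt_add u (pt_scale (- d) v) -> p j = pt_add u (pt_scale d v) ->
  exists c, bracket_sum k p = d ^+ 2 * c.
Proof.
move=> ij pi pj.
have term (s : 'S_8) : exists c, bracket_term k (p \o s) = d ^+ 2 * c.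
  apply: (@bracket_term_dvd _ _ _ (s^-1 i)%g (s^-1 j)%g d u v).
  - by rewrite (inj_eq perm_inj).
  - by rewrite /= permKV.
  - by rewrite /= permKV.
rewrite /bracket_sum; elim/big_rec: _ => [|s x _ [c ->]]; first by exists 0; rewrite mulr0.
have [b ->] := term s; exists ((-1) ^+ s * b + c).
by move: (_ ^+ s) => e; ring.
Qed.

(* Moving the two points symmetrically makes the sum an odd function of the  *)
(* distance, which improves the order of vanishing from 2 to 3.              *)
Lemma bracket_sum_sym_dvd (R : idomainType) k (p : 'I_8 -> R * R * R) (i j : 'I_8) u v :
  2%:R != 0 :> R -> i != j ->
  exists c, bracket_sum k (fun l =>
    if l == i then pt_add (pt_polyC u) (pt_scale (- 'X) (pt_polyC v))
    else if l == j then pt_add (pt_polyC u) (pt_scale 'X (pt_polyC v))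
    else pt_polyC (p l)) = 'X ^+ 3 * c.
Proof.
move=> nz2 ij; set q := fun l : 'I_8 => _.
have [||c Ec] := @bracket_sum_dvd _ k q i j 'X (pt_polyC u) (pt_polyC v) ij.
- by rewrite /q eqxx.
- by rewrite /q eqxx eq_sym (negbTE ij).
have : bracket_sum k q \Po (- 'X) = - bracket_sum k q.
  pose h : {rmorphism {poly R} -> {poly R}} := comp_poly (- 'X).
  rewrite -[LHS]/(h _) -bracket_sum_map -mulN1r.
  have -> : -1 = (-1) ^+ tperm i j :> {poly R} by rewrite odd_tperm ij.
  rewrite -bracket_sum_perm; apply: eq_bracket_sum => l.
  have hC w : map_pt h (pt_polyC w) = pt_polyC w.
    by congr (_, _, _); apply: comp_polyC.
  have hX : h 'X = - 'X by apply: comp_polyX.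
  rewrite /q /=; case: tpermP => [->|->|/eqP li /eqP lj].
  - by rewrite eqxx eq_sym (negbTE ij) eqxx map_pt_line !hC rmorphN hX opprK.
  - by rewrite [j == i]eq_sym (negbTE ij) !eqxx map_pt_line !hC hX.
  - by rewrite (negbTE li) (negbTE lj) hC.
rewrite Ec rmorphM rmorphXn /= comp_polyX sqrrN => /eqP.
rewrite -mulrN (inj_eq (mulfI _)) ?expf_neq0 ?polyX_eq0 // => /eqP Ec'.
have c0 : c.[0] = 0.
  have := congr1 (horner^~ 0) Ec'; rewrite horner_comp !hornerE oppr0 => /eqP.
  by rewrite -addr_eq0 -mulr2n -mulr_natl mulf_eq0 (negbTE nz2) => /eqP.
have /factor_theorem[b Eb] : root c 0 by rewrite /root c0.
by exists b; rewrite Eb subr0; ring.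
Qed.

(** Here the point i stays fixed and only j moves, as is needed to speak of a triple point of the
    octic in the point j. The centre of the symmetric motion is taken as p i + X v over {poly R},
    and the second variable is then set to X; hence the factor 2. *)
Lemma bracket_sum_triple (R : idomainType) k (p : 'I_8 -> R * R * R) (i j : 'I_8) v :
  2%:R != 0 :> R -> i != j ->
  exists c, bracket_sum k (fun l =>
    if l == j then pt_add (pt_polyC (p i)) (pt_scale (2%:R * 'X) (pt_polyC v))
    else pt_polyC (p l)) = 'X ^+ 3 * c.
Proof.
move=> nz2 ij.
pose u := pt_add (pt_polyC (p i)) (pt_scale 'X (pt_polyC v)).
have nz2p : 2%:R != 0 :> {poly R} by rewrite -polyC_natr polyC_eq0.
have [c Ec] := bracket_sum_sym_dvd k (fun l => pt_polyC (p l)) u (pt_polyC v) nz2p ij.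
pose h : {rmorphism {poly {poly R}} -> {poly R}} := horner_eval 'X.
exists (h c); have := congr1 h Ec.
rewrite rmorphM rmorphXn -bracket_sum_map /= {2}/horner_eval hornerX => <-.
have hC w : map_pt h (pt_polyC w) = w by case: w => [[a b] e]; congr (_, _, _); apply: hornerC.
have hX : h 'X = 'X by apply: hornerX.
apply: eq_bracket_sum => l; rewrite /u; case: (altP (l =P i)) => [->|li].
  rewrite (negbTE ij) map_pt_line !hC rmorphN hX; congr (_, _, _) => /=; ring.
by case: ifP => lj; rewrite ?map_pt_line !hC // hX; congr (_, _, _) => /=; ring.
Qed.

(** * Degrees in each single point *)

Section HomogeneousPoints.
Variables (R : comNzRingType).
Implicit Types (u v w : {mpoly R[3]} * {mpoly R[3]} * {mpoly R[3]}).

Definition pt_homog d u :=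
  [/\ u.1.1 \is d.-homog, u.1.2 \is d.-homog & u.2 \is d.-homog].

Definition generic_pt : {mpoly R[3]} * {mpoly R[3]} * {mpoly R[3]} :=
  ('X_(@Ordinal 3 0 isT), 'X_(@Ordinal 3 1 isT), 'X_(@Ordinal 3 2 isT)).

Definition pt_mpolyC := map_pt (@mpolyC 3 R).

Lemma generic_pt_homog : pt_homog 1 generic_pt.
Proof. by split; rewrite dhomogX /= mdeg1. Qed.

Lemma dhomog_mpolyC (c : R) : c%:MP_[3] \is 0.-homog.
Proof. by rewrite -[c%:MP]mulr1 mul_mpolyC dhomogZ ?dhomog1. Qed.

Lemma pt_mpolyC_homog (u : R * R * R) : pt_homog 0 (pt_mpolyC u).
Proof. by split; apply: dhomog_mpolyC. Qed.

Lemma br_homog a b c u v w : pt_homog a u -> pt_homog b v -> pt_homog c w ->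
  br u v w \is (a + b + c).-homog.
Proof.
move=> [ux uy uz] [vx vy vz] [wx wy wz].
by rewrite -addnA /br rpredD ?rpredB // dhomogM // rpredB // dhomogM.
Qed.

Lemma dhomog_big_prod (I : Type) (r : seq I) (d : I -> nat) (f : I -> {mpoly R[3]}) :
  (forall i, f i \is (d i).-homog) -> \prod_(i <- r) f i \is (\sum_(i <- r) d i)%N.-homog.
Proof.
move=> fd; elim: r => [|i r IHr]; first by rewrite !big_nil dhomog1.
by rewrite !big_cons dhomogM.
Qed.

(** The index 0 occurs in seven brackets and once more as the point outside them; every other index
    occurs in eight brackets. *)
Lemma triples_degree (a : 'I_8) :
  (\sum_(t <- triples) ((inord t.1.1 == a) + (inord t.1.2 == a) + (inord t.2 == a))
   + (inord 0 == a :> 'I_8))%N = 8%N.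
Proof.
have E n : (n < 8)%N -> (inord n == a :> 'I_8) = (n == a).
  by move=> n8; rewrite -val_eqE /= inordK.
rewrite !big_cons big_nil /= !E //.
by case: a {E} => a; do 8?[case: a => [//|a]].
Qed.

Lemma bracket_sum_homog k (p : 'I_8 -> {mpoly R[3]} * {mpoly R[3]} * {mpoly R[3]}) j :
  (forall i, pt_homog (i == j) (p i)) -> bracket_sum k p \is 8.-homog.
Proof.
move=> hp; apply: rpred_sum => s _; rewrite -signr_odd.
suff: bracket_term k (p \o s) \is 8.-homog.
  by move=> h; case: odd; rewrite /= ?expr1 ?expr0 ?mulN1r ?rpredN ?mul1r.
rewrite -[X in X.-homog](triples_degree (s^-1 j)%g) /bracket_term.
have E i : (i == (s^-1 j)%g) = (s i == j).
  by rewrite -(inj_eq (@perm_inj _ s)) permKV.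
apply: dhomogM; last first.
  by case: (hp (s (inord 0))) => hx hy hz; rewrite E; case: k => [|[|k]].
by apply: dhomog_big_prod => t; rewrite !E; apply: br_homog.
Qed.
End HomogeneousPoints.

(** * The determinantal formula for the ninth point *)

Section CayleyBacharachForm.
Variable R : comNzRingType.
Implicit Types (u v w : R * R * R) (q : 'I_5 -> R * R * R).

Definition pt_rot u : R * R * R := (u.1.2, u.2, u.1.1).

(** The monomials of a conic through (1, 0, 0). *)
Definition conic_row u : seq R :=
  let: (x, y, z) := u in [:: x * y; x * z; y * y; y * z; z * z].
(** The monomials of a cubic that is singular at (1, 0, 0) and passes through (0, 1, 0) and (0, 0,
    1). *)
Definition cubic_row u : seq R :=
  let: (x, y, z) := u in
  [:: x * y * y; x * y * z; x * z * z; y * y * z; y * z * z].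

Definition row_det (r : R * R * R -> seq R) q : R :=
  \det (\matrix_(i < 5, j < 5) (r (q i))`_j).

Definition conic_det k q := row_det (fun u => conic_row (iter k pt_rot u)) q.
Definition nodal_det k q := row_det (fun u => cubic_row (iter k pt_rot u)) q.

(** Coordinate k of (Cx Dy Dz, Dx Cy Dz, Dx Dy Cz); the rotation index matters only modulo 3. *)
Definition ninth_pt k q : R :=
  conic_det k q * nodal_det k.+1 q * nodal_det k.+2 q.

Lemma row_det_perm r q (s : 'S_5) : row_det r (q \o s) = (-1) ^+ s * row_det r q.
Proof.
rewrite -det_perm -det_mulmx -row_permE /row_det; congr (\det _).
by apply/matrixP => i j; rewrite !mxE.
Qed.

Lemma eq_row_det r q q' : q =1 q' -> row_det r q = row_det r q'.
Proof. by move=> e; congr (\det _); apply/matrixP => i j; rewrite !mxE e. Qed.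

Lemma ninth_pt_perm k q (s : 'S_5) : ninth_pt k (q \o s) = (-1) ^+ s * ninth_pt k q.
Proof.
rewrite /ninth_pt /conic_det /nodal_det 3!(row_det_perm _ q s).
rewrite -signr_odd; case: (odd _); rewrite /= ?expr0 ?expr1; ring.
Qed.

Lemma eq_ninth_pt k q q' : q =1 q' -> ninth_pt k q = ninth_pt k q'.
Proof. by move=> e; rewrite /ninth_pt /conic_det /nodal_det !(eq_row_det _ e). Qed.

Lemma row_det_dvd r q i d :
  (forall j : 'I_5, exists c, (r (q i))`_j = d * c) -> exists c, row_det r q = d * c.
Proof.
move=> h; rewrite /row_det (expand_det_row _ i).
elim/big_rec: _ => [|j x _ [c ->]]; first by exists 0; rewrite mulr0.
by have [b e] := h j; rewrite mxE e; exists (b * cofactor (\matrix_(i, j) (r (q i))`_j) i j + c); ring.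
Qed.
End CayleyBacharachForm.

Lemma row_det_map (R S : comNzRingType) (f : {rmorphism R -> S}) rR rS
    (q : 'I_5 -> R * R * R) :
  (forall u (j : 'I_5), (rS (map_pt f u))`_j = f (rR u)`_j) ->
  row_det rS (fun i => map_pt f (q i)) = f (row_det rR q).
Proof.
move=> h; rewrite -det_map_mx; congr (\det _).
by apply/matrixP => i j; rewrite !mxE h.
Qed.

Section MapNinthPoint.
Variables (R S : comNzRingType) (f : {rmorphism R -> S}).

Lemma iter_pt_rot_map k (u : R * R * R) :
  iter k (@pt_rot S) (map_pt f u) = map_pt f (iter k (@pt_rot R) u).
Proof. by elim: k => //= k ->. Qed.

Lemma conic_row_map k (u : R * R * R) (j : 'I_5) :
  (conic_row (iter k (@pt_rot S) (map_pt f u)))`_j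
  = f (conic_row (iter k (@pt_rot R) u))`_j.
Proof.
rewrite iter_pt_rot_map; case: (iter k _ u) => [[x y] z]; rewrite /map_pt /=.
by case: j => j /=; do 5?[case: j => [_|j]; first by rewrite /= ?rmorphM].
Qed.

Lemma cubic_row_map k (u : R * R * R) (j : 'I_5) :
  (cubic_row (iter k (@pt_rot S) (map_pt f u)))`_j
  = f (cubic_row (iter k (@pt_rot R) u))`_j.
Proof.
rewrite iter_pt_rot_map; case: (iter k _ u) => [[x y] z]; rewrite /map_pt /=.
by case: j => j /=; do 5?[case: j => [_|j]; first by rewrite /= ?rmorphM].
Qed.

Lemma ninth_pt_map k (q : 'I_5 -> R * R * R) :
  ninth_pt k (fun i => map_pt f (q i)) = f (ninth_pt k q).
Proof.
rewrite !rmorphM /ninth_pt /conic_det /nodal_det.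
rewrite (row_det_map _ (conic_row_map k)).
by rewrite (row_det_map _ (cubic_row_map k.+1)) (row_det_map _ (cubic_row_map k.+2)).
Qed.
End MapNinthPoint.

Lemma row_det_homog (R : comNzRingType) r d
    (q : 'I_5 -> {mpoly R[3]} * {mpoly R[3]} * {mpoly R[3]}) j :
  (forall e u (i : 'I_5), pt_homog e u -> (r u)`_i \is (d * e).-homog) ->
  (forall i, pt_homog (i == j) (q i)) -> row_det r q \is d.-homog.
Proof.
move=> hr hq; apply: rpred_sum => s _; rewrite -signr_odd.
suff h : \prod_i (\matrix_(i < 5, j < 5) (r (q i))`_j) i (s i) \is d.-homog.
  by case: (odd _); rewrite /= ?expr1 ?expr0 ?mulN1r ?rpredN ?mul1r.
have -> : d = (\sum_(i < 5) d * (i == j))%N.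
  by rewrite (bigD1 j) //= eqxx muln1 big1 ?addn0 // => i /negbTE ->; rewrite muln0.
by apply: dhomog_big_prod => i; rewrite mxE; apply: hr.
Qed.

Lemma iter_rot_homog (R : comNzRingType) k e (u : {mpoly R[3]} * {mpoly R[3]} * {mpoly R[3]}) :
  pt_homog e u -> pt_homog e (iter k (@pt_rot _) u).
Proof. by move=> h; elim: k => //= k [hx hy hz]. Qed.

Lemma ninth_pt_homog (R : comNzRingType) k
    (q : 'I_5 -> {mpoly R[3]} * {mpoly R[3]} * {mpoly R[3]}) j :
  (forall i, pt_homog (i == j) (q i)) -> ninth_pt k q \is 8.-homog.
Proof.
move=> hq; have nodal m : nodal_det m q \is 3.-homog.
  apply: (row_det_homog _ hq) => e u i /(iter_rot_homog m).
  case: (iter m _ u) => [[x y] z] [/= hx hy hz].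
  have h a b c : a \is e.-homog -> b \is e.-homog -> c \is e.-homog ->
      a * b * c \is (3 * e).-homog.
    by move=> ha hb hc; rewrite !mulSn addn0 addnA !dhomogM.
  by case: i => i /= _; do 5?[case: i => [|i]; first by apply: h]; rewrite /= nth_nil rpred0.
rewrite -[8%N]/(2 + 3 + 3)%N !dhomogM //.
apply: (row_det_homog _ hq) => e u i /(iter_rot_homog k).
case: (iter k _ u) => [[x y] z] [/= hx hy hz].
rewrite mul2n -addnn.
by case: i => i /= _; do 5?[case: i => [|i]; first by apply: dhomogM]; rewrite /= nth_nil rpred0.
Qed.

(** At X = 0 the rows i and j of the determinant coincide. *)
Lemma row_det_line_dvd (R : idomainType) rR rP (q : 'I_5 -> R * R * R) i j v :
  (forall x u (j : 'I_5), (rR (map_pt (horner_eval x) u))`_j = horner_eval x (rP u)`_j) ->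
  i != j ->
  exists c, row_det rP (fun l =>
    if l == j then pt_add (pt_polyC (q i)) (pt_scale (2%:R * 'X) (pt_polyC v))
    else pt_polyC (q l)) = 'X * c.
Proof.
move=> hr ij; set Q := fun l : 'I_5 => _.
have hC w : map_pt (horner_eval 0) (pt_polyC w) = w :> R * R * R.
  by case: w => [[a b] e]; congr (_, _, _); apply: hornerC.
have /factor_theorem[c Ec] : root (row_det rP Q) 0.
  rewrite /root -/(horner_eval 0 _).
  rewrite -(@row_det_map _ _ (horner_eval (0 : R)) rP rR _ (hr 0)).
  apply/eqP/(determinant_alternate ij) => l; rewrite !mxE /Q (negbTE ij) eqxx.
  congr (_ `_ _); congr rR; rewrite hC.
  rewrite (map_pt_line (horner_eval (0 : R))) !hC /pt_add /pt_scale.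
  rewrite rmorphM /= {2 4 6}/horner_eval !hornerX !mulr0 !mul0r !addr0.
  by case: (q i) => [[a b] e].
by exists c; rewrite Ec subr0 mulrC.
Qed.

Section OrderAtFrame.
Variables (R : comNzRingType) (d x y z : R).

(** Near a frame point a determinant vanishes to the order of its moving row. The conic row has
    order 1 at (1, 0, 0); the cubic row has order 2 there and order 1 at the two other frame points.
    In [ninth_pt] these orders add up to 3 at every frame point. *)
Lemma conic_row0_dvd (j : 'I_5) :
  exists c, (conic_row (x, d * y, d * z))`_j = d ^+ 1 * c.
Proof.
exists ([:: x * y; x * z; d * y * y; d * y * z; d * z * z]`_j).
by case: j => j /= _; do 5?[case: j => [|j]; first by rewrite /=; ring]; rewrite /= !nth_nil mulr0.
Qed.

Lemma cubic_row0_dvd (j : 'I_5) :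
  exists c, (cubic_row (x, d * y, d * z))`_j = d ^+ 2 * c.
Proof.
exists ([:: x * y * y; x * y * z; x * z * z; d * y * y * z; d * y * z * z]`_j).
by case: j => j /= _; do 5?[case: j => [|j]; first by rewrite /=; ring]; rewrite /= !nth_nil mulr0.
Qed.

Lemma cubic_row1_dvd (j : 'I_5) :
  exists c, (cubic_row (d * x, y, d * z))`_j = d ^+ 1 * c.
Proof.
exists ([:: x * y * y; d * x * y * z; d * d * x * z * z; y * y * z; d * y * z * z]`_j).
by case: j => j /= _; do 5?[case: j => [|j]; first by rewrite /=; ring]; rewrite /= !nth_nil mulr0.
Qed.

Lemma cubic_row2_dvd (j : 'I_5) :
  exists c, (cubic_row (d * x, d * y, z))`_j = d ^+ 1 * c.
Proof.
exists ([:: d * d * x * y * y; d * x * y * z; x * z * z; d * y * y * z; y * z * z]`_j).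
by case: j => j /= _; do 5?[case: j => [|j]; first by rewrite /=; ring]; rewrite /= !nth_nil mulr0.
Qed.
End OrderAtFrame.

(** * The difference of the two sides and its triple points *)

Definition basis_pt (R : nzRingType) (a : nat) : R * R * R :=
  ((a == 0)%N%:R, (a == 1)%N%:R, (a == 2)%N%:R).

Definition framed (R : nzRingType) (q : 'I_5 -> R * R * R) (l : 'I_8) : R * R * R :=
  match split (l : 'I_(3 + 5)) with inl a => basis_pt R a | inr b => q b end.

(** 840 is the factor of proportionality, confirmed on integers by [samples_defect]. *)
Definition defect (R : comNzRingType) k (q : 'I_5 -> R * R * R) : R :=
  bracket_sum k (framed q) - 840%:R * ninth_pt k q.

Lemma framed_lshift (R : nzRingType) (q : 'I_5 -> R * R * R) (a : 'I_3) :
  framed q (lshift 5 a) = basis_pt R a.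
Proof. by rewrite /framed (unsplitK (inl a)). Qed.

Lemma framed_rshift (R : nzRingType) (q : 'I_5 -> R * R * R) (b : 'I_5) :
  framed q (rshift 3 b) = q b.
Proof. by rewrite /framed (unsplitK (inr b)). Qed.

Lemma ord8_split (l : 'I_8) :
  (exists a : 'I_3, l = lshift 5 a) \/ (exists b : 'I_5, l = rshift 3 b).
Proof. by rewrite -[l](@splitK 3 5); case: split => a; [left | right]; exists a. Qed.

Lemma eq_defect (R : comNzRingType) k (q q' : 'I_5 -> R * R * R) :
  q =1 q' -> defect k q = defect k q'.
Proof.
move=> e; rewrite /defect (eq_ninth_pt _ e); congr (_ + _).
by apply: eq_bracket_sum => l; rewrite /framed; case: split => b; rewrite ?e.
Qed.

Lemma map_basis_pt (R S : nzRingType) (f : {rmorphism R -> S}) a :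
  map_pt f (basis_pt R a) = basis_pt S a.
Proof. by rewrite /map_pt /= !rmorph_nat. Qed.

Lemma pt_polyC_basis (R : nzRingType) a : pt_polyC (basis_pt R a) = basis_pt {poly R} a.
Proof. exact: (map_basis_pt (@polyC R)). Qed.

Lemma defect_map (R S : comNzRingType) (f : {rmorphism R -> S}) k
    (q : 'I_5 -> R * R * R) :
  defect k (fun i => map_pt f (q i)) = f (defect k q).
Proof.
rewrite /defect rmorphB rmorphM rmorph_nat ninth_pt_map -bracket_sum_map.
congr (_ + _); apply: eq_bracket_sum => l; rewrite /framed.
by case: split => b //; rewrite map_basis_pt.
Qed.

Lemma eq_lrshift35 (a : 'I_3) (b : 'I_5) : (lshift 5 a == rshift 3 b :> 'I_8) = false.
Proof. exact: eq_lrshift. Qed.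

Lemma eq_rshift35 (a b : 'I_5) : (rshift 3 a == rshift 3 b :> 'I_8) = (a == b).
Proof. exact: (inj_eq (@rshift_inj 3 5)). Qed.

Lemma framed_tperm (R : nzRingType) (q : 'I_5 -> R * R * R) a b :
  framed (q \o tperm a b) =1 framed q \o tperm (rshift 3 a) (rshift 3 b).
Proof.
move=> l /=; have [[c ->]|[c ->]] := ord8_split l.
  by rewrite tpermD ?framed_lshift //; rewrite eq_sym eq_lrshift35.
rewrite framed_rshift /=.
case: (tpermP (rshift 3 a : 'I_8) (rshift 3 b) (rshift 3 c)).
- by move/(@rshift_inj 3 5) ->; rewrite framed_rshift tpermL.
- by move/(@rshift_inj 3 5) ->; rewrite framed_rshift tpermR.
- move=> ac bc; rewrite framed_rshift tpermD //; rewrite eq_sym -eq_rshift35; exact/eqP.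
Qed.

(** Both sides are skew in the five points, so a transposition changes the defect only by a sign. *)
Lemma defect_perm_eq0 (R : comNzRingType) k (q : 'I_5 -> R * R * R) (s : 'S_5) :
  defect k q = 0 -> defect k (q \o s) = 0.
Proof.
have [ts -> _] := prod_tpermP s.
elim: ts q => [|[a b] ts IHts] q q0.
  by rewrite big_nil -[RHS]q0; apply: eq_defect => i; rewrite /= perm1.
rewrite big_cons.
rewrite (@eq_defect _ _ _ ((q \o (\prod_(t <- ts) tperm t.1 t.2)%g) \o tperm a b)); last first.
  by move=> i; rewrite /= permM.
move: {q0} (IHts q q0) => /=; set q' := q \o _ => q0.
case: (altP (a =P b)) => [->|ab].
  by rewrite -[RHS]q0; apply: eq_defect => i; rewrite /= tperm1 perm1.
rewrite /defect (eq_bracket_sum _ (framed_tperm _ _ _)) bracket_sum_perm ninth_pt_perm.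
by rewrite [odd_perm (tperm a b)]odd_tperm ab odd_tperm eq_rshift35 ab mulrCA -mulrBr -/(defect k q') q0 mulr0.
Qed.

Lemma defect_homog (R : comNzRingType) k
    (q : 'I_5 -> {mpoly R[3]} * {mpoly R[3]} * {mpoly R[3]}) j :
  (forall i, pt_homog (i == j) (q i)) -> defect k q \is 8.-homog.
Proof.
move=> hq; apply: rpredB; last first.
  by rewrite -mpolyC_nat mul_mpolyC dhomogZ // (ninth_pt_homog _ hq).
apply: (@bracket_sum_homog _ _ _ (rshift 3 j)) => l.
have [[a ->]|[b ->]] := ord8_split l.
  rewrite eq_lrshift35 framed_lshift.
  have -> : basis_pt {mpoly R[3]} a = pt_mpolyC (basis_pt R a).
    by rewrite /pt_mpolyC (map_basis_pt (@mpolyC 3 R)).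
  exact: pt_mpolyC_homog.
by rewrite eq_rshift35 framed_rshift; apply: hq.
Qed.

Section TripleVanishing.
Variables (R : idomainType) (nz2 : 2%:R != 0 :> R).
Variables (k : nat) (k3 : (k < 3)%N).
Variables (q : 'I_5 -> R * R * R) (j : 'I_5) (v : R * R * R).

Definition moved (u : R * R * R) (l : 'I_5) : {poly R} * {poly R} * {poly R} :=
  if l == j then pt_add (pt_polyC u) (pt_scale (2%:R * 'X) (pt_polyC v))
  else pt_polyC (q l).

Lemma bracket_sum_moved (i : 'I_8) u : i != rshift 3 j -> framed q i = u ->
  exists c, bracket_sum k (framed (moved u)) = 'X ^+ 3 * c.
Proof.
move=> ij <-; have [c Ec] := bracket_sum_triple k (framed q) v nz2 ij.
exists c; rewrite -Ec; apply: eq_bracket_sum => l.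
have [[a ->]|[b ->]] := ord8_split l.
  by rewrite !framed_lshift eq_lrshift35 pt_polyC_basis.
by rewrite !framed_rshift eq_rshift35.
Qed.

Lemma ninth_pt_moved i : i != j -> exists c, ninth_pt k (moved (q i)) = 'X ^+ 3 * c.
Proof.
move=> ij.
have C m : exists c, conic_det m (moved (q i)) = 'X * c.
  apply: (@row_det_line_dvd R (fun u => conic_row (iter m (@pt_rot R) u)) _ q i j v _ ij) => x u l.
  exact: (conic_row_map (horner_eval x)).
have N m : exists c, nodal_det m (moved (q i)) = 'X * c.
  apply: (@row_det_line_dvd R (fun u => cubic_row (iter m (@pt_rot R) u)) _ q i j v _ ij) => x u l.
  exact: (cubic_row_map (horner_eval x)).
rewrite /ninth_pt; have [a ->] := C k; have [b ->] := N k.+1; have [c ->] := N k.+2.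
by exists (a * b * c); ring.
Qed.

(** Brings the coordinates of a point near a frame point into the shape (x, d y, d z) of the
    divisibility lemmas, up to rotation. *)
Lemma moved_coord (b : bool) (w : {poly R}) : (b%:R : R)%:P + 2%:R * 'X * w
  = if b then 1 + 2%:R * 'X * w else 'X * (2%:R * w).
Proof. by case: b => /=; ring. Qed.

(** The order is 2 at the frame point where the cubics are singular. The bound [m < 5] covers the
    indices k + 1 and k + 2 of [ninth_pt]. *)
Lemma nodal_det_moved_frame (a : 'I_3) m : (m < 5)%N ->
  exists c, nodal_det m (moved (basis_pt R a)) = 'X ^+ (1 + (m %% 3 == a)%N) * c.
Proof.
move=> m5; apply: (@row_det_dvd _ _ _ j) => l.
rewrite /moved eqxx /pt_add /pt_scale /=.
rewrite !moved_coord.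
by case: a => a /=; case: a => [|[|[|//]]] _;
  move: m m5 => [|[|[|[|[|//]]]]] _ /=;
  first [exact: cubic_row0_dvd | exact: cubic_row1_dvd | exact: cubic_row2_dvd].
Qed.

Lemma conic_det_moved_frame :
  exists c, conic_det k (moved (basis_pt R k)) = 'X ^+ 1 * c.
Proof.
apply: (@row_det_dvd _ _ _ j) => l.
rewrite /moved eqxx /pt_add /pt_scale /=.
rewrite !moved_coord.
by move: k3; case: k => [|[|[|//]]] _; apply: conic_row0_dvd.
Qed.

Lemma ninth_pt_moved_frame (a : 'I_3) :
  exists c, ninth_pt k (moved (basis_pt R a)) = 'X ^+ 3 * c.
Proof.
have [|b Eb] := @nodal_det_moved_frame a k.+1; first by case: k k3 => [|[|[|]]].
have [|c Ec] := @nodal_det_moved_frame a k.+2; first by case: k k3 => [|[|[|]]].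
rewrite /ninth_pt Eb Ec; case: (altP (a =P k :> nat)) => [->|ak].
  have [d ->] := conic_det_moved_frame; exists (b * c * d).
  by move: k3; case: k => [|[|[|//]]] _ /=; ring.
exists (conic_det k (moved (basis_pt R a)) * b * c); move=> {Eb Ec}.
move: (conic_det _ _) => d; by move: k3 ak; case: a => a /= a3; case: k => [|[|[|//]]] _;
  move: a a3 => [|[|[|//]]] _ //= _; ring.
Qed.

Lemma defect_moved i : i != j -> exists c, defect k (moved (q i)) = 'X ^+ 3 * c.
Proof.
move=> ij; have [c Ec] := ninth_pt_moved ij.
have [||b Eb] := @bracket_sum_moved (rshift 3 i) (q i); first by rewrite eq_rshift35.
  by rewrite framed_rshift.
by exists (b - 840%:R * c); rewrite /defect Eb Ec; ring.
Qed.

Lemma defect_moved_frame (a : 'I_3) :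
  exists c, defect k (moved (basis_pt R a)) = 'X ^+ 3 * c.
Proof.
have [c Ec] := ninth_pt_moved_frame a.
have [||b Eb] := @bracket_sum_moved (lshift 5 a) (basis_pt R a).
- by rewrite eq_lrshift35.
- by rewrite framed_lshift.
by exists (b - 840%:R * c); rewrite /defect Eb Ec; ring.
Qed.
End TripleVanishing.

(* Elimination modulo a prime *)
Delimit Scope Z_scope with BZ.

Section ModularElimination.
Variable q : Z.

Definition is_zero_mod (z : Z) : bool := if Z.modulo z q is Z0 then true else false.

Fixpoint combine_rows (p h : Z) (t pt : seq Z) : seq Z :=
  match t, pt with
  | x :: t', y :: pt' =>
    Z.modulo (Z.sub (Z.mul p x) (Z.mul h y)) q :: combine_rows p h t' pt'
  | _, _ => [::]
  end.

(** Division-free elimination of the leading entry. A row whose length does not match becomes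
    [[::]], a vacuous condition, so soundness needs no invariant on lengths. *)
Definition reduce_row (p : Z) (pt : seq Z) (r : seq Z) : seq Z :=
  if r is h :: t then
    if is_zero_mod h then t
    else if eqn (size t) (size pt) then combine_rows p h t pt else [::]
  else [::].

Fixpoint pick_pivot (rows acc : seq (seq Z)) : option (Z * seq Z * seq (seq Z)) :=
  if rows is r :: rows' then
    if r is h :: t then
      if is_zero_mod h then pick_pivot rows' (r :: acc) else Some (h, t, catrev acc rows')
    else None
  else None.

(** A certificate that the rows force n unknowns to vanish. The length bound confines the pivot row
    to the unknowns that are already known to be zero when its leading one is recovered. *)
Fixpoint full_rank (n : nat) (rows : seq (seq Z)) : bool :=
  if n is n'.+1 then
    if pick_pivot rows [::] is Some (p, pt, rest) then
      (size pt <= n')%N && full_rank n' [seq reduce_row p pt r | r <- rest]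
    else false
  else true.

Variables (R : idomainType) (f : {rmorphism Z -> R}).
Hypothesis f_mod : forall z, f (Z.modulo z q) = f z.
Hypothesis f_eq0 : forall z, f z = 0 -> is_zero_mod z.

Fixpoint dot (r : seq Z) (v : nat -> R) : R :=
  if r is x :: r' then f x * v 0%N + dot r' (fun i => v i.+1) else 0.

Lemma dotE r v n : (size r <= n)%N -> dot r v = \sum_(i < n) f r`_i * v i.
Proof.
elim: r v n => [|x r IHr] v n /=.
  by move=> _; rewrite big1 // => i _; rewrite nth_nil rmorph0 mul0r.
by case: n => // n rn; rewrite big_ord_recl /= (IHr _ n).
Qed.

Lemma is_zero_modP z : is_zero_mod z -> f z = 0.
Proof.
rewrite -(f_mod z) /is_zero_mod; case: (Z.modulo z q) => // _; exact: rmorph0.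
Qed.

Lemma dot_combine p h t pt v : size t = size pt ->
  dot (combine_rows p h t pt) v = f p * dot t v - f h * dot pt v.
Proof.
elim: t pt v => [|x t IHt] [|y pt] v //=; first by rewrite !mulr0 subr0.
move=> [/IHt ->]; rewrite f_mod.
have -> : f (p * x - h * y)%BZ = f p * f x - f h * f y by rewrite -!rmorphM -rmorphB.
by ring.
Qed.

Lemma pick_pivotP rows acc p pt rest : pick_pivot rows acc = Some (p, pt, rest) ->
  f p != 0 /\ perm_eq ((p :: pt) :: rest) (rows ++ acc).
Proof.
elim: rows acc => [|[|h t] rows IHrows] acc //=.
case: ifP => [_|h0 [<- <- <-]].
  by move=> /IHrows[p0 E]; split=> //; rewrite (perm_trans E) // -cat_rcons -cats1 -catA perm_catCA.
split; last by rewrite perm_cons catrevE perm_sym perm_catC perm_cat2r perm_sym perm_rev.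
by apply/eqP => /f_eq0; rewrite h0.
Qed.

Lemma full_rankP n rows v : full_rank n rows -> {in rows, forall r, dot r v = 0} ->
  forall i, (i < n)%N -> v i = 0.
Proof.
elim: n rows v => [|n IHn] rows v //=.
case E: (pick_pivot _ _) => [[[p pt] rest]|] //= /andP[sz fr] h.
have [p0 /perm_mem mem] := pick_pivotP E.
have hp : f p * v 0%N + dot pt (fun i => v i.+1) = 0.
  by apply: (h (p :: pt)); rewrite -[rows]cats0 -mem mem_head.
have v' i : (i < n)%N -> v i.+1 = 0.
  apply: (IHn _ (fun i => v i.+1) fr) => _ /mapP[r rrest ->].
  have : dot r v = 0 by apply: h; rewrite -[rows]cats0 -mem in_cons rrest orbT.
  case: r {rrest} => [//|x t] /=; case: ifP => [/is_zero_modP -> | _].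
    by rewrite mul0r add0r.
  case: eqnP => [e hx|//]; rewrite dot_combine //.
  set a := dot t _ in hx *; set b := dot pt _ in hp *.
  have -> : f p * a - f x * b = f p * (f x * v 0%N + a) - f x * (f p * v 0%N + b) by ring.
  by rewrite hx hp !mulr0 subr0.
case=> [|i]; last by rewrite ltnS => /v'.
move=> _; move: hp; rewrite (dotE _ sz) big1 ?addr0 => [/eqP|i _]; last by rewrite v' ?mulr0.
by rewrite mulf_eq0 (negbTE p0) => /eqP.
Qed.
End ModularElimination.

(** * Octics with triple points *)

Definition monomials (d : nat) : seq (nat * nat * nat) :=
  flatten [seq [seq (a, b, d - a - b)%N | b <- iota 0 (d.+1 - a)] | a <- iota 0 d.+1].

Definition octic_monos : seq (nat * nat * nat) := monomials 8.

(* The operations are explicit so that the same code runs on Z efficiently.   *)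
Section JetOps.
Variables (T : Type) (mul add : T -> T -> T) (zero one : T).

(* (x ^ n, n x ^ (n - 1), 'C(n, 2) x ^ (n - 2)) *)
Fixpoint jet_ops (x : T) (n : nat) : T * T * T :=
  if n is n'.+1 then
    let: (a, b, c) := jet_ops x n' in
    (mul x a, add (mul x b) a, add (mul x c) b)
  else (one, zero, zero).

Definition jets_ops (u : T * T * T) : seq (T * T * T) * seq (T * T * T) * seq (T * T * T) :=
  ([seq jet_ops u.1.1 n | n <- iota 0 9], [seq jet_ops u.1.2 n | n <- iota 0 9],
   [seq jet_ops u.2 n | n <- iota 0 9]).

(** The coefficient of t ^ 2 in the monomial m at the point u + t d, from the jets of the
    coordinates of u; the entries of d are 0 or 1. *)
Definition hess_coef_ops (js : seq (T * T * T) * seq (T * T * T) * seq (T * T * T))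
    (d : bool * bool * bool) (m : nat * nat * nat) : T :=
  let z := (zero, zero, zero) in
  let: (p0, p1, p2) := nth z js.1.1 m.1.1 in
  let: (q0, q1, q2) := nth z js.1.2 m.1.2 in
  let: (r0, r1, r2) := nth z js.2 m.2 in
  let c (b : bool) (x : T) := if b then x else zero in
  add (c d.1.1 (mul p2 (mul q0 r0))) (add (c d.1.2 (mul p0 (mul q2 r0)))
  (add (c d.2 (mul p0 (mul q0 r2))) (add (c (d.1.1 && d.1.2) (mul p1 (mul q1 r0)))
  (add (c (d.1.1 && d.2) (mul p1 (mul q0 r1))) (c (d.1.2 && d.2) (mul p0 (mul q1 r1))))))).

Definition value_coef_ops (js : seq (T * T * T) * seq (T * T * T) * seq (T * T * T))
    (m : nat * nat * nat) : T :=
  let z := (zero, zero, zero) in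
  mul (mul (nth z js.1.1 m.1.1).1.1 (nth z js.1.2 m.1.2).1.1) (nth z js.2 m.2).1.1.

(** A quadratic form in three variables is determined by its values at these six vectors. So the six
    rows say that the second-order part of an octic vanishes at u, which in characteristic zero
    means a triple point, by Euler's relation. *)
Definition directions : seq (bool * bool * bool) :=
  [:: (true, false, false); (false, true, false); (false, false, true);
      (true, true, false); (true, false, true); (false, true, true)].

Definition triple_rows_ops u : seq (seq T) :=
  let js := jets_ops u in
  [seq [seq hess_coef_ops js d m | m <- octic_monos] | d <- directions].

Definition value_row_ops u : seq T :=
  let js := jets_ops u in [seq value_coef_ops js m | m <- octic_monos].
End JetOps.

Notation jet := (jet_ops *%R +%R 0 1).
Notation jets := (jets_ops *%R +%R 0 1).
Notation hess_coef := (hess_coef_ops *%R +%R 0).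
Notation value_coef := (value_coef_ops *%R 0).
Notation triple_rows := (triple_rows_ops *%R +%R 0 1).
Notation value_row := (value_row_ops *%R +%R 0 1).

Section Jets.
Variable R : comNzRingType.

Definition mono_value (u : R * R * R) (m : nat * nat * nat) : R :=
  u.1.1 ^+ m.1.1 * u.1.2 ^+ m.1.2 * u.2 ^+ m.2.

Definition dir_pt (d : bool * bool * bool) : R * R * R :=
  (d.1.1%:R, d.1.2%:R, d.2%:R).

Lemma jet_value (x : R) n : (jet x n).1.1 = x ^+ n.
Proof. by elim: n => //= n; case: (jet x n) => [[a b] c] /= ->; rewrite exprS. Qed.

Lemma octic_monosP m : m \in octic_monos ->
  [/\ (m.1.1 < 9)%N, (m.1.2 < 9)%N & (m.2 < 9)%N].
Proof.
have : all (fun m => [&& m.1.1 < 9, m.1.2 < 9 & m.2 < 9])%N octic_monos by [].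
by move/allP => h /h /and3P.
Qed.

Lemma nth_jets (x : R) n : (n < 9)%N -> nth (0, 0, 0) [seq jet x n | n <- iota 0 9] n = jet x n.
Proof. by move=> n9; rewrite (nth_map 0%N) ?size_iota // nth_iota. Qed.

Lemma value_coefE (u : R * R * R) m : m \in octic_monos -> value_coef (jets u) m = mono_value u m.
Proof. by case/octic_monosP => a b c; rewrite /value_coef !nth_jets ?jet_value. Qed.
End Jets.

Lemma jet_taylor (R : comNzRingType) (x v : R) n :
  exists r, (x%:P + 2%:R * 'X * v%:P) ^+ n
   = (jet x n).1.1%:P + 2%:R * 'X * (v * (jet x n).1.2)%:P
     + 4%:R * 'X ^+ 2 * (v ^+ 2 * (jet x n).2)%:P + 'X ^+ 3 * r.
Proof.
elim: n => [|n [r IHn]]; first by exists 0; rewrite expr0 /= !mulr0 polyC1 ?polyC0; ring.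
rewrite exprS {}IHn /=; case: (jet x n) => [[a b] c] /=.
exists (r * (x%:P + 2%:R * 'X * v%:P) + 8%:R * (v ^+ 3 * c)%:P).
rewrite !(polyCM, polyCD, rmorphXn) /=; ring.
Qed.

Lemma jet_mul (R : comNzRingType) (d a0 a1 a2 a3 b0 b1 b2 b3 c0 c1 c2 c3 : R) :
  exists r,
    (a0 + d * a1 + d ^+ 2 * a2 + d ^+ 3 * a3) * (b0 + d * b1 + d ^+ 2 * b2 + d ^+ 3 * b3)
    * (c0 + d * c1 + d ^+ 2 * c2 + d ^+ 3 * c3)
  = a0 * b0 * c0 + d * (a1 * b0 * c0 + a0 * b1 * c0 + a0 * b0 * c1)
    + d ^+ 2 * (a2 * b0 * c0 + a0 * b2 * c0 + a0 * b0 * c2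
                + a1 * b1 * c0 + a1 * b0 * c1 + a0 * b1 * c1) + d ^+ 3 * r.
Proof.
pose e0 := a0 * b0; pose e1 := a0 * b1 + a1 * b0.
pose e2 := a0 * b2 + a1 * b1 + a2 * b0.
pose e3 := a3 * (b0 + d * b1 + d ^+ 2 * b2 + d ^+ 3 * b3) + a2 * (b1 + d * b2 + d ^+ 2 * b3)
  + a1 * (b2 + d * b3) + a0 * b3.
exists (e3 * (c0 + d * c1 + d ^+ 2 * c2 + d ^+ 3 * c3) + e2 * (c1 + d * c2 + d ^+ 2 * c3)
  + e1 * (c2 + d * c3) + e0 * c3).
rewrite /e3 /e2 /e1 /e0; ring.
Qed.

Lemma hess_taylor (R : comNzRingType) (u : R * R * R) d m : m \in octic_monos ->
  exists a b r, mono_value (pt_add (pt_polyC u) (pt_scale (2%:R * 'X) (pt_polyC (dir_pt R d)))) m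
   = a%:P + 'X * b%:P + 'X ^+ 2 * (4%:R * hess_coef (jets u) d m)%:P + 'X ^+ 3 * r.
Proof.
case/octic_monosP => m1 m2 m3; rewrite /mono_value /hess_coef !nth_jets //=.
have [r1 ->] := jet_taylor u.1.1 (dir_pt R d).1.1 m.1.1.
have [r2 ->] := jet_taylor u.1.2 (dir_pt R d).1.2 m.1.2.
have [r3 ->] := jet_taylor u.2 (dir_pt R d).2 m.2.
case: (jet _ m.1.1) => [[p0 p1] p2]; case: (jet _ m.1.2) => [[q0 q1] q2].
case: (jet _ m.2) => [[s0 s1] s2]; rewrite /= /dir_pt /=.
(* The entries of a direction are 0 or 1, hence equal to their squares. *)
have sq (b : bool) : b%:R ^+ 2 = b%:R :> R by case: b; rewrite ?expr1n ?expr0n.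
rewrite !sq; move: d => [[d1 d2] d3] /=.
have dE (b : bool) (x : R) : (if b then x else 0) = b%:R * x by case: b; rewrite ?mul1r ?mul0r.
have dA (b c : bool) : (b && c)%:R = b%:R * c%:R :> R by case: b; case: c; rewrite ?mul1r ?mul0r.
rewrite !dE !dA; move: (d1%:R) (d2%:R) (d3%:R) => {sq dE dA d1 d2 d3} d1 d2 d3.
have E (a b c e : R) (r : {poly R}) :
    a%:P + 2%:R * 'X * (e * b)%:P + 4%:R * 'X ^+ 2 * (e * c)%:P + 'X ^+ 3 * r
  = a%:P + 'X * (2%:R * (e * b))%:P + 'X ^+ 2 * (4%:R * (e * c))%:P + 'X ^+ 3 * r.
  by rewrite !polyCM; ring.
rewrite !{}E; set x0 := p0%:P; set x1 := (2%:R * _)%:P; set x2 := (4%:R * _)%:P.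
set y0 := q0%:P; set y1 := (2%:R * (d2 * _))%:P; set y2 := (4%:R * (d2 * _))%:P.
set z0 := s0%:P; set z1 := (2%:R * (d3 * _))%:P; set z2 := (4%:R * (d3 * _))%:P.
have [r ->] := jet_mul 'X x0 x1 x2 r1 y0 y1 y2 r2 z0 z1 z2 r3.
exists (p0 * q0 * s0), (2%:R * (d1 * p1) * q0 * s0 + p0 * (2%:R * (d2 * q1)) * s0 + p0 * q0 * (2%:R * (d3 * s1))), r.
rewrite -!polyCM -!polyCD; congr (_ + _ * _ + _ * _%:P + _); ring.
Qed.

Definition mnm_of (m : nat * nat * nat) : 'X_{1..3} :=
  [multinom nth 0%N [:: m.1.1; m.1.2; m.2] i | i < 3].

Lemma mnm_of_inj : injective mnm_of.
Proof.
move=> [[a b] c] [[a' b'] c'] /mnmP h.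
have := h (@Ordinal 3 0 isT); have := h (@Ordinal 3 1 isT); have := h (@Ordinal 3 2 isT).
by rewrite !mnmE /= => -> -> ->.
Qed.

Lemma mdeg_mnm_of d m : m \in monomials d -> mdeg (mnm_of m) = d.
Proof.
move=> /flatten_mapP[a]; rewrite mem_iota => /andP[_ ad] /mapP[b].
rewrite mem_iota => /andP[_ bd] ->; rewrite mdegE !big_ord_recl big_ord0 !mnmE /=.
by move: ad bd; lia.
Qed.

Lemma monomials_mnm d (k : 'X_{1..3}) : mdeg k = d ->
  exists2 m, m \in monomials d & mnm_of m = k.
Proof.
rewrite mdegE !big_ord_recl big_ord0 addn0.
set a := k _; set b := k _; set c := k _ => abc.
exists (a, b, c); last first.
  apply/mnmP => i; rewrite mnmE /=; case: i => [[|[|[|//]]] i3] /=; congr (k _);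
  exact: val_inj.
apply/flatten_mapP; exists a; first by rewrite mem_iota; lia.
by apply/mapP; exists b; [rewrite mem_iota; lia | congr (_, _, _); lia].
Qed.

Lemma uniq_monomials d : uniq (monomials d).
Proof.
apply: allpairs_uniq_dep => [|a _|]; rewrite ?iota_uniq //.
by move=> [a b] [a' b'] _ _ /= [-> ->].
Qed.

Section HomogExpansion.
Variables (R S : comNzRingType) (f : {rmorphism R -> S}) (d : nat) (p : {mpoly R[3]}).
Hypothesis pd : p \is d.-homog.

Lemma homog_expand :
  p = \sum_(m <- monomials d) p@_(mnm_of m) *: 'X_[mnm_of m].
Proof.
apply/mpolyP => k; rewrite raddf_sum /=.
case: (eqVneq (mdeg k) d) => [/monomials_mnm[m mM <-]|kd].
  rewrite (bigD1_seq m) ?uniq_monomials //= mcoeffZ mcoeffX eqxx mulr1 big1 ?addr0 // => m' m'm.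
  by rewrite mcoeffZ mcoeffX (inj_eq mnm_of_inj) (negbTE m'm) mulr0.
rewrite (dhomog_nemf_coeff pd kd) big_seq big1 // => m /mdeg_mnm_of md.
rewrite mcoeffZ mcoeffX; case: eqP => [e|]; last by rewrite mulr0.
by move: kd; rewrite -e md eqxx.
Qed.

Lemma homog_mmap (u : S * S * S) :
  mmap f (fun i : 'I_3 => nth 0 [:: u.1.1; u.1.2; u.2] i) p
  = \sum_(m <- monomials d) f p@_(mnm_of m) * mono_value u m.
Proof.
rewrite [in LHS]homog_expand raddf_sum /=; apply: eq_bigr => m _.
rewrite mmapZ mmapX; congr (_ * _); rewrite /mmap1 !big_ord_recl big_ord0 !mnmE /=.
by rewrite /mono_value mulr1 mulrA.
Qed.
End HomogExpansion.

(** * The defect as an octic in one point, and its interpolation *)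

Definition with_pt (T : Type) (q : 'I_5 -> T) (j : 'I_5) (u : T) : 'I_5 -> T :=
  fun l => if l == j then u else q l.

Definition octic_coef (R : comNzRingType) k (q : 'I_5 -> R * R * R) (j : 'I_5) m : R :=
  (defect k (with_pt (fun l => pt_mpolyC (q l)) j (generic_pt R)))@_(mnm_of m).

(** The morphism [f] allows the point j to be inserted in R itself, for values, or in {poly R}, for
    Taylor expansions. *)
Lemma defect_octic (R S : comNzRingType) (f : {rmorphism R -> S}) k
    (q : 'I_5 -> R * R * R) (j : 'I_5) (u : S * S * S) :
  defect k (with_pt (fun l => map_pt f (q l)) j u)
  = \sum_(m <- octic_monos) f (octic_coef k q j m) * mono_value u m.
Proof.
rewrite -(@homog_mmap _ _ f 8) -?defect_map.
  apply: eq_defect => l; rewrite /with_pt; case: eqP => _.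
    case: u => [[x y] z]; rewrite /map_pt /generic_pt /= !mmapX !mmap1U /=.
    by [].
  by rewrite /pt_mpolyC /map_pt /= !mmapC.
apply: (@defect_homog _ _ _ j) => l; rewrite /with_pt; case: eqP => _.
  exact: generic_pt_homog.
exact: pt_mpolyC_homog.
Qed.

(** Chosen such that any four of them as triple points and the other three as zeros pass the test
    [samples_unisolvent]. *)
Definition sample_pts : seq (Z * Z * Z) :=
  [:: (1, -2, 2); (1, 1, 0); (-2, 2, 1); (2, 1, 2); (-1, -1, 2); (0, -2, 1); (-1, 0, 2)]%BZ.

Fixpoint sublists (T : Type) (l : seq T) (n : nat) : seq (seq T) :=
  match n, l with
  | 0, _ => [:: [::]]
  | _, [::] => [::]
  | n'.+1, x :: l' => [seq x :: s | s <- sublists l' n'] ++ sublists l' n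
  end.

(** Each of the 35 systems has 18 rows for the frame, 24 for four samples and 3 for values. Full
    rank modulo the single prime 37 already shows that the integer determinant is nonzero. *)
Definition samples_unisolvent : bool :=
  let rowsH := triple_rows_ops Z.mul Z.add 0%BZ 1%BZ in
  let rowV := value_row_ops Z.mul Z.add 0%BZ 1%BZ in
  let F := flatten [seq rowsH u | u <- [:: (1, 0, 0); (0, 1, 0); (0, 0, 1)]%BZ] in
  let H := [seq rowsH u | u <- sample_pts] in
  let V := [seq rowV u | u <- sample_pts] in
  all (fun A => full_rank 37%BZ 45 (F ++ flatten [seq nth [::] H a | a <- A]
     ++ [seq nth [::] V b | b <- iota 0 7 & b \notin A])) (sublists (iota 0 7) 4).

Lemma samples_unisolventT : samples_unisolvent.
Proof. by vm_cast_no_check (erefl true). Qed.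

Lemma mem_sublists (T : eqType) (s l : seq T) : subseq s l -> s \in sublists l (size s).
Proof.
elim: l s => [|x l IHl] [|y s] //=; case: eqP => [-> h|_ h]; rewrite mem_cat.
  by apply/orP; left; apply: map_f; apply: IHl.
by apply/orP; right; apply: (IHl (y :: s)).
Qed.

Section Rows.
Variables (R S : comNzRingType) (f : {rmorphism R -> S}).

Lemma jet_map x n : jet (f x) n = map_pt f (jet x n).
Proof.
elim: n => [|n IHn] /=; first by rewrite /map_pt /= rmorph1 rmorph0.
by rewrite IHn; case: (jet x n) => [[a b] c]; rewrite /map_pt /= !rmorphD !rmorphM.
Qed.

Lemma jets_map u : jets (map_pt f u)
  = ([seq map_pt f p | p <- (jets u).1.1], [seq map_pt f p | p <- (jets u).1.2],
     [seq map_pt f p | p <- (jets u).2]).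
Proof.
rewrite /jets_ops; cbn [fst snd]; congr (_, _, _); rewrite -map_comp; apply: eq_map => n;
  exact: jet_map.
Qed.

Lemma nth_map_pt (s : seq (R * R * R)) i :
  nth (0, 0, 0) [seq map_pt f p | p <- s] i = map_pt f (nth (0, 0, 0) s i).
Proof.
have -> : (0, 0, 0) = map_pt f (0, 0, 0) by rewrite /map_pt /= rmorph0.
case: (ltnP i (size s)) => h; first by rewrite (nth_map (0, 0, 0)).
by rewrite !nth_default ?size_map.
Qed.

Lemma triple_rows_map u :
  triple_rows (map_pt f u) = [seq map f r | r <- triple_rows u].
Proof.
rewrite /triple_rows_ops -map_comp; apply: eq_map => d.
rewrite [RHS]/comp -map_comp; apply: eq_map => m; rewrite [RHS]/comp jets_map.
move: (jets u) => [[A B] C]; rewrite /hess_coef_ops /= !nth_map_pt.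
case: (nth _ _ _) => [[p0 p1] p2]; case: (nth _ _ _) => [[q0 q1] q2].
case: (nth _ _ _) => [[r0 r1] r2]; rewrite /map_pt /=.
by do 5!(rewrite rmorphD); case: d => [[[] []] []] /=; rewrite ?rmorph0 ?rmorphM.
Qed.

Lemma value_row_map u : value_row (map_pt f u) = map f (value_row u).
Proof.
rewrite /value_row_ops -map_comp; apply: eq_map => m.
rewrite [RHS]/comp jets_map; move: (jets u) => [[A B] C].
by rewrite /value_coef_ops /= !nth_map_pt /map_pt /= !rmorphM.
Qed.
End Rows.

Definition linear_system (R : comNzRingType) (us vs : seq (R * R * R)) : seq (seq R) :=
  flatten [seq triple_rows u | u <- us] ++ [seq value_row v | v <- vs].

Lemma linear_system_map (R S : comNzRingType) (f : {rmorphism R -> S}) us vs :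
  linear_system (map (map_pt f) us) (map (map_pt f) vs)
  = [seq map f r | r <- linear_system us vs].
Proof.
rewrite /linear_system map_cat map_flatten -!map_comp; congr (flatten _ ++ _).
  by apply: eq_map => u /=; rewrite triple_rows_map.
by apply: eq_map => u /=; rewrite value_row_map.
Qed.

Definition system_mx (R : comNzRingType) (us vs : seq (R * R * R)) : 'M[R]_45 :=
  \matrix_(i, j) (nth [::] (linear_system us vs) i)`_j.

Lemma system_mx_map (R S : comNzRingType) (f : {rmorphism R -> S}) us vs :
  system_mx (map (map_pt f) us) (map (map_pt f) vs) = map_mx f (system_mx us vs).
Proof.
apply/matrixP => i j; rewrite !mxE linear_system_map.
case: (ltnP i (size (linear_system us vs))) => hi; last first.
  by rewrite !(nth_default [::]) ?size_map // !nth_nil rmorph0.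
rewrite (nth_map [::]) //; set r := nth [::] _ _.
case: (ltnP j (size r)) => hj; last by rewrite !nth_default ?size_map ?rmorph0.
by rewrite (nth_map 0).
Qed.

Definition sample (a : nat) : Z * Z * Z := nth (0, 0, 0) sample_pts a.

Definition frame_pts (R : nzRingType) : seq (R * R * R) :=
  [seq basis_pt R a | a <- iota 0 3].

(* Rows of the linear system read as linear forms in the coefficients of an  *)
(* octic.                                                                     *)
Definition kills (R : comNzRingType) (w : nat -> R) (r : seq R) : Prop :=
  \sum_(i < 45) r`_i * w i = 0.

Lemma size_linear_system (R : comNzRingType) (us vs : seq (R * R * R)) :
  size (linear_system us vs) = (6 * size us + size vs)%N.
Proof.
rewrite size_cat size_map size_flatten /shape -map_comp.
congr (_ + _)%N; elim: us => //= u us ->; by rewrite mulnS.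
Qed.

Lemma system_mx_kills (R : comNzRingType) us vs (w : nat -> R) :
  {in linear_system us vs, forall r, kills w r} ->
  (6 * size us + size vs)%N = 45%N ->
  system_mx us vs *m \col_i w i = 0.
Proof.
move=> h sz; apply/colP => i; rewrite !mxE -[RHS](h (nth [::] (linear_system us vs) i)).
  by apply: eq_bigr => j _; rewrite !mxE.
by rewrite mem_nth // size_linear_system sz.
Qed.

Lemma det_kills (R : idomainType) us vs (w : nat -> R) :
  \det (system_mx us vs) != 0 ->
  {in linear_system us vs, forall r, kills w r} ->
  (6 * size us + size vs)%N = 45%N ->
  forall i, (i < 45)%N -> w i = 0.
Proof.
move=> d0 h sz i i45; have /(congr1 (mulmx (\adj (system_mx us vs)))) := system_mx_kills h sz.
rewrite mulmxA mul_adj_mx mulmx0 mul_scalar_mx => /colP/(_ (Ordinal i45)).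
by rewrite !mxE => /eqP; rewrite mulf_eq0 (negbTE d0) => /eqP.
Qed.

Lemma F37_mod (z : Z) : ((int_of_Z (Z.modulo z 37))%:~R = (int_of_Z z)%:~R :> 'F_37).
Proof.
rewrite [in RHS](Z.div_mod z 37) // rmorphD rmorphM rmorphD rmorphM /=.
have -> : (int_of_Z 37)%:~R = 0 :> 'F_37 by apply/val_inj.
by rewrite mul0r add0r.
Qed.

Lemma F37_eq0 (z : Z) : (int_of_Z z)%:~R = 0 :> 'F_37 -> is_zero_mod 37 z.
Proof.
rewrite -F37_mod /is_zero_mod; have : (0 <= Z.modulo z 37 < 37)%BZ by apply: Z.mod_pos_bound.
case: (Z.modulo z 37) => // p; last by lia.
move=> hp /eqP; rewrite /= -[_%:~R]/((Pos.to_nat p)%:R).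
rewrite -(dvdn_pcharf (pchar_Fp (isT : prime 37))) => /dvdn_leq; lia.
Qed.

Lemma size_linear_system_row (R : comNzRingType) us vs (r : seq R) :
  r \in linear_system us vs -> size r = 45%N.
Proof.
rewrite mem_cat => /orP[/flatten_mapP[u _ /mapP[d _ ->]]|/mapP[u _ ->]];
  by rewrite size_map.
Qed.

Lemma det_eq0_kills (R : idomainType) us vs : (6 * size us + size vs)%N = 45%N ->
  (forall w : nat -> R, {in linear_system us vs, forall r, kills w r} ->
     forall i, (i < 45)%N -> w i = 0) ->
  \det (system_mx us vs) != 0.
Proof.
move=> sz h; rewrite -det_tr; apply/det0P => -[v v0 /matrixP vM].
case/negP: v0; apply/eqP/rowP => i; rewrite mxE.
pose w n := v 0 (inord n); rewrite -[v 0 i]/(v 0 i) -[i]inord_val -/(w i).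
apply: h => // r /(nthP [::])[k]; rewrite size_linear_system sz => k45 <-.
have := vM 0 (Ordinal k45); rewrite [RHS]mxE mxE => E; rewrite /kills -[RHS]E.
by apply: eq_bigr => j _; rewrite mulrC /w inord_val 2!mxE.
Qed.

Definition sample_compl (A : seq nat) : seq nat := [seq b <- iota 0 7 | b \notin A].

Lemma det_samples A : A \in sublists (iota 0 7) 4 ->
  \det (system_mx (frame_pts Z ++ map sample A) (map sample (sample_compl A))) != 0.
Proof.
move=> Asub; have /allP/(_ A Asub) fr := samples_unisolventT.
have szA : (6 * size (frame_pts Z ++ map sample A) + size (map sample (sample_compl A)))%N = 45%N.
  have : all (fun A => (6 * size (frame_pts Z ++ map sample A) + size (map sample (sample_compl A)) == 45)%N) (sublists (iota 0 7) 4) by [].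
  by move/allP/(_ A Asub)/eqP.
pose f : {rmorphism Z -> 'F_37} := intr \o int_of_Z.
apply/negP => /eqP d0.
have : \det (system_mx (map (map_pt f) (frame_pts Z ++ map sample A)) (map (map_pt f) (map sample (sample_compl A)))) == 0.
  by rewrite system_mx_map det_map_mx d0 rmorph0.
apply/negP/det_eq0_kills => [|w]; first by rewrite [size (map _ (_ ++ _))]size_map [X in (_ + X)%N]size_map.
rewrite linear_system_map => hw.
apply: (full_rankP (f := f) F37_mod F37_eq0 fr) => r rin.
have {}rin : r \in flatten [seq triple_rows u | u <- frame_pts Z]
    ++ flatten [seq nth [::] [seq triple_rows u | u <- sample_pts] a | a <- A]
    ++ [seq nth [::] [seq value_row u | u <- sample_pts] b | b <- sample_compl A].
  exact: rin.
have rs : r \in linear_system (frame_pts Z ++ map sample A) (map sample (sample_compl A)).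
  have sA : {subset A <= iota 0 7}.
    have : all (all (mem (iota 0 7))) (sublists (iota 0 7) 4) by [].
    by move/allP/(_ A Asub)/allP.
  have H (T : Type) (g : Z * Z * Z -> seq T) a : a \in iota 0 7 ->
      nth [::] [seq g u | u <- sample_pts] a = g (sample a).
    by rewrite mem_iota => a7; rewrite (nth_map (0, 0, 0)).
  have K (T : eqType) (x : T) a b c d e : x \in a ++ b ++ c ->
      {subset b <= d} -> {subset c <= e} -> x \in (a ++ d) ++ e.
    rewrite !mem_cat => /or3P[-> //|/[swap] h1 /h1->|/[swap] _ /[swap] h1 /h1->];
    by rewrite ?orbT.
  rewrite /linear_system map_cat flatten_cat; apply: K rin _ _ => {}r.
    move=> /flatten_mapP[a aA]; rewrite H ?sA // => rin.
    by apply/flatten_mapP; exists (sample a) => //; apply: map_f.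
  move=> /mapP[b bB ->]; rewrite H; first by apply: map_f; apply: map_f.
  by move: bB; rewrite mem_filter => /andP[].
have := hw (map f r) (map_f _ rs); rewrite /kills => <-.
rewrite (@dotE _ f r w 45); last by rewrite (size_linear_system_row rs).
apply: eq_bigr => i _; rewrite (nth_map 0) // (size_linear_system_row rs); exact: ltn_ord.
Qed.

(** Characteristic zero, in a form that passes to polynomial rings. *)
Definition nat_faithful (R : nzRingType) : Prop :=
  forall n, (n%:R == 0 :> R) = (n == 0)%N.

Lemma nat_faithful_poly (R : nzRingType) : nat_faithful R -> nat_faithful {poly R}.
Proof. by move=> h n; rewrite -polyC_natr polyC_eq0 h. Qed.

Definition Zinj (R : nzRingType) : {rmorphism Z -> R} := intr \o int_of_Z.

Lemma Zinj_eq0 (R : nzRingType) z : nat_faithful R -> Zinj R z = 0 -> z = 0.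
Proof.
move=> h /eqP E; rewrite -[z]int_of_ZK; move: E; rewrite /Zinj /=.
case: (int_of_Z z) => n.
  by rewrite -[_%:~R]/(n%:R) h => /eqP ->.
by rewrite NegzE mulrNz oppr_eq0 -[_%:~R]/(n.+1%:R) h.
Qed.

Definition sample_in (R : nzRingType) (a : nat) : R * R * R := map_pt (Zinj R) (sample a).

Lemma polyC_sample (R : nzRingType) a : pt_polyC (sample_in R a) = sample_in {poly R} a.
Proof. by congr (_, _, _); rewrite /= rmorph_int. Qed.

Lemma map_pt_id (R : Type) (u : R * R * R) : map_pt id u = u.
Proof. by case: u => [[]]. Qed.

Section OcticConditions.
Variables (R : idomainType) (R0 : nat_faithful R).

Lemma value_row_kills k (q : 'I_5 -> R * R * R) j u :
  defect k (with_pt q j u) = 0 ->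
  kills (fun i => octic_coef k q j (nth (0, 0, 0)%N octic_monos i)) (value_row u).
Proof.
have -> : defect k (with_pt q j u) = defect k (with_pt (fun l => map_pt idfun (q l)) j u).
  by apply: eq_defect => l; rewrite /with_pt map_pt_id.
rewrite (defect_octic idfun) (big_nth (0, 0, 0)%N) big_mkord => E; rewrite /kills -[RHS]E.
apply: eq_bigr => i _; have im := @mem_nth _ (0, 0, 0)%N octic_monos i (ltn_ord i).
by rewrite (nth_map (0, 0, 0)%N) // value_coefE // mulrC.
Qed.

(** Along u + 2 X d the coefficient of X ^ 2 in the defect is 4 times the row of d applied to the
    coefficients of the octic, and 4 can be cancelled. *)
Lemma triple_rows_kill k (q : 'I_5 -> R * R * R) j u :
  (forall v, exists c, defect k (moved q j v u) = 'X ^+ 3 * c) ->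
  {in triple_rows u, forall r,
    kills (fun i => octic_coef k q j (nth (0, 0, 0)%N octic_monos i)) r}.
Proof.
move=> h _ /mapP[d _ ->]; have [c] := h (dir_pt R d).
rewrite -[defect _ _]/(defect k (with_pt (fun l => pt_polyC (q l)) j _)).
rewrite (defect_octic (@polyC R)) (big_nth (0, 0, 0)%N) big_mkord.
move=> /polyP/(_ 2%N); rewrite coefXnM [(2 < 3)%N]/= coef_sum => E.
apply: (@mulfI _ 4%:R); first by rewrite R0.
rewrite /kills mulr0 -[RHS]E mulr_sumr {E}; apply: eq_bigr => i _.
have im := @mem_nth _ (0, 0, 0)%N octic_monos i (ltn_ord i).
rewrite (nth_map (0, 0, 0)%N) //; have [a [b [r ->]]] := hess_taylor u d im.
rewrite coefCM !coefD coefC coefXM !coefXnM /= !coefC /=.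
by rewrite add0r addr0; ring.
Qed.

End OcticConditions.

Section Interpolation.
Variables (R : idomainType) (R0 : nat_faithful R).

Lemma map_frame_pts (S T : nzRingType) (f : {rmorphism S -> T}) :
  [seq map_pt f u | u <- frame_pts S] = frame_pts T.
Proof. by rewrite -map_comp; apply: eq_map => a; apply: map_basis_pt. Qed.

Lemma defect_interpolation k (q : 'I_5 -> {poly R} * {poly R} * {poly R}) j (a : 'I_5 -> nat) :
  (k < 3)%N ->
  {in predC1 j &, injective a} -> {in predC1 j, forall i, (a i < 7)%N} ->
  {in predC1 j, forall i, map_pt (horner_eval 0) (q i) = sample_in R (a i)} ->
  (forall b, (b < 7)%N -> {in predC1 j, forall i, a i != b} ->
     defect k (with_pt q j (sample_in {poly R} b)) = 0) ->
  defect k q = 0.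
Proof.
move=> k3 a_inj a7 q0 van.
pose A := [seq a i | i <- enum (predC1 j)].
(* In increasing order the starting indices form one of the lists that were checked; [ia] recovers
   the point that starts at a given sample. *)
pose A' := [seq x <- iota 0 7 | x \in A].
pose ia x := odflt j [pick i in predC1 j | a i == x].
have iaP x : x \in A' -> ia x \in predC1 j /\ a (ia x) = x.
  rewrite mem_filter => /andP[/mapP[i]]; rewrite mem_enum => ij -> _.
  rewrite /ia; case: pickP => [i' /andP[ij' /eqP e]|/(_ i)]; first by rewrite /= e.
  by rewrite /= ij eqxx.
have szA' : size A' = 4%N.
  have -> : size A' = size A.
    apply/perm_size/uniq_perm; first by rewrite filter_uniq ?iota_uniq.
      by rewrite map_inj_in_uniq ?enum_uniq // => x y; rewrite !mem_enum; apply: a_inj.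
    move=> x; rewrite mem_filter mem_iota; apply: andb_idr => /mapP[i].
    by rewrite mem_enum => ij ->; apply: a7.
  by rewrite size_map -cardE cardC1 card_ord.
pose us := frame_pts {poly R} ++ [seq q (ia x) | x <- A'].
pose vs := [seq sample_in {poly R} b | b <- sample_compl A'].
pose w n := octic_coef k q j (nth (0, 0, 0)%N octic_monos n).
have A'sub : A' \in sublists (iota 0 7) 4 
  by have := mem_sublists (filter_subseq (fun x => x \in A) (iota 0 7)); rewrite -/A' szA'.
have sz : (6 * size us + size vs = 45)%N.
  rewrite size_cat !size_map szA' /sample_compl.
  have : all (fun A => size [seq b <- iota 0 7 | b \notin A] == 3)%N (sublists (iota 0 7) 4) by [].
  by move/allP/(_ A' A'sub)/eqP => ->.
have det0 : \det (system_mx us vs) != 0.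
  apply/eqP => d0; case/eqP: (det_samples A'sub); apply: (Zinj_eq0 R0).
  rewrite -det_map_mx -system_mx_map map_cat map_frame_pts.
  have -> : [seq map_pt (Zinj R) u | u <- map sample A']
      = [seq map_pt (horner_eval 0) u | u <- [seq q (ia x) | x <- A']].
    rewrite -!map_comp; apply/eq_in_map => x /iaP[xj xa].
    by rewrite /= q0 // xa.
  have -> : [seq map_pt (Zinj R) u | u <- map sample (sample_compl A')]
      = [seq map_pt (horner_eval 0) u | u <- vs].
    rewrite -!map_comp; apply: eq_map => b.
    by rewrite /= -polyC_sample; congr (_, _, _); rewrite /= [horner_eval _ _]hornerC.
  rewrite -(map_frame_pts (horner_eval (0 : R))) -map_cat system_mx_map det_map_mx d0.
  exact: rmorph0.
have w0 : forall n, (n < 45)%N -> w n = 0.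
  apply: (det_kills det0 _ sz) => r; rewrite mem_cat => /orP[/flatten_mapP[u]|/mapP[v]].
    rewrite mem_cat => uin; apply: triple_rows_kill; first exact: nat_faithful_poly.
    have nz2 : 2%:R != 0 :> {poly R} by rewrite (nat_faithful_poly R0).
    move=> v; case/orP: uin => [/mapP[b]|/mapP[x /iaP[xj _] ->]].
      rewrite mem_iota => b3 ->.
      exact: (defect_moved_frame nz2 k3 q j v (Ordinal (b3 : (b < 3)%N))).
    exact: defect_moved.
  move=> /mapP[b bA' ->] ->; apply/value_row_kills/van.
    by move: bA'; rewrite mem_filter mem_iota => /andP[].
  move=> i ij; move: bA'; rewrite mem_filter => /andP[+ b7]; apply: contraNneq => e.
  by rewrite mem_filter b7 andbT; apply/mapP; exists i; rewrite ?mem_enum.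
have -> : defect k q = defect k (with_pt (fun l => map_pt idfun (q l)) j (q j)).
  by apply: eq_defect => l; rewrite /with_pt map_pt_id; case: eqP => [->|].
rewrite (defect_octic idfun) (big_nth (0, 0, 0)%N) big_mkord big1 // => i _.
by rewrite [X in X * _](w0 i (ltn_ord i)) mul0r.
Qed.

End Interpolation.

(* The triples grouped by their largest index. *)
Definition level_triples : seq (seq (nat * nat * nat)) :=
  [:: [::]; [::]; [:: (1, 2, 0)]; [:: (2, 3, 0)]; [:: (3, 4, 0); (1, 2, 4); (3, 4, 1)];
      [:: (4, 5, 0); (2, 3, 5); (4, 5, 2)];
      [:: (5, 6, 0); (3, 4, 6); (5, 6, 1); (1, 2, 6); (5, 6, 3)];
      [:: (6, 7, 0); (7, 1, 0); (4, 5, 7); (6, 7, 2); (7, 1, 3); (2, 3, 7);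
          (6, 7, 4); (7, 1, 5)]]%N.

(** * Evaluation of both sides at integer points *)

Section Steps.
Variables (T : Type) (mul : T -> T -> T) (zero one : T).

(** The first place belongs to the point outside the brackets: keeping only the orderings with i
    there gives the coefficient of the point i. At each later place the brackets that it completes
    are multiplied, so a zero bracket cuts the branch as early as possible. *)
Definition bracket_step (lev : seq (seq (nat * nat * nat)))
   (brf : nat -> nat -> nat -> T) (i : nat) (acc : seq nat) : T :=
  if acc is [:: x] then if eqn x i then one else zero else
  let l := rev acc in
  foldr (fun t x => mul (brf (nth 0 l t.1.1) (nth 0 l t.1.2) (nth 0 l t.2)) x)
    one (nth [::] lev (size acc).-1).

Definition det_step (rows : seq (seq T)) (acc : seq nat) : T :=
  nth zero (nth [::] rows (size acc).-1) (head 0%N acc).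
End Steps.

Lemma enum_ord_inord n : enum 'I_n.+1 = [seq inord i | i <- iota 0 n.+1].
Proof.
rewrite -val_enum_ord -map_comp -[LHS]map_id; apply: eq_map => i /=.
by rewrite inord_val.
Qed.

Lemma bracket_sum_altsum (R : comNzRingType) k (p : 'I_8 -> R * R * R)
  (brf : nat -> nat -> nat -> R) (isz : R -> bool) :
  (forall x, isz x -> x = 0 :> R) ->
  (forall x y z : 'I_8, brf x y z = br (p x) (p y) (p z)) ->
  bracket_sum k p = \sum_(i < 8) coord k (p i) *
    altsum (bracket_step *%R 0 1 level_triples brf i) *%R (fun x y => x - y) isz
      8 [::] [seq nat_of_ord i | i <- enum 'I_8] 1.
Proof.
move=> iszP brfE; under [RHS]eq_bigr => i _ do
  rewrite (altsumE _ iszP) mul1r mulr_sumr.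
rewrite exchange_big; apply: eq_bigr => s _ /=.
pose i0 := s (inord 0); rewrite (bigD1 i0) //= big1 ?addr0 => [|i ii0]; last first.
  rewrite enum_ord_inord /=.
  have -> : eqn (s (inord 0)) i = false by apply/negbTE; apply: contra ii0 => /eqnP/val_inj <-.
  by rewrite !mul0r !mulr0.
rewrite [RHS]mulrCA; congr (_ * _); rewrite [RHS]mulrC /bracket_term; congr (_ * _).
rewrite enum_ord_inord /= /level_triples /bracket_step /=.
have -> : eqn (s (inord 0)) i0 by apply/eqnP.
rewrite !brfE !big_cons big_nil /=.
ring.
Qed.

Lemma row_det_altsum (R : comNzRingType) (r : R * R * R -> seq R) (q : 'I_5 -> R * R * R)
  (isz : R -> bool) :
  (forall x, isz x -> x = 0 :> R) ->
  row_det r q = altsum (det_step 0 [seq r (q i) | i <- enum 'I_5]) *%R (fun x y => x - y) isz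
      5 [::] [seq nat_of_ord i | i <- enum 'I_5] 1.
Proof.
move=> iszP; rewrite (altsumE _ iszP) mul1r; apply: eq_bigr => s _; congr (_ * _).
rewrite enum_ord_inord /= /det_step /= !big_ord_recl big_ord0 !mxE.
by do 5!(congr (_ * _); first by congr ((r (q _))`_(s _)); apply: val_inj; rewrite /= inordK).
Qed.

Definition Z_br (u v w : Z * Z * Z) : Z :=
  (u.1.1 * (v.1.2 * w.2 - v.2 * w.1.2) - u.1.2 * (v.1.1 * w.2 - v.2 * w.1.1)
  + u.2 * (v.1.1 * w.1.2 - v.1.2 * w.1.1))%BZ.

Definition Z_conic_row (u : Z * Z * Z) : seq Z :=
  let: (x, y, z) := u in [:: x * y; x * z; y * y; y * z; z * z]%BZ.
Definition Z_cubic_row (u : Z * Z * Z) : seq Z :=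
  let: (x, y, z) := u in
  [:: x * y * y; x * y * z; x * z * z; y * y * z; y * z * z]%BZ.

Definition Z_altsum (T : Type) (step : seq T -> Z) :=
  altsum (R := Z) step Z.mul Z.sub (Z.eqb 0).

Definition Z_row_det (rows : seq (seq Z)) : Z :=
  Z_altsum (det_step 0%BZ rows) 5 [::] (iota 0 5) 1%BZ.

Definition Z_bracket_coefs (ps : seq (Z * Z * Z)) : seq Z :=
  let tab := [seq [seq [seq Z_br u v w | w <- ps] | v <- ps] | u <- ps] in
  let brf i j k := nth 0%BZ (nth [::] (nth [::] tab i) j) k in
  [seq Z_altsum (bracket_step Z.mul 0%BZ 1%BZ level_triples brf i) 8 [::] (iota 0 8) 1%BZ
     | i <- iota 0 8].

Definition Z_ninth_pt k (ps : seq (Z * Z * Z)) : Z :=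
  (Z_row_det [seq Z_conic_row (iter k (@pt_rot Z) u) | u <- ps]
  * Z_row_det [seq Z_cubic_row (iter k.+1 (@pt_rot Z) u) | u <- ps]
  * Z_row_det [seq Z_cubic_row (iter k.+2 (@pt_rot Z) u) | u <- ps])%BZ.

Definition Z_defect_eq0 (ps : seq (Z * Z * Z)) : bool :=
  let fs := [:: (1, 0, 0); (0, 1, 0); (0, 0, 1)]%BZ ++ ps in
  let cs := Z_bracket_coefs fs in
  all (fun k => Z.eqb
    (foldr Z.add 0%BZ [seq Z.mul (if k is k'.+1 then if k' is _.+1 then x.1.2 else x.1.1.2 else x.1.1.1) x.2 | x <- zip fs cs])
    (840 * Z_ninth_pt k ps)%BZ) (iota 0 3).

Lemma samples_defect : all (fun A => Z_defect_eq0 (map sample A)) (sublists (iota 0 7) 5).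
Proof. by vm_cast_no_check (erefl true). Qed.

Lemma Z_eqb0 z : Z.eqb 0 z -> z = 0.
Proof. by move=> /Z.eqb_spec <-. Qed.

Lemma Z_altsumE (step : seq nat -> Z) n l :
  Z_altsum step n [::] l 1%BZ
  = altsum step *%R (fun x y => x - y) (Z.eqb 0) n [::] l 1.
Proof. by []. Qed.

Lemma Z_row_detE (r : Z * Z * Z -> seq Z) (q : 'I_5 -> Z * Z * Z) :
  Z_row_det [seq r (q i) | i <- enum 'I_5] = row_det r q.
Proof. by rewrite (row_det_altsum _ _ Z_eqb0) val_enum_ord. Qed.

Lemma Z_ninth_ptE k (q : 'I_5 -> Z * Z * Z) :
  Z_ninth_pt k [seq q i | i <- enum 'I_5] = ninth_pt k q.
Proof.
rewrite /ninth_pt /conic_det /nodal_det -!Z_row_detE /Z_ninth_pt -!map_comp.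
by congr (Z.mul (Z.mul (Z_row_det _) (Z_row_det _)) (Z_row_det _)); apply: eq_map => i /=;
  case: (iter _ _ _) => [[x y] z].
Qed.

Lemma Z_bracket_coefsE k (p : 'I_8 -> Z * Z * Z) : (k < 3)%N ->
  foldr Z.add 0%BZ [seq Z.mul (if k is k'.+1 then if k' is _.+1 then x.1.2 else x.1.1.2 else x.1.1.1) x.2
     | x <- zip [seq p i | i <- enum 'I_8] (Z_bracket_coefs [seq p i | i <- enum 'I_8])]
  = bracket_sum k p.
Proof.
move=> k3.
pose ps := [seq p i | i <- enum 'I_8].
pose tab := [seq [seq [seq Z_br u v w | w <- ps] | v <- ps] | u <- ps].
pose brf i j k := nth 0%BZ (nth [::] (nth [::] tab i) j) k.
have nthps (T : Type) d (f : Z * Z * Z -> T) (i : 'I_8) : nth d [seq f u | u <- ps] i = f (p i).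
  by rewrite /ps -map_comp (nth_map ord0) ?size_enum_ord // nth_ord_enum.
have brfE (x y z : 'I_8) : brf x y z = br (p x) (p y) (p z) by rewrite /brf !nthps.
rewrite (bracket_sum_altsum _ Z_eqb0 brfE) val_enum_ord.
pose c i := Z_altsum (bracket_step Z.mul 0%BZ 1%BZ level_triples brf i) 8 [::] (iota 0 8) 1%BZ.
transitivity (\sum_(i < 8) coord k (p i) * c i); last first.
  by apply: eq_bigr => i _; rewrite /c Z_altsumE.
rewrite -[Z_bracket_coefs _]/[seq c i | i <- iota 0 8].
move: c => c; rewrite enum_ord_inord -map_comp /= !big_ord_recl big_ord0.
do 8!(congr (Z.add (Z.mul _ _) _);
  first by congr (coord k (p _)); apply: val_inj; rewrite /= inordK).
Qed.

Lemma enum_ord8_split (T : Type) (f : 'I_8 -> T) : [seq f i | i <- enum 'I_8]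
  = [seq f (lshift 5 a) | a : 'I_3 <- enum 'I_3] ++ [seq f (rshift 3 b) | b : 'I_5 <- enum 'I_5].
Proof.
rewrite !enum_ord_inord /=.
by do 8!(congr (f _ :: _); first by apply: val_inj; rewrite /= !inordK).
Qed.

Lemma defect_samples k (A : seq nat) : (k < 3)%N -> A \in sublists (iota 0 7) 5 ->
  defect k (fun i : 'I_5 => sample (nth 0%N A i)) = 0.
Proof.
move=> k3 Asub; have := allP samples_defect A Asub; rewrite /Z_defect_eq0.
move=> /allP/(_ k); rewrite mem_iota => /(_ k3) /Z.eqb_spec.
pose q (i : 'I_5) := sample (nth 0%N A i).
have -> : map sample A = [seq q i | i <- enum 'I_5].
  have : size A = 5%N.
    have : all (fun A => size A == 5)%N (sublists (iota 0 7) 5) by [].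
    by move/allP/(_ A Asub)/eqP.
  rewrite /q; case: A {Asub q} => [|a [|b [|c [|d [|e []]]]]] //= _.
  by rewrite enum_ord_inord /= !inordK.
have -> : [:: (1, 0, 0); (0, 1, 0); (0, 0, 1)]%BZ ++ [seq q i | i <- enum 'I_5]
    = [seq framed q i | i <- enum 'I_8].
  rewrite enum_ord8_split; congr (_ ++ _); last first.
    by apply: eq_map => i; rewrite framed_rshift.
  rewrite (eq_map (framed_lshift q)) enum_ord_inord /= !inordK //.
rewrite Z_bracket_coefsE // Z_ninth_ptE => E; rewrite /defect {}E.
by rewrite -/q; apply/eqP; rewrite subr_eq0.
Qed.

(** The computation covers increasing lists of samples; skew symmetry gives the other orders. *)
Lemma defect_at_samples (R : comNzRingType) k (g : 'I_5 -> nat) : (k < 3)%N ->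
  injective g -> (forall i, (g i < 7)%N) ->
  defect k (fun i => sample_in R (g i)) = 0.
Proof.
move=> k3 g_inj g7; pose A := [seq x <- iota 0 7 | x \in codom g].
have gA i : g i \in A by rewrite mem_filter codom_f mem_iota g7.
have szA : size A = 5%N.
  rewrite -[RHS](card_ord 5) -(size_codom g); apply/perm_size/uniq_perm.
  - by rewrite filter_uniq ?iota_uniq.
  - exact/injectiveP.
  - by move=> x; rewrite mem_filter; apply: andb_idr => /codomP[i ->]; rewrite mem_iota g7.
have gi i : (index (g i) A < 5)%N by rewrite -szA index_mem gA.
have s_inj : injective (fun i => Ordinal (gi i)).
  by move=> i j [] /(congr1 (nth 0%N A)); rewrite !nth_index // => /g_inj.
have Asub : A \in sublists (iota 0 7) 5.
  by have := mem_sublists (filter_subseq (fun x => x \in codom g) (iota 0 7)); rewrite -/A szA.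
pose q (i : 'I_5) := sample_in R (nth 0%N A i).
rewrite (@eq_defect _ _ _ (q \o perm s_inj)) => [|i]; last first.
  by rewrite /q /= permE /= nth_index.
by apply: defect_perm_eq0; rewrite (defect_map (Zinj R)) defect_samples.
Qed.

Lemma map_pt_segment (R : comNzRingType) (x : R) (u v : R * R * R) :
  map_pt (horner_eval x)
    (pt_add (pt_scale (1 - 'X) (pt_polyC u)) (pt_scale 'X (pt_polyC v)))
  = pt_add (pt_scale (1 - x) u) (pt_scale x v).
Proof. by congr (_, _, _); rewrite /= /horner_eval !hornerE. Qed.

Lemma map_pt_polyC (R : comNzRingType) (x : R) (u : R * R * R) :
  map_pt (horner_eval x) (pt_polyC u) = u.
Proof. by case: u => [[a b] c]; congr (_, _, _); apply: hornerC. Qed.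

(* Each step degenerates the points in free position to sample points.        *)
Lemma defect_free_eq0 m (R : idomainType) k (q : 'I_5 -> R * R * R) (g : 'I_5 -> nat) :
  nat_faithful R -> (k < 3)%N -> (m <= 5)%N ->
  {in [pred i : 'I_5 | m <= i]%N &, injective g} ->
  {in [pred i : 'I_5 | m <= i]%N, forall i, (g i < 7 - m)%N} ->
  {in [pred i : 'I_5 | m <= i]%N, forall i, q i = sample_in R (g i)} ->
  defect k q = 0.
Proof.
(* The ring is generalized because each step adjoins a variable. *)
elim: m R q g => [|m IHm] R q g R0 k3 m5 g_inj g7 qg.
  rewrite (@eq_defect _ _ _ (fun i => sample_in R (g i))) => [|i]; last exact: qg.
  apply: defect_at_samples => // [i j|i]; first exact: g_inj.
  by have := g7 i isT; rewrite subn0.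
pose j := Ordinal m5.
(* The first m points start at the samples of index 7 - m and above. Of the 7 - m samples below, [g]
   uses 4 - m, so three remain as test values for the point j. *)
pose a (i : 'I_5) := if (i < m)%N then (7 - m.+1 + i).+1 else g i.
pose line (i : 'I_5) : {poly R} * {poly R} * {poly R} :=
  if (i < m)%N then
    pt_add (pt_scale (1 - 'X) (sample_in {poly R} (a i))) (pt_scale 'X (pt_polyC (q i)))
  else pt_polyC (q i).
have gt_m i : i \in predC1 j -> (i < m)%N = false -> (m < i)%N.
  rewrite inE -val_eqE /= => ij /negbT; rewrite -leqNgt leq_eqVlt eq_sym.
  by rewrite (negbTE ij).
have gt_m' (i : 'I_5) : (m <= i)%N -> i != j -> (m < i)%N.
  by move=> im ij; apply: gt_m; rewrite ?inE // ltnNge im.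
have line1 : (fun i => map_pt (horner_eval 1) (line i)) =1 q.
  move=> i; rewrite /line; case: ifP => im; last exact: map_pt_polyC.
  rewrite -polyC_sample map_pt_segment.
  by case: (q i) => [[x y] z]; congr (_, _, _) => /=; ring.
suff l0 : defect k line = 0.
  by rewrite -(eq_defect k line1) (defect_map (horner_eval (1 : R))) l0 rmorph0.
apply: (@defect_interpolation R R0 k line j a k3).
- move=> i i' ij ij'; rewrite /a; case: ifP => im; case: ifP => im'.
  + by move=> [] /eqP; rewrite eqn_add2l => /eqP /val_inj.
  + have := g7 i' (gt_m _ ij' im'); lia.
  + have := g7 i (gt_m _ ij im); lia.
  + by apply: g_inj; apply: gt_m.
- move=> i ij; rewrite /a; case: ifP => im; first by lia.
  have := g7 i (gt_m _ ij im); lia.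
- move=> i ij; rewrite /line; case: ifP => im.
    rewrite -polyC_sample map_pt_segment.
    by case: (sample_in R _) => [[x y] z]; congr (_, _, _) => /=; ring.
  by rewrite map_pt_polyC qg /a ?im //; apply: gt_m.
- move=> b b7 ab.
  have bm : (b < 7 - m)%N.
    rewrite ltnNge; apply/negP => mb.
    have im : (b - (7 - m) < 5)%N by lia.
    have := ab (Ordinal im); rewrite inE -val_eqE /= /a /=.
    rewrite (_ : (_ < m)%N); last by lia.
    move=> /(_ _) /eqP; lia.
  apply: (IHm _ _ (with_pt g j b) (nat_faithful_poly R0) k3 (ltnW m5)).
  + move=> i i'; rewrite !inE /with_pt => im im'.
    case: (altP (i =P j)) => [->|ij]; case: (altP (i' =P j)) => [->//|ij'].
    * move=> e; have := ab i' ij'; rewrite /a ltnNge im' /= -e eqxx => // -[].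
    * move=> e; have := ab i ij; rewrite /a ltnNge im /= e eqxx => // -[].
    * by apply: g_inj; apply: gt_m'.
  + move=> i im; rewrite /with_pt; case: eqP => [//|/eqP ij].
    have := g7 i (gt_m' i im ij); lia.
  + move=> i im; rewrite /with_pt; case: eqP => [//|/eqP ij].
    by rewrite /line ltnNge [(m <= i)%N]im /= qg ?polyC_sample //; apply: gt_m'.
Qed.

Theorem defect_eq0 (R : idomainType) k (q : 'I_5 -> R * R * R) :
  nat_faithful R -> (k < 3)%N -> defect k q = 0.
Proof.
move=> R0 k3; apply: (@defect_free_eq0 5 _ _ _ (fun _ => 0%N)) => // i;
  by rewrite inE leqNgt ltn_ord.
Qed.

(** * Cubics in a chart *)

Section BinaryForms.
Variable R : comNzRingType.
Implicit Types (p : {poly R}) (y z : R).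

(** The binary form of degree d whose dehomogenization at z = 1 is p; unlike p it also has a value
    at infinity, at (1, 0). *)
Definition bform d p y z : R := \sum_(i < d.+1) p`_i * y ^+ i * z ^+ (d - i).

Lemma bformD d p p' y z : bform d (p + p') y z = bform d p y z + bform d p' y z.
Proof. by rewrite -big_split; apply: eq_bigr => i _; rewrite coefD !mulrDl. Qed.

Lemma bformC d c p y z : bform d (c%:P * p) y z = c * bform d p y z.
Proof. by rewrite mulr_sumr; apply: eq_bigr => i _; rewrite coefCM !mulrA. Qed.

Lemma bformN d p y z : bform d (- p) y z = - bform d p y z.
Proof. by rewrite -sumrN; apply: eq_bigr => i _; rewrite coefN !mulNr. Qed.

Lemma bform0 d y z : bform d 0 y z = 0.
Proof. by rewrite /bform big1 // => i _; rewrite coef0 !mul0r. Qed.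

Lemma bform1 d p t : (size p <= d.+1)%N -> bform d p t 1 = p.[t].
Proof.
move=> h; rewrite (horner_coef_wide _ h).
by apply: eq_bigr => i _; rewrite expr1n mulr1.
Qed.

Lemma bform_inf d p y : bform d p y 0 = p`_d * y ^+ d.
Proof.
rewrite /bform big_ord_recr /= subnn expr0 mulr1 big1 ?add0r // => i _.
by rewrite expr0n subn_eq0 leqNgt ltn_ord mulr0.
Qed.

Lemma bform_scale d p c y z : bform d p (c * y) (c * z) = c ^+ d * bform d p y z.
Proof.
rewrite mulr_sumr; apply: eq_bigr => i _; rewrite !exprMn.
have -> : c ^+ d = c ^+ i * c ^+ (d - i) by rewrite -exprD subnKC // -ltnS.
ring.
Qed.
End BinaryForms.

Lemma bformM (K : fieldType) d e (p q : {poly K}) y z :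
  (size p <= d.+1)%N -> (size q <= e.+1)%N ->
  bform (d + e) (p * q) y z = bform d p y z * bform e q y z.
Proof.
move=> hp hq; have hpq : (size (p * q)%R <= (d + e).+1)%N.
  by apply: leq_trans (size_polyMleq _ _) _; have := leq_add hp hq; lia.
have [->|z0] := eqVneq z 0.
  rewrite !bform_inf exprD coefM (bigD1 (inord d)) //= inordK ?ltnS ?leq_addr //.
  rewrite addKn big1 ?addr0 => [|i]; first by ring.
  rewrite -val_eqE /= inordK ?ltnS ?leq_addr // neq_ltn => /orP[id|di].
    by rewrite (nth_default _ (leq_trans hq _)) ?mulr0 //; have := ltn_ord i; lia.
  by rewrite (nth_default _ (leq_trans hp di)) mul0r.
have E k (f : {poly K}) : (size f <= k.+1)%N -> bform k f y z = z ^+ k * f.[y / z].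
  move=> h; rewrite -(bform1 _ h) -bform_scale mulr1.
  by congr bform; rewrite mulrCA divff ?mulr1.
by rewrite !E // hornerM exprD; ring.
Qed.

Definition indep2 (K : fieldType) (u v : K * K) : bool := u.1 * v.2 != u.2 * v.1.

(** Zeros with nonzero second entry give distinct roots of p. At most one of the independent zeros
    is at infinity, and that one lowers the degree bound of p by one. *)
Lemma bform_eq0 (K : fieldType) d (p : {poly K}) (us : seq (K * K)) :
  (size p <= d.+1)%N -> (d < size us)%N -> pairwise (@indep2 K) us -> (0, 0) \notin us ->
  {in us, forall u, bform d p u.1 u.2 = 0} -> p = 0.
Proof.
move=> sp sd pus us0 h; apply/eqP/negP => /negP p0.
pose fin := [seq u <- us | u.2 != 0].
have fin0 u : u \in us -> u.2 != 0 -> p.[u.1 / u.2] = 0.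
  move=> /h hu u0; rewrite -(bform1 _ sp).
  apply: (@mulfI _ (u.2 ^+ d)); first by rewrite expf_neq0.
  by rewrite -bform_scale mulr1 mulrCA divff // mulr1 hu mulr0.
have ufin : uniq [seq u.1 / u.2 | u <- fin].
  rewrite uniq_pairwise pairwise_map.
  apply: (sub_in_pairwise (P := fun u => u.2 != 0)) (pairwise_filter _ pus).
    move=> u v u0 v0 /=; apply: contraNneq => e.
    have {}e : u.1 = v.1 / v.2 * u.2 by rewrite -e mulfVK.
    by rewrite e; apply/eqP; field.
  by apply/allP => u; rewrite mem_filter => /andP[].
have rfin : all (root p) [seq u.1 / u.2 | u <- fin].
  apply/allP => _ /mapP[u + ->]; rewrite mem_filter => /andP[u0 uus].
  exact/eqP/fin0.
have := max_poly_roots p0 rfin ufin; rewrite size_map.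
have [inf1|inf0] := boolP (has (fun u => u.2 == 0) us); last first.
  have -> : fin = us.
    apply/all_filterP/allP => u uus; apply: contra inf0 => u0; apply/hasP; by exists u.
  by move=> /leq_trans/(_ sp); rewrite ltnS leqNgt sd.
have {}sp : (size p <= d)%N.
  have /hasP[u uus /eqP u0] := inf1; have := h u uus; rewrite u0 bform_inf => /eqP.
  rewrite mulf_eq0 => /orP[/eqP pd|]; last first.
    rewrite expf_eq0 => /andP[_ /eqP u1]; case/negP: us0.
    by move: uus; case: (u) u0 u1 => a b /= -> ->.
  rewrite -ltnS ltn_neqAle sp andbT; apply/negP => /eqP e; case/negP: p0.
  by rewrite -lead_coef_eq0 lead_coefE e /= pd.
have : (size us <= (size fin).+1)%N.
  rewrite -(count_predC (fun u : K * K => u.2 != 0)) -!size_filter -/fin -addn1 leq_add2l.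
  have := pairwise_filter (predC (fun u : K * K => u.2 != 0)) pus.
  have := filter_all (predC (fun u : K * K => u.2 != 0)) us.
  case: (filter _ us) => [|a [|b l]] //= /and3P[/negPn/eqP a0 /negPn/eqP b0 _].
  by rewrite /indep2 a0 b0 mulr0 mul0r eqxx.
move=> h1 /leq_trans/(_ sp) h2; have := leq_trans sd (leq_trans h1 h2).
by rewrite ltnn.
Qed.

Lemma indep2N (K : fieldType) (u v : K * K) : u != (0, 0) -> ~~ indep2 u v ->
  exists c, v = (c * u.1, c * u.2).
Proof.
case: u v => [y z] [a b]; rewrite /indep2 negbK /= => yz /eqP e.
have [y0|y0] := eqVneq y 0.
  have z0 : z != 0 by apply: contraNneq yz => ->; rewrite y0.
  exists (b / z); rewrite y0 mulr0 mulfVK //; congr (_, _).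
  by apply: (mulfI z0); rewrite -e y0 mul0r mulr0.
exists (a / y); rewrite mulfVK //; congr (_, _).
by apply: (mulfI y0); rewrite e; field.
Qed.

(** Degree bookkeeping for [pencil_res_neq0], where these are the sizes of the polynomials in f = (l
    x + m) (a0 x + b0): the conclusion says that both factors can be homogenized. *)
Lemma factor_sizes (l a b m : nat) : (l + a = 3)%N -> (0 < l)%N -> (0 < a)%N ->
  (0 < b)%N -> (0 < m)%N -> ((m + b).-1 <= 4)%N ->
  (((m + a).-1 < (l + b).-1)%N -> ((l + b).-1 <= 3)%N) ->
  (((l + b).-1 < (m + a).-1)%N -> ((m + a).-1 <= 3)%N) ->
  (b <= a.+1)%N /\ (m <= l.+1)%N.
Proof. lia. Qed.

(** * Pencils of cubics projected from a base point *)

Section ChartCubics.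
Variable K : fieldType.

(* The cubic form x ^ 2 L(y, z) + x q(y, z) + n(y, z) passing through the     *)
(* point (1, 0, 0), with L, q and n dehomogenized at z = 1.                   *)
Record chart_cubic := ChartCubic {
  lin_part : {poly K}; quad_part : {poly K}; cub_part : {poly K};
  size_lin_part : (size lin_part <= 2)%N;
  size_quad_part : (size quad_part <= 3)%N;
  size_cub_part : (size cub_part <= 4)%N }.

Definition ceval (f : chart_cubic) (u : K * K * K) : K :=
  u.1.1 ^+ 2 * bform 1 (lin_part f) u.1.2 u.2
  + u.1.1 * bform 2 (quad_part f) u.1.2 u.2 + bform 3 (cub_part f) u.1.2 u.2.

Lemma size_comb d (p p' : {poly K}) s s' :
  (size p <= d)%N -> (size p' <= d)%N -> (size (s%:P * p + s'%:P * p')%R <= d)%N.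
Proof.
move=> hp hp'; rewrite (leq_trans (size_polyD _ _)) // geq_max !mul_polyC.
by rewrite !(leq_trans (size_scale_leq _ _)).
Qed.

Definition cubic_comb (f g : chart_cubic) s s' : chart_cubic :=
  ChartCubic (size_comb s s' (size_lin_part f) (size_lin_part g))
    (size_comb s s' (size_quad_part f) (size_quad_part g))
    (size_comb s s' (size_cub_part f) (size_cub_part g)).

Lemma ceval_comb f g s s' u :
  ceval (cubic_comb f g s s') u = s * ceval f u + s' * ceval g u.
Proof. by rewrite /ceval /= !bformD !bformC; ring. Qed.

(* f is the product of l0 x + m(y, z) and c0 x ^ 2 + x a0(y, z) + b0(y, z).   *)
Definition factorable (f : chart_cubic) : Prop :=
  exists l0 c0 (m a0 b0 : {poly K}),
    [/\ [/\ (size m <= 2)%N, (size a0 <= 2)%N & (size b0 <= 3)%N], l0 * c0 = 0,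
        lin_part f = l0%:P * a0 + c0%:P * m,
        quad_part f = l0%:P * b0 + m * a0 & cub_part f = m * b0].

(** The three parts have the zero (y, z) in common, so the line through (1, 0, 0) in this direction
    splits off. *)
Lemma line_factor f y z : (y, z) != (0, 0) ->
  bform 1 (lin_part f) y z = 0 -> bform 2 (quad_part f) y z = 0 ->
  bform 3 (cub_part f) y z = 0 -> factorable f.
Proof.
case: f => L q n sL sq sn /= yz.
have [z0|z0] := eqVneq z 0.
  have y0 : y != 0 by apply: contraNneq yz => ->; rewrite z0.
  have lead d (p : {poly K}) : (size p <= d.+1)%N -> bform d p y z = 0 -> (size p <= d)%N.
    move=> sp; rewrite z0 bform_inf => /eqP; rewrite mulf_eq0 expf_eq0 (negbTE y0) andbF orbF => pd.
    rewrite -ltnS ltn_neqAle sp andbT; apply/negP => /eqP e.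
    move: (e); rewrite (_ : size p = 0)%N //; apply/eqP.
    by rewrite size_poly_eq0 -lead_coef_eq0 lead_coefE e /=.
  move=> /(lead _ _ sL) sL' /(lead _ _ sq) sq' /(lead _ _ sn) sn'.
  (* The line is z = 0, whose dehomogenized equation is the constant 1. *)
  exists 0, L`_0, 1, q, n; split; rewrite ?mul0r ?mul1r ?add0r //=.
    by rewrite size_poly1.
  by rewrite mulr1; apply: size1_polyC.
have fac d (p : {poly K}) : (size p <= d.+1)%N -> bform d p y z = 0 ->
    exists2 r, p = ('X - (y / z)%:P) * r & (size (r : {poly K}) <= d)%N.
  move=> sp h; have /factor_theorem[r Er] : root p (y / z).
    rewrite /root -(bform1 _ sp); apply/eqP; apply: (@mulfI _ (z ^+ d)).
      by rewrite expf_neq0.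
    by rewrite -bform_scale mulr1 mulrCA divff // mulr1 h mulr0.
  exists r; first by rewrite mulrC.
  have [->|r0] := eqVneq r 0; first by rewrite size_poly0.
  by move: sp; rewrite Er size_Mmonic ?monicXsubC // size_XsubC addn2.
move=> /(fac _ _ sL)[c Lc sc] /(fac _ _ sq)[a qa sa] /(fac _ _ sn)[b nb sb].
exists 0, c`_0, ('X - (y / z)%:P), a, b; split; rewrite ?mul0r ?add0r //=.
  by rewrite size_XsubC.
by rewrite Lc mulrC; congr (_ * _); apply: size1_polyC.
Qed.

Definition dir (u : K * K * K) : K * K := (u.1.2, u.2).

Section Pencil.
Variables f g : chart_cubic.
Hypothesis irr : forall s s', (s, s') != (0, 0) -> ~ factorable (cubic_comb f g s s').

Definition base_pt u := ceval f u = 0 /\ ceval g u = 0.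

(** Some member has a linear part that vanishes in the direction (y, z). On the line in that
    direction it has degree at most 1 in x; with two zeros it would contain the line. *)
Lemma base_pt_dir_inj x x' y z : (y, z) != (0, 0) ->
  base_pt (x, y, z) -> base_pt (x', y, z) -> x = x'.
Proof.
move=> yz [fx gx] [fx' gx']; apply/eqP/negP => /negP xx'.
have [[s s'] ss' Ls] : exists2 s : K * K, s != (0, 0) &
    bform 1 (lin_part (cubic_comb f g s.1 s.2)) y z = 0.
  rewrite /=; set a := bform 1 (lin_part f) y z; set b := bform 1 (lin_part g) y z.
  have [ab|ab] := eqVneq (b, - a) (0, 0).
    exists (1, 0); first by rewrite xpair_eqE oner_eq0.
    case: ab => b0 /eqP; rewrite oppr_eq0 => /eqP a0.
    by rewrite /= bformD !bformC -/a -/b a0; ring.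
  by exists (b, - a) => //=; rewrite bformD !bformC -/a -/b; ring.
set h := cubic_comb f g s s' in Ls.
have hx : ceval h (x, y, z) = 0 by rewrite ceval_comb fx gx; ring.
have hx' : ceval h (x', y, z) = 0 by rewrite ceval_comb fx' gx'; ring.
move: hx hx'; rewrite /ceval [bform 1 _ _ _]Ls /= !mulr0 !add0r => hx hx'.
have q0 : bform 2 (quad_part h) y z = 0.
  apply: (@mulfI _ (x - x')); first by rewrite subr_eq0.
  rewrite mulr0 -[RHS](subrr 0) -{1}hx -hx'; ring.
apply: (irr ss'); apply: (line_factor yz Ls q0).
by rewrite -[RHS]hx q0 mulr0 add0r.
Qed.

Lemma irr_left : ~ factorable f.
Proof.
case=> l0 [c0 [m [a0 [b0 [sz l0c0 eL eq en]]]]].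
apply: (@irr 1 0); first by rewrite xpair_eqE oner_eq0.
by exists l0, c0, m, a0, b0; split; rewrite //= ?mul1r ?polyC0 ?mul0r ?addr0 ?polyC1 ?mul1r.
Qed.

Section NodalMember.
Hypothesis f_nodal : lin_part f = 0.
Variable us : seq (K * K * K).
Hypothesis us_base : forall u, u \in us -> base_pt u.
Hypothesis us_indep : pairwise (@indep2 K) (map dir us).
Hypothesis us_dir0 : (0, 0) \notin map dir us.
Hypothesis us_size : (3 < size us)%N.

Let q := quad_part f.
Let n := cub_part f.

Lemma ceval_nodal u : base_pt u ->
  u.1.1 * bform 2 q u.1.2 u.2 + bform 3 n u.1.2 u.2 = 0.
Proof. by case=> + _; rewrite /ceval f_nodal bform0 mulr0 add0r. Qed.

Lemma nodal_quad_neq0 : q != 0.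
Proof.
apply/eqP => q0; have n0 : n = 0.
  apply: (@bform_eq0 _ 3 n (map dir us)) => //; first exact: size_cub_part.
    by rewrite size_map.
  move=> _ /mapP[u uus ->]; have := ceval_nodal (us_base uus).
  by rewrite q0 bform0 mulr0 add0r.
apply: irr_left; exists 0, 0, 0, 0, 0; rewrite f_nodal -/q q0 -/n n0 size_poly0.
by split; rewrite ?mul0r ?addr0.
Qed.

(** A common linear factor of q and n is a line in f, and if q divides n as n = m q, then f = q (x +
    m). *)
Lemma nodal_coprime : coprimep q n.
Proof.
have q0 := nodal_quad_neq0; rewrite /coprimep; set d := gcdp q n.
have d0 : d != 0 by rewrite gcdp_eq0 (negbTE q0).
have dq : (d %| q)%R by apply: dvdp_gcdl.
have dn : (d %| n)%R by apply: dvdp_gcdr.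
have := leq_trans (dvdp_leq q0 dq) (size_quad_part f).
have : (0 < size d)%N by rewrite size_poly_gt0.
(* What remains are the sizes 2, a common linear factor, and 3, where q divides n. *)
case sd: (size d) => [|[|[|[|k]]]] //= _ _; exfalso.
  have dt : root d (- d`_0 / d`_1).
    have d1 : d`_1 != 0 by have := lead_coef_eq0 d; rewrite lead_coefE sd /= (negbTE d0) => ->.
    rewrite /root (@horner_coef_wide _ 2) ?sd // !big_ord_recl big_ord0 /= expr0 expr1.
    by apply/eqP; field.
  apply: irr_left; apply: (@line_factor f (- d`_0 / d`_1) 1).
  - by rewrite xpair_eqE oner_eq0 andbF.
  - by rewrite f_nodal bform0.
  - rewrite bform1 ?size_quad_part //; exact/eqP/(root_dvdp dq).
  - rewrite bform1 ?size_cub_part //; exact/eqP/(root_dvdp dn).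
have sq : size q = 3%N.
  by apply/eqP; rewrite eqn_leq size_quad_part -sd dvdp_leq.
have qd : (q %| d)%R.
  have : d %= q by rewrite -dvdp_size_eqp // sd sq.
  by case/andP.
have /dvdpP[m nm] := dvdp_trans qd dn.
apply: irr_left; exists 1, 0, m, 0, q; rewrite f_nodal size_poly0; split=> //.
- split=> //; last exact: size_quad_part.
  have := size_cub_part f; rewrite -/n nm.
  have [->|m0] := eqVneq m 0; first by rewrite size_poly0.
  by rewrite size_mul // sq addnS -[4%N]/(2 + 2)%N leq_add2r.
- by rewrite mulr0.
- by rewrite mulr0 mul0r addr0.
- by rewrite mul1r mulr0 addr0.
Qed.

(* The resultant of the two members with respect to x. *)
Definition nodal_res : {poly K} :=
  n ^+ 2 * lin_part g - n * q * quad_part g + q ^+ 2 * cub_part g.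

Lemma size_mul3 (a b c : {poly K}) i j k :
  (size a <= i.+1)%N -> (size b <= j.+1)%N -> (size c <= k.+1)%N ->
  (size (a * b * c)%R <= (i + j + k).+1)%N.
Proof.
move=> ha hb hc; apply: leq_trans (size_polyMleq _ _) _.
move: (size_polyMleq a b) ha hb hc; move: (size (a * b)%R) (size a) (size b) (size c) => m1 m2 m3 m4; lia.
Qed.

Lemma size_nodal_res : (size nodal_res <= 8)%N.
Proof.
have sn : (size n <= 4)%N := size_cub_part f.
have sq : (size q <= 3)%N := size_quad_part f.
rewrite (leq_trans (size_polyD _ _)) // geq_max (leq_trans (size_polyD _ _)) ?geq_max ?size_polyN.
  by rewrite (@size_mul3 q q _ 2 2 3) ?size_cub_part.
by rewrite (@size_mul3 n n _ 3 3 1) ?size_lin_part // (@size_mul3 n q _ 3 2 2) ?size_quad_part.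
Qed.

Lemma bform_nodal_res y z : bform 7 nodal_res y z =
  bform 3 n y z ^+ 2 * bform 1 (lin_part g) y z
  - bform 3 n y z * bform 2 q y z * bform 2 (quad_part g) y z
  + bform 2 q y z ^+ 2 * bform 3 (cub_part g) y z.
Proof.
have sn : (size n <= 4)%N := size_cub_part f.
have sq : (size q <= 3)%N := size_quad_part f.
have [sL' sq' sn'] := And3 (size_lin_part g) (size_quad_part g) (size_cub_part g).
have snn : (size (n * n)%R <= 7)%N by rewrite (leq_trans (size_polyMleq _ _)) //; have := leq_add sn sn; case: (_ + _)%N.
have snq : (size (n * q)%R <= 6)%N by rewrite (leq_trans (size_polyMleq _ _)) //; have := leq_add sn sq; case: (_ + _)%N.
have sqq : (size (q * q)%R <= 5)%N by rewrite (leq_trans (size_polyMleq _ _)) //; have := leq_add sq sq; case: (_ + _)%N.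
rewrite !bformD bformN; congr (_ - _ + _).
- by rewrite (@bformM _ 6 1) // (@bformM _ 3 3).
- by rewrite (@bformM _ 5 2) // (@bformM _ 3 2).
- by rewrite (@bformM _ 4 3) // (@bformM _ 2 2).
Qed.

Lemma nodal_res_base u : base_pt u -> bform 7 nodal_res u.1.2 u.2 = 0.
Proof.
move=> bu; have fu := ceval_nodal bu; case: bu => _; rewrite bform_nodal_res /ceval.
have -> : bform 3 n u.1.2 u.2 = - (u.1.1 * bform 2 q u.1.2 u.2).
  by apply/eqP; rewrite -addr_eq0 addrC fu.
set Q := bform 2 q _ _; set L := bform 1 _ _ _; set Q' := bform 2 _ _ _; set N' := bform 3 _ _ _.
move=> E; transitivity (Q ^+ 2 * (u.1.1 ^+ 2 * L + u.1.1 * Q' + N')); first by ring.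
by rewrite E mulr0.
Qed.

(** If the resultant vanishes, q divides the linear part of g, being coprime to n. A nonzero linear
    part contradicts the degrees, and a zero one makes g a constant multiple of f. *)
Lemma nodal_res_neq0 : nodal_res != 0.
Proof.
have q0 := nodal_quad_neq0; have cop := nodal_coprime.
apply/eqP => B0.
have E : n * n * lin_part g = q * (n * quad_part g - q * cub_part g).
  by apply/eqP; rewrite -subr_eq0 -[X in _ == X]B0 /nodal_res; apply/eqP; ring.
have qL : (q %| lin_part g)%R.
  rewrite -(@Gauss_dvdpr _ _ (n * n)) ?coprimepMr ?cop // E dvdp_mulr //.
have L0 : lin_part g = 0.
  apply/eqP/negP => /negP L0; have := dvdp_leq L0 qL => sqL.
  have sL := size_lin_part g.
  (* Otherwise q and n both vanish at infinity and the line z = 0 splits off. *)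
  have n3 : size n = 4%N.
    apply/eqP; rewrite eqn_leq size_cub_part ltnNge; apply/negP => sn.
    apply: irr_left; apply: (@line_factor f 1 0).
    - by rewrite xpair_eqE oner_eq0.
    - by rewrite f_nodal bform0.
    - by rewrite bform_inf nth_default ?mul0r //; apply: leq_trans sqL sL.
    - by rewrite bform_inf nth_default ?mul0r.
  have n0 : n != 0 by rewrite -size_poly_gt0 n3.
  have sE : (size (n * n * lin_part g)%R = 6 + size (lin_part g))%N.
    by rewrite size_mul ?mulf_neq0 // size_mul // n3.
  have sn' : (size (n * quad_part g)%R <= 6)%N.
    rewrite (leq_trans (size_polyMleq _ _)) // n3.
    by have := size_quad_part g; case: (size _).
  have sqn' : (size (q * cub_part g)%R <= 6)%N.
    have := leq_add (size_quad_part f) (size_cub_part g); rewrite -/q => h.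
    by rewrite (leq_trans (size_polyMleq _ _)) //; move: h; case: (_ + _)%N.
  have sd : (size (n * quad_part g - q * cub_part g)%R <= 6)%N.
    by rewrite (leq_trans (size_polyD _ _)) // geq_max size_polyN sn'.
  have := size_polyMleq q (n * quad_part g - q * cub_part g); rewrite -E sE.
  have := size_poly_gt0 q; rewrite q0.
  have := size_poly_gt0 (lin_part g); rewrite L0.
  move: sqL sL sd; move: (size q) (size (lin_part g)) (size (n * quad_part g - q * cub_part g)%R) => a b c.
  lia.
have E2 : n * quad_part g = q * cub_part g.
  move: E; rewrite L0 mulr0 => /esym/eqP; rewrite mulf_eq0 (negbTE q0) /= subr_eq0.
  by move/eqP.
have qq' : (q %| quad_part g)%R.
  by rewrite -(@Gauss_dvdpr _ _ n) // E2 dvdp_mulr.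
have /dvdpP[c Ec] := qq'.
have Ed : cub_part g = c * n.
  by apply: (mulfI q0); rewrite -E2 Ec; ring.
have sc : (size c <= 1)%N.
  have [->|c0] := eqVneq c 0; first by rewrite size_poly0.
  have [sq|sq] := ltnP (size q) 3.
    have [sn|sn] := ltnP (size n) 4.
      exfalso; apply: irr_left; apply: (@line_factor f 1 0).
      - by rewrite xpair_eqE oner_eq0.
      - by rewrite f_nodal bform0.
      - by rewrite bform_inf nth_default ?mul0r.
      - by rewrite bform_inf nth_default ?mul0r.
    have n0 : n != 0 by rewrite -size_poly_gt0 (leq_trans _ sn).
    have := size_cub_part g; rewrite Ed size_mul //.
    move: (size c) (size n) sn => a b; lia.
  have := size_quad_part g; rewrite Ec size_mul //.
  move: (size c) (size q) sq => a b; lia.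
apply: (@irr (- c`_0) 1); first by rewrite xpair_eqE oner_eq0 andbF.
exists 0, 0, 0, 0, 0; rewrite /= size_poly0 f_nodal L0 Ec Ed -/q -/n (size1_polyC sc) coefC /=.
by rewrite polyCN polyC1 polyC0; split; rewrite // ?mul0r; ring.
Qed.

(** The node takes up two of the nine intersections; the others are zeros of the resultant, of
    degree 7. *)
Lemma nodal_size_le : (size us <= 7)%N.
Proof.
rewrite leqNgt; apply/negP => us7; case/negP: nodal_res_neq0; apply/eqP.
apply: (@bform_eq0 _ 7 _ (map dir us)); rewrite ?size_map ?size_nodal_res //.
by move=> _ /mapP[u uus ->]; apply: nodal_res_base; apply: us_base.
Qed.

Lemma nodal_quad_at_dir u : u \in us -> bform 2 q u.1.2 u.2 != 0.
Proof.
move=> uus; apply/eqP => qu; have := ceval_nodal (us_base uus).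
rewrite qu mulr0 add0r => nu; apply: irr_left; apply: (@line_factor f u.1.2 u.2) => //.
  by apply: contraNneq us_dir0 => <-; apply: map_f.
by rewrite f_nodal bform0.
Qed.

(** A tangent of f at the node that is also tangent to g would be an eighth zero of the resultant.
    This transversality is what keeps the multiplicity at the node equal to 2. *)
Lemma nodal_tangent y z : size us = 7%N -> (y, z) != (0, 0) ->
  bform 1 (lin_part g) y z = 0 -> bform 2 q y z != 0.
Proof.
move=> us7 yz Lyz; apply/eqP => qyz; case/negP: nodal_res_neq0; apply/eqP.
apply: (@bform_eq0 _ 7 _ ((y, z) :: map dir us)); rewrite /= ?size_map ?size_nodal_res ?us7 //.
- rewrite us_indep andbT; apply/allP => _ /mapP[u uus ->]; rewrite /indep2 /=.
  apply: contraNT (nodal_quad_at_dir uus) => h.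
  have [c [-> ->]] := indep2N yz (h : ~~ indep2 (y, z) (dir u)).
  by rewrite bform_scale qyz mulr0.
- by rewrite inE negb_or us_dir0 andbT eq_sym.
- move=> v; rewrite inE => /orP[/eqP ->|/mapP[u uus ->]] /=.
    by rewrite bform_nodal_res Lyz qyz; ring.
  by apply: nodal_res_base; apply: us_base.
Qed.

(** The coefficient conditions say that g is singular at (0, 0, 1). Then X ^ 2 divides the
    resultant, and the quotient, a form of degree 5, vanishes in six other directions. *)
Lemma nodal_unique vs : size us = 7%N -> us = (0, 0, 1) :: vs ->
  (quad_part g)`_0 = 0 -> (cub_part g)`_0 = 0 -> (cub_part g)`_1 = 0 -> False.
Proof.
move=> us7 usE q0 n0 n1; case/negP: nodal_res_neq0.
have e2us : (0, 0, 1) \in us by rewrite usE mem_head.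
have nf0 : n`_0 = 0.
  have := ceval_nodal (us_base e2us); rewrite /= mul0r add0r bform1 ?size_cub_part //.
  by rewrite horner_coef0.
have polyX_dvd (p : {poly K}) : p`_0 = 0 -> exists p', p = 'X * p'.
  move=> p0; have /factor_theorem[p' ->] : root p 0 by rewrite /root horner_coef0 p0.
  by exists p'; rewrite subr0 mulrC.
have [a na] := polyX_dvd _ nf0; have [b qb] := polyX_dvd _ q0.
have [c nc] := polyX_dvd _ n0.
have c0 : c`_0 = 0 by have := n1; rewrite nc coefXM.
have [d cd] := polyX_dvd _ c0.
have [B EB] : exists B, nodal_res = 'X^2 * B.
  exists (a ^+ 2 * lin_part g - a * q * b + q ^+ 2 * d).
  by rewrite /nodal_res na qb nc cd; ring.
have X0 : 'X^2 != 0 :> {poly K} by rewrite monic_neq0 ?monicXn.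
suff B0 : B = 0 by rewrite EB B0 mulr0.
have sB : (size B <= 6)%N.
  have [->|B0] := eqVneq B 0; first by rewrite size_poly0.
  have := size_nodal_res; rewrite EB size_mul // size_polyXn.
  by move: (size B) => s; lia.
have := us_indep; rewrite usE.
move=> /= /andP[/allP e2vs ivs].
apply: (@bform_eq0 _ 5 _ (map dir vs)) => //.
- by rewrite size_map; move: us7; rewrite usE => -[->].
- apply: contra us_dir0 => /mapP[u uvs e]; apply/mapP; exists u => //.
  by rewrite usE inE uvs orbT.
move=> v vvs; have /mapP[u uvs Ev] := vvs.
have v1 : v.1 != 0 by have := e2vs v vvs; rewrite /indep2 /= mul0r mul1r eq_sym.
apply: (@mulfI _ (v.1 ^+ 2)); first by rewrite expf_neq0.
have := nodal_res_base (us_base (_ : u \in us)); rewrite EB (@bformM _ 2 5) ?size_polyXn //.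
rewrite -[u.1.2]/(dir u).1 -[u.2]/(dir u).2 -Ev.
have -> : bform 2 'X^2 v.1 v.2 = v.1 ^+ 2.
  by rewrite /bform !big_ord_recl big_ord0 !coefXn /= !mul0r !add0r mul1r addr0 expr0 mulr1.
by move=> ->; rewrite ?mulr0 // usE inE uvs orbT.
Qed.
End NodalMember.

Section TransversalPencil.
Hypothesis linf : lin_part f = 'X.
Hypothesis ling : lin_part g = 1.

Let q := quad_part f.
Let n := cub_part f.
Let q' := quad_part g.
Let n' := cub_part g.
Let sq : (size q <= 3)%N := size_quad_part f.
Let sn : (size n <= 4)%N := size_cub_part f.
Let sq' : (size q' <= 3)%N := size_quad_part g.
Let sn' : (size n' <= 4)%N := size_cub_part g.

(* The resultant of f and g with respect to x. *)
Definition pencil_res : {poly K} :=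
  ('X * n' - n) ^+ 2 - ('X * q' - q) * (q * n' - q' * n).

Lemma size_sub_le d (a b : {poly K}) :
  (size a <= d)%N -> (size b <= d)%N -> (size (a - b)%R <= d)%N.
Proof. by move=> ha hb; rewrite (leq_trans (size_polyD _ _)) // geq_max size_polyN ha. Qed.

Lemma size_mul_le i j (a b : {poly K}) :
  (size a <= i.+1)%N -> (size b <= j.+1)%N -> (size (a * b)%R <= (i + j).+1)%N.
Proof.
move=> ha hb; apply: leq_trans (size_polyMleq _ _) _.
by have := leq_add ha hb; case: (_ + _)%N => // k; rewrite addnS addSn.
Qed.

Let sXn' : (size ('X * n' - n)%R <= 5)%N.
Proof.
apply: size_sub_le; last by apply: leq_trans sn _.
by apply: (@size_mul_le 1 3); rewrite ?size_polyX.
Qed.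

Let sXq' : (size ('X * q' - q)%R <= 4)%N.
Proof.
apply: size_sub_le; last by apply: leq_trans sq _.
by apply: (@size_mul_le 1 2); rewrite ?size_polyX.
Qed.

Let sqn' : (size (q * n' - q' * n)%R <= 6)%N.
Proof. by apply: size_sub_le; apply: (@size_mul_le 2 3). Qed.

Lemma size_pencil_res : (size pencil_res <= 9)%N.
Proof.
by apply: size_sub_le; [apply: (@size_mul_le 4 4) | apply: (@size_mul_le 3 5)].
Qed.

Lemma bform_X y z : bform 1 'X y z = y :> K.
Proof. by rewrite /bform !big_ord_recl big_ord0 !coefX /=; ring. Qed.

Lemma bform_1 y z : bform 1 1 y z = z :> K.
Proof. by rewrite /bform !big_ord_recl big_ord0 !coef1 /=; ring. Qed.

Lemma bform_pencil_res y z :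
  let Q := bform 2 q y z in let Q' := bform 2 q' y z in
  let N := bform 3 n y z in let N' := bform 3 n' y z in
  bform 8 pencil_res y z
  = (y * N' - z * N) ^+ 2 - (y * Q' - z * Q) * (Q * N' - Q' * N).
Proof.
move=> Q Q' N N'.
rewrite bformD bformN (@bformM _ 4 4) ?(@bformM _ 3 5) // !bformD !bformN.
(* As a form of degree 1 the constant 1 is z; it raises n and q to the degrees of 'X * n' and 'X *
   q'. *)
rewrite -{1 2}[n]mul1r -{1}[q]mul1r.
rewrite !(@bformM _ 1 3) ?(@bformM _ 1 2) ?(@bformM _ 2 3) ?size_polyX ?size_poly1 //.
by rewrite bform_X bform_1 -expr2.
Qed.

Lemma ceval_f u : ceval f u =
  u.1.1 ^+ 2 * u.1.2 + u.1.1 * bform 2 q u.1.2 u.2 + bform 3 n u.1.2 u.2.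
Proof. by rewrite /ceval linf bform_X. Qed.

Lemma ceval_g u : ceval g u =
  u.1.1 ^+ 2 * u.2 + u.1.1 * bform 2 q' u.1.2 u.2 + bform 3 n' u.1.2 u.2.
Proof. by rewrite /ceval ling bform_1. Qed.

Lemma pencil_res_base u : base_pt u -> bform 8 pencil_res u.1.2 u.2 = 0.
Proof.
case; rewrite ceval_f ceval_g bform_pencil_res.
set Q := bform 2 q _ _; set Q' := bform 2 q' _ _.
move=> /eqP; rewrite addrC addr_eq0 => /eqP -> /eqP; rewrite addrC addr_eq0 => /eqP ->.
ring.
Qed.

(** The difference f - X g equals a x + b, of degree 1 in x. If the resultant vanishes, its root
    -b/a is also a root of f; written in lowest terms a0 x + b0, this linear polynomial divides f,
    and f = (l x + m) (a0 x + b0). *)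
Lemma pencil_res_neq0 : pencil_res != 0.
Proof.
apply/eqP => r0; pose a := q - 'X * q'; pose b := n - 'X * n'.
have E : 'X * b ^+ 2 = a * (q * b - n * a).
  have /(congr1 (fun p => 'X * p)) := r0; rewrite mulr0 => r0'.
  by apply/eqP; rewrite -subr_eq0 -[X in _ == X]r0' /pencil_res /a /b; apply/eqP; ring.
(* In the degenerate case q = X q' and n = X n', so f contains the line y = 0. *)
have [ab0|ab0] := boolP ((a == 0) && (b == 0)).
  case/andP: ab0; rewrite /a /b !subr_eq0 => /eqP qE /eqP nE.
  apply: irr_left; exists 0, 1, 'X, q', n'; rewrite linf mul0r -/q -/n; split=> //.
  - rewrite size_polyX; split=> //.
      move: sq; rewrite qE; have [->|q0] := eqVneq q' 0; first by rewrite size_poly0.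
      by rewrite mulrC size_mulX.
    move: sn; rewrite nE; have [->|n0] := eqVneq n' 0; first by rewrite size_poly0.
    by rewrite mulrC size_mulX.
  - by rewrite polyC0 polyC1; ring.
  - by rewrite polyC0 qE; ring.
pose d := gcdp a b.
have d0 : d != 0 by rewrite gcdp_eq0.
have cop : coprimep (a %/ d)%R (b %/ d)%R by apply: coprimep_div_gcd; rewrite -negb_and.
have Ea : a = (a %/ d)%R * d by rewrite divpK // dvdp_gcdl.
have Eb : b = (b %/ d)%R * d by rewrite divpK // dvdp_gcdr.
move: (a %/ d)%R (b %/ d)%R cop Ea Eb => a0 b0 cop Ea Eb.
have E0 : 'X * b0 ^+ 2 = a0 * (q * b0 - n * a0).
  apply: (@mulfI _ (d ^+ 2)); first by rewrite expf_neq0.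
  transitivity ('X * b ^+ 2); first by rewrite Eb; ring.
  by rewrite E Eb Ea; ring.
have a0X : (a0 %| 'X)%R.
  have : (a0 %| 'X * b0 ^+ 2)%R by rewrite E0 dvdp_mulr.
  by rewrite Gauss_dvdpl // coprimep_expr.
have b0n : (b0 %| n)%R.
  have : (b0 %| n * a0 ^+ 2)%R.
    rewrite (_ : n * a0 ^+ 2 = b0 * (a0 * q - 'X * b0)) ?dvdp_mulr //.
    apply/eqP; rewrite -subr_eq0.
    have -> : n * a0 ^+ 2 - b0 * (a0 * q - 'X * b0) = 'X * b0 ^+ 2 - a0 * (q * b0 - n * a0) by ring.
    by rewrite E0 subrr.
  by rewrite Gauss_dvdpl // coprimep_expr // coprimep_sym.
have a00 : a0 != 0 by apply: contraTneq a0X => ->; rewrite dvd0p polyX_eq0.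
have [l EX] := dvdpP _ _ a0X; have [m En] := dvdpP _ _ b0n.
have X0 : 'X != 0 :> {poly K} by rewrite polyX_eq0.
have l0 : l != 0 by apply: contraNneq X0 => l0; rewrite EX l0 mul0r.
have sal : (size l + size a0 = 3)%N.
  have := congr1 (fun p : {poly K} => size p) EX; rewrite size_polyX size_mul //.
  have := size_poly_gt0 l; rewrite l0.
  by case: (size l) => // k _ /=; rewrite addSn => <-.
have [b00|b00] := eqVneq b0 0.
  have n0 : n = 0 by rewrite En b00 mulr0.
  apply: irr_left; exists 1, 0, 0, 'X, q; rewrite linf -/q -/n n0 size_poly0 size_polyX sq.
  by split; rewrite ?mulr0 ?mul0r ?mul1r ?addr0 //= ?polyC0 ?mul0r ?addr0 // mul1r.
have Eq : q = l * b0 + m * a0.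
  apply: (@mulfI _ (a0 * b0)); first by rewrite mulf_neq0.
  have -> : a0 * b0 * q = a0 * (q * b0 - n * a0) + a0 ^+ 2 * n by ring.
  by rewrite -E0 {1}EX En; ring.
have size_m : m != 0 -> (size n = (size m + size b0).-1)%N.
  by move=> m0; rewrite En size_mul.
have size_ma : m != 0 -> (size (m * a0)%R = (size m + size a0).-1)%N.
  by move=> m0; rewrite size_mul.
have size_lb : (size (l * b0)%R = (size l + size b0).-1)%N by rewrite size_mul.
have sb1 : (0 < size b0)%N by rewrite size_poly_gt0.
have sa1 : (0 < size a0)%N by rewrite size_poly_gt0.
have sl1 : (0 < size l)%N by rewrite size_poly_gt0.
have sum1 : (size (m * a0)%R < size (l * b0)%R)%N -> (size (l * b0)%R <= 3)%N.
  by move=> h; move: sq; rewrite Eq size_polyDl.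
have sum2 : (size (l * b0)%R < size (m * a0)%R)%N -> (size (m * a0)%R <= 3)%N.
  by move=> h; move: sq; rewrite Eq addrC size_polyDl.
have bounds : (size b0 <= (size a0).+1)%N /\ (size m <= (size l).+1)%N.
  have [m0|m0] := eqVneq m 0.
    move: sum1; rewrite m0 mul0r size_poly0 size_lb => h.
    have {}h : ((size l + size b0).-1 <= 3)%N by case: posnP h => [->|_ ->].
    split=> //; rewrite -(leq_add2l (size l)) addnS sal.
    by move: h; case: (_ + _)%N.
  have sm1 : (0 < size m)%N by rewrite size_poly_gt0.
  apply: factor_sizes => //; first by rewrite -size_m.
    by rewrite -size_lb -size_ma.
  by rewrite -size_lb -size_ma.
have [a1|a1] := eqVneq (size a0) 1%N.
  have a0c : a0 = (a0`_0)%:P by apply: size1_polyC; rewrite a1.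
  apply: irr_left; exists a0`_0, 0, b0, l, m; rewrite linf -/q -/n -a0c; split.
  - have l2 : size l = 2%N by move: sal; rewrite a1 addn1 => -[].
    by case: bounds; rewrite a1 l2.
  - by rewrite mulr0.
  - by rewrite polyC0 mul0r addr0 mulrC.
  - by rewrite Eq; ring.
  - by rewrite En mulrC.
have l1 : size l = 1%N.
  by move: sal sa1 sl1; case: (size l) => [|[|x]] //; case: (size a0) a1 => [|[|y]] // _; rewrite !addSn addnC.
have lc : l = (l`_0)%:P by apply: size1_polyC; rewrite l1.
apply: irr_left; exists l`_0, 0, m, a0, b0; rewrite linf -/q -/n -lc; split.
- have a2 : size a0 = 2%N by move: sal; rewrite l1 add1n => -[].
  by case: bounds; rewrite l1 a2.
- by rewrite mulr0.
- by rewrite polyC0 mul0r addr0.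
- by rewrite Eq; ring.
- by rewrite En.
Qed.

Lemma transversal_size_le (us : seq (K * K * K)) :
  {in us, forall u, base_pt u} -> pairwise (@indep2 K) (map dir us) ->
  (0, 0) \notin map dir us -> (size us <= 8)%N.
Proof.
move=> ub ui u0; rewrite leqNgt; apply/negP => us8; case/negP: pencil_res_neq0; apply/eqP.
apply: (@bform_eq0 _ 8 _ (map dir us)); rewrite ?size_map ?size_pencil_res //.
by move=> _ /mapP[u uus ->]; apply: pencil_res_base; apply: ub.
Qed.

Lemma base_pt1 x t : base_pt (x, t, 1) <->
  x ^+ 2 * t + x * q.[t] + n.[t] = 0 /\ x ^+ 2 + x * q'.[t] + n'.[t] = 0.
Proof. by rewrite /base_pt ceval_f ceval_g /= !bform1 // mulr1. Qed.

(** Otherwise the member f - t g contains the line through (1, 0, 0) in the direction (t, 1). *)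
Lemma no_vertical_member t : 'X.[t] * q'.[t] != q.[t] \/ 'X.[t] * n'.[t] != n.[t].
Proof.
have [eq|] := eqVneq ('X.[t] * q'.[t]) q.[t]; last by left.
right; apply/eqP => en; apply: (@irr 1 (- t)); first by rewrite xpair_eqE oner_eq0.
apply: (@line_factor _ t 1); first by rewrite xpair_eqE oner_eq0 andbF.
- by rewrite /= linf ling bform1 ?size_comb ?size_polyX ?size_poly1 // !hornerE; ring.
- by rewrite /= bform1 ?size_comb // -/q -/q' !hornerE -eq !hornerE; ring.
- by rewrite /= bform1 ?size_comb // -/n -/n' !hornerE -en !hornerE; ring.
Qed.

(** Eliminating x ^ 2 leaves D x + M = 0, which determines x unless D = 0; but at a root of the
    resultant D = 0 forces M = 0, which [no_vertical_member] excludes. *)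
Lemma pencil_res_root t : pencil_res.[t] = 0 -> exists x, base_pt (x, t, 1).
Proof.
rewrite /pencil_res !hornerE => r0.
pose D := t * q'.[t] - q.[t]; pose M := t * n'.[t] - n.[t].
have qE : q.[t] = t * q'.[t] - D by rewrite /D; ring.
have nE : n.[t] = t * n'.[t] - M by rewrite /M; ring.
have [D0|D0] := eqVneq D 0.
  have M0 : M = 0.
    have : M ^+ 2 = 0 by rewrite -[RHS]r0 -/D -/M D0; ring.
    by move/eqP; rewrite expf_eq0 => /eqP.
  by have := no_vertical_member t; rewrite hornerX qE nE D0 M0 !subr0 !eqxx => -[].
exists (- M / D); apply/base_pt1.
have g0 : (- M / D) ^+ 2 + - M / D * q'.[t] + n'.[t] = 0.
  apply: (mulfI (expf_neq0 2 D0)); rewrite mulr0 -[RHS]r0 -/D -/M qE nE; field; exact: D0.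
split=> //; rewrite qE nE.
transitivity (t * ((- M / D) ^+ 2 + - M / D * q'.[t] + n'.[t])).
  by field.
by rewrite g0 mulr0.
Qed.

Definition cubic_dx (h : chart_cubic) x t : K :=
  2%:R * x * (lin_part h).[t] + (quad_part h).[t].
Definition cubic_dy (h : chart_cubic) x t : K :=
  x ^+ 2 * (lin_part h)^`().[t] + x * (quad_part h)^`().[t] + (cub_part h)^`().[t].

Lemma cubic_dx_comb s s' x t :
  cubic_dx (cubic_comb f g s s') x t = s * cubic_dx f x t + s' * cubic_dx g x t.
Proof. by rewrite /cubic_dx /= !(hornerD, hornerM, hornerC); ring. Qed.

Lemma cubic_dy_comb s s' x t :
  cubic_dy (cubic_comb f g s s') x t = s * cubic_dy f x t + s' * cubic_dy g x t.
Proof.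
by rewrite /cubic_dy /= !(derivD, derivM, derivC) !mul0r !add0r !(hornerD, hornerM, hornerC); ring.
Qed.

(** At a base point the derivative of the resultant is -D times the Jacobian J of f and g, and D is
    nonzero there. When J vanishes, some member has both partial derivatives zero. *)
Lemma pencil_res_double x t : base_pt (x, t, 1) -> pencil_res^`().[t] = 0 ->
  exists2 s, s != (0, 0) & let h := cubic_comb f g s.1 s.2 in
    cubic_dx h x t = 0 /\ cubic_dy h x t = 0.
Proof.
move=> /base_pt1[fx gx] r0.
pose D := t * q'.[t] - q.[t].
pose J := cubic_dx f x t * cubic_dy g x t - cubic_dy f x t * cubic_dx g x t.
have nE : n.[t] = - (x ^+ 2 * t) - x * q.[t] by rewrite -[LHS]addr0 -[X in _ + X]oppr0 -fx; ring.
have nE' : n'.[t] = - x ^+ 2 - x * q'.[t] by rewrite -[LHS]addr0 -[X in _ + X]oppr0 -gx; ring.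
have DJ : D * J = 0.
  apply/eqP; rewrite -oppr_eq0 -[X in _ == X]r0; apply/eqP.
  rewrite /pencil_res /D /J /cubic_dx /cubic_dy linf ling -/q -/q' -/n -/n' !derivE
    !(hornerD, hornerM, hornerN, hornerX, hornerC, hornerMn, hornerXn) /=.
  rewrite nE nE'; ring.
have D0 : D != 0.
  apply/eqP => D0; have qt : q.[t] = t * q'.[t] by apply/eqP; rewrite eq_sym -subr_eq0 -/D D0.
  by have := no_vertical_member t; rewrite hornerX nE nE' qt eqxx => -[//|/eqP[]]; ring.
have J0 : J = 0 by apply: (mulfI D0); rewrite DJ mulr0.
set fx' := cubic_dx f x t; set gx' := cubic_dx g x t.
set fy' := cubic_dy f x t; set gy' := cubic_dy g x t.
have [e1|ne1] := eqVneq (gx', - fx') (0, 0).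
  case: e1 => gx0 /eqP; rewrite oppr_eq0 => /eqP fx0.
  have [e2|ne2] := eqVneq (gy', - fy') (0, 0).
    case: e2 => gy0 /eqP; rewrite oppr_eq0 => /eqP fy0.
    exists (1, 0); first by rewrite xpair_eqE oner_eq0.
    rewrite /= cubic_dx_comb cubic_dy_comb -/fx' -/gx' -/fy' -/gy' fx0 gx0 fy0 gy0.
    by split; ring.
  exists (gy', - fy') => //=.
  rewrite cubic_dx_comb cubic_dy_comb -/fx' -/gx' -/fy' -/gy' fx0 gx0.
  by split; ring.
exists (gx', - fx') => //=.
rewrite cubic_dx_comb cubic_dy_comb -/fx' -/gx' -/fy' -/gy'; split; first by ring.
by transitivity (- J); [rewrite /J -/fx' -/gx' -/fy' -/gy'; ring | rewrite J0 oppr0].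
Qed.

Lemma coefM_top i j (a b : {poly K}) : (size a <= i.+1)%N -> (size b <= j.+1)%N ->
  (a * b)`_(i + j) = a`_i * b`_j.
Proof.
move=> ha hb; have := @bformM _ i j a b 1 0 ha hb.
by rewrite !bform_inf !expr1n !mulr1.
Qed.

Lemma polyX_factor d (p : {poly K}) : p`_0 = 0 -> (size p <= d.+1)%N ->
  exists2 p', p = 'X * p' & (size p' <= d)%N.
Proof.
move=> p0 sp; have /factor_theorem[p' Ep] : root p 0 by rewrite /root horner_coef0 p0.
rewrite subr0 in Ep; exists p'; first by rewrite mulrC.
have [->|p'0] := eqVneq p' 0; first by rewrite size_poly0.
by move: sp; rewrite Ep size_mulX.
Qed.

Lemma size_drop_lead d (p : {poly K}) : p`_d = 0 -> (size p <= d.+1)%N -> (size p <= d)%N.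
Proof.
move=> pd sp; rewrite -ltnS ltn_neqAle sp andbT; apply/negP => /eqP [e].
have /eqP : lead_coef p = 0 by rewrite lead_coefE e.
by rewrite lead_coef_eq0 -size_poly_eq0 e.
Qed.

(* The pencil has two more base points (0, 1, 0) and (0, 0, 1); the last root *)
(* of the resultant is found from its extreme coefficients.                   *)
Lemma last_direction (ts : seq K) (y z : K) :
  n`_0 = 0 -> n`_3 = 0 -> n'`_0 = 0 -> n'`_3 = 0 ->
  size ts = 5%N -> uniq ts -> 0 \notin ts ->
  {in ts, forall t, exists x, base_pt (x, t, 1)} -> z != 0 ->
  - (q'`_2 * (q`_2 * n'`_2 - q'`_2 * n`_2)) * (\prod_(t <- ts) t) * y
    = q`_0 * (q`_0 * n'`_1 - q'`_0 * n`_1) * z ->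
  pencil_res.[y / z] = 0 /\ (y / z \in ts -> pencil_res^`().[y / z] = 0).
Proof.
move=> n0 n3 n0' n3' sts uts ts0 bts z0 eyz.
have [v nv sv] := polyX_factor n0 (size_drop_lead n3 sn).
have [v' nv' sv'] := polyX_factor n0' (size_drop_lead n3' sn').
(* The base point (0, 0, 1) contributes the root 0 and (0, 1, 0) the root at infinity. After
   removing both, a sextic with the five roots [ts] and one more root is left. *)
pose rs := 'X * ('X * v' - v) ^+ 2 - ('X * q' - q) * (q * v' - q' * v).
have res_rs : pencil_res = 'X * rs by rewrite /pencil_res /rs nv nv'; ring.
have sXv : (size ('X * v' - v)%R <= 3)%N.
  apply: size_sub_le; last by apply: leq_trans sv _.
  by apply: (@size_mul_le 1 1); rewrite ?size_polyX.
have sqv : (size (q * v' - q' * v)%R <= 4)%N by apply: size_sub_le; apply: (@size_mul_le 2 1).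
have sX1 : (size ('X * ('X * v' - v) ^+ 2)%R <= 6)%N.
  by apply: (@size_mul_le 1 4); rewrite ?size_polyX //; apply: (@size_mul_le 2 2).
have srs : (size rs <= 7)%N.
  by apply: size_sub_le; [apply: leq_trans sX1 _ | apply: (@size_mul_le 3 3)].
have rs6 : rs`_6 = - (q'`_2 * (q`_2 * n'`_2 - q'`_2 * n`_2)).
  rewrite coefB nth_default // sub0r (@coefM_top 3 3) // nv nv'; congr (- (_ * _)).
    by rewrite coefB coefXM /= [X in _ - X]nth_default ?subr0.
  by rewrite coefB (@coefM_top 2 1) // (@coefM_top 2 1) // !coefXM.
have rs0 : rs`_0 = q`_0 * (q`_0 * n'`_1 - q'`_0 * n`_1).
  rewrite nv nv' !coefXM /= -!horner_coef0 /rs.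
  by rewrite !(hornerD, hornerM, hornerN, hornerX, hornerXn, horner_exp); ring.
have rt t : t \in ts -> rs.[t] = 0.
  move=> tts; have [x bx] := bts t tts.
  have := pencil_res_base bx; rewrite /= bform1 ?size_pencil_res // res_rs hornerM hornerX.
  by move/eqP; rewrite mulf_eq0 => /orP[/eqP t0|/eqP //]; move: ts0; rewrite -t0 tts.
have [k Ek] : exists k, rs = k * \prod_(t <- ts) ('X - t%:P).
  apply: uniq_roots_prod_XsubC; last by rewrite uniq_rootsE.
  by apply/allP => t /rt /eqP.
set P := \prod_(t <- ts) _ in Ek.
have sP : size P = 6%N by rewrite size_prod_XsubC sts.
have Pm : P \is monic by apply: monic_prod_XsubC.
have sk : (size k <= 2)%N.
  have [->|k0] := eqVneq k 0; first by rewrite size_poly0.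
  by move: srs; rewrite Ek size_Mmonic // sP addnS -[7%N]/(2 + 5)%N leq_add2r.
have k1 : k`_1 = rs`_6.
  rewrite Ek (@coefM_top 1 5) ?sP // -[P`_5]/(P`_6.-1) -[in P`__]sP -lead_coefE.
  by rewrite (monicP Pm) mulr1.
have k0 : rs`_0 = - (k`_0 * \prod_(t <- ts) t).
  rewrite Ek -!horner_coef0 hornerM -mulrN; congr (_ * _).
  rewrite horner_prod; transitivity (\prod_(t <- ts) - t).
    by apply: eq_bigr => t _; rewrite !hornerE.
  move: sts; case: (ts) => [|a [|b [|c [|d [|e []]]]]] // _; rewrite !big_cons !big_nil; ring.
have pts : \prod_(t <- ts) t != 0.
  by rewrite prodf_seq_neq0; apply/allP => t tts /=; apply: contraNneq ts0 => <-.
have kt : k.[y / z] = 0.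
  rewrite (@horner_coef_wide _ 2) // !big_ord_recl big_ord0 /= expr0 expr1 mulr1 addr0.
  apply: (mulfI pts); rewrite mulr0; apply: (mulIf z0); rewrite mul0r.
  transitivity (k`_1 * (\prod_(t <- ts) t) * y + k`_0 * \prod_(t <- ts) t * z); first by field.
  rewrite k1 rs6 eyz -rs0 k0; ring.
split; first by rewrite res_rs Ek !hornerM kt; ring.
move=> tts; have [c Ec] : exists c, k = c * ('X - (y / z)%:P).
  by apply/factor_theorem/eqP.
rewrite res_rs Ek Ec /P (big_rem _ tts) /=; set P' := \prod_(i <- _) _.
by rewrite !derivE !(hornerD, hornerM, hornerN, hornerX, hornerC) subrr; ring.
Qed.
End TransversalPencil.
End Pencil.
End ChartCubics.

(** * Ternary forms *)

Notation o0 := (@Ordinal 3 0 isT).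
Notation o1 := (@Ordinal 3 1 isT).
Notation o2 := (@Ordinal 3 2 isT).

Lemma ord3P (P : 'I_3 -> Prop) : P o0 -> P o1 -> P o2 -> forall i, P i.
Proof.
move=> p0 p1 p2 [[|[|[|//]]] i3].
- by rewrite (_ : Ordinal i3 = o0) //; apply: val_inj.
- by rewrite (_ : Ordinal i3 = o1) //; apply: val_inj.
- by rewrite (_ : Ordinal i3 = o2) //; apply: val_inj.
Qed.

Lemma sum_ord3 (V : nmodType) (f : 'I_3 -> V) : \sum_i f i = f o0 + f o1 + f o2.
Proof.
rewrite !big_ord_recl big_ord0 addr0 addrA.
by congr (_ + _ + _); congr f; apply: val_inj.
Qed.

Lemma poly_fun_eq0 (R : idomainType) (p : {poly R}) : nat_faithful R ->
  (forall n : nat, p.[n%:R] = 0) -> p = 0.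
Proof.
move=> R0 h; apply/eqP/negP => /negP p0.
have us : uniq [seq n%:R : R | n <- iota 0 (size p)].
  rewrite map_inj_uniq ?iota_uniq // => m n /eqP e.
  wlog mn : m n e / (m <= n)%N.
    by move=> wl; case: (leqP m n) => [/wl|/ltnW/wl h']; [exact | rewrite h' // eq_sym].
  by apply/eqP; rewrite eqn_leq mn -subn_eq0 -R0 natrB // subr_eq0 eq_sym.
have := max_poly_roots p0 _ us; rewrite size_map size_iota ltnn => h'.
by apply/notF/h'/allP => _ /mapP[n _ ->]; apply/eqP.
Qed.

Section TernaryForms.
Variable K : fieldType.
Implicit Types (f g h : {mpoly K[3]}) (u : K * K * K) (v w : 'rV[K]_3) (A B : 'M[K]_3).

Definition feval f w : K := f.@[fun i => w 0 i].
Definition row3 u : 'rV[K]_3 := \row_i nth 0 [:: u.1.1; u.1.2; u.2] i.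
Definition pt3 w : K * K * K := (w 0 o0, w 0 o1, w 0 o2).

Lemma pt3K : cancel pt3 row3.
Proof. by move=> w; apply/rowP; elim/ord3P; rewrite mxE. Qed.

Lemma row3K : cancel row3 pt3.
Proof. by move=> [[a b] c]; rewrite /pt3 !mxE. Qed.

Lemma feval_homog d f w : f \is d.-homog ->
  feval f w = \sum_(m <- monomials d) f@_(mnm_of m) * mono_value (pt3 w) m.
Proof.
move=> fd; rewrite -(homog_mmap (@idfun K) fd) /feval /meval.
rewrite /mmap; apply: eq_bigr => m _; congr (_ * _); rewrite /mmap1.
by apply: eq_bigr => i _; elim/ord3P: i.
Qed.

Lemma fevalD f g w : feval (f + g) w = feval f w + feval g w. Proof. exact: mevalD. Qed.
Lemma fevalZ c f w : feval (c *: f) w = c * feval f w. Proof. exact: mevalZ. Qed.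
Lemma fevalM f g w : feval (f * g) w = feval f w * feval g w. Proof. exact: mevalM. Qed.

Lemma feval_scale d f c w : f \is d.-homog -> feval f (c *: w) = c ^+ d * feval f w.
Proof.
move=> fd; rewrite !(feval_homog _ fd) mulr_sumr; apply: eq_big_seq => m mM.
have := mdeg_mnm_of mM; rewrite mdegE sum_ord3 !mnmE /= => e.
rewrite /mono_value /= !mxE !exprMn -e !exprD; ring.
Qed.

Lemma homog_fun_eq0 d f : nat_faithful K -> f \is d.-homog ->
  (forall w, feval f w = 0) -> f = 0.
Proof.
move=> K0 fd f0; rewrite (homog_expand fd).
(* Kronecker's substitution separates the monomials of degree d. *)
pose p : {poly K} := \sum_(m <- monomials d) (f@_(mnm_of m))%:P * 'X^(m.1.1 + d.+1 * m.1.2).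
have p0 : p = 0.
  apply: poly_fun_eq0 => // n; rewrite -[RHS](f0 (row3 (n%:R, n%:R ^+ d.+1, 1))).
  rewrite (feval_homog _ fd) row3K horner_sum; apply: eq_bigr => m _.
  by rewrite hornerM hornerC hornerXn /mono_value expr1n mulr1 exprD exprM.
apply: big1_seq => m /andP[_ mM].
have le m' : m' \in monomials d -> (m'.1.1 < d.+1)%N.
  by move/mdeg_mnm_of; rewrite mdegE sum_ord3 !mnmE /=; lia.
have := congr1 (fun p : {poly K} => p`_(m.1.1 + d.+1 * m.1.2)) p0.
rewrite coef0 coef_sum (bigD1_seq m) ?uniq_monomials //= coefCM coefXn eqxx mulr1.
rewrite big_seq_cond big1 ?addr0 => [->|m' /andP[m'M m'm]]; first by rewrite scale0r.
rewrite coefCM coefXn; case: eqP => [e|]; last by rewrite mulr0.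
case/eqP: m'm; apply: mnm_of_inj.
have e1 : m.1.1 = m'.1.1.
  have := congr1 (fun k => k %% d.+1)%N e.
  by rewrite ![(_ + d.+1 * _)%N]addnC ![(d.+1 * _)%N]mulnC !modnMDl !modn_small ?le.
have e2 : m.1.2 = m'.1.2 by move: e; rewrite e1 => /addnI/eqP; rewrite eqn_mul2l => /eqP.
have := mdeg_mnm_of mM; rewrite -(mdeg_mnm_of m'M) !mdegE !sum_ord3 !mnmE /=.
rewrite e1 e2 => /addnI e3; apply/mnmP; rewrite /mnm_of e1 e2 e3.
by elim/ord3P => /=; rewrite !mnmE.
Qed.

Lemma homog_fun_inj d f g : nat_faithful K -> f \is d.-homog -> g \is d.-homog ->
  (forall w, feval f w = feval g w) -> f = g.
Proof.
move=> K0 fd gd e; apply/eqP; rewrite -subr_eq0; apply/eqP.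
apply: (homog_fun_eq0 K0 (rpredB fd gd)) => w.
by rewrite fevalD -scaleN1r fevalZ e mulN1r subrr.
Qed.

Definition lform A j : {mpoly K[3]} := \sum_i A i j *: 'X_i.

Lemma feval_lform A j w : feval (lform A j) w = (w *m A) 0 j.
Proof.
rewrite /feval /lform raddf_sum mxE; apply: eq_bigr => i _.
by rewrite /= mevalZ mevalXU mulrC.
Qed.

Lemma lform_homog A j : lform A j \is 1.-homog.
Proof. by apply: rpred_sum => i _; apply: dhomogZ; rewrite dhomogX; apply/eqP/mdeg1. Qed.

Definition lforms A := (lform A o0, lform A o1, lform A o2).

Definition form_poly d (c : nat * nat * nat -> K) A : {mpoly K[3]} :=
  \sum_(m <- monomials d) c m *: mono_value (lforms A) m.

Lemma mono_value_homog d m A : m \in monomials d -> mono_value (lforms A) m \is d.-homog.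
Proof.
move=> /mdeg_mnm_of; rewrite mdegE sum_ord3 !mnmE /= => <-.
have h j k : lform A j ^+ k \is k.-homog.
  by have := dhomogMn k (lform_homog A j); rewrite mul1n.
by rewrite /mono_value !dhomogM ?h.
Qed.

Lemma form_poly_homog d c A : form_poly d c A \is d.-homog.
Proof.
rewrite /form_poly big_seq; apply: rpred_sum => m mM.
by apply: dhomogZ; apply: mono_value_homog.
Qed.

Lemma feval_mono_value m A w :
  feval (mono_value (lforms A) m) w = mono_value (pt3 (w *m A)) m.
Proof. by rewrite /mono_value !fevalM /feval !rmorphXn /= -!/(feval _ w) !feval_lform. Qed.

Lemma feval_form_poly d c A w : feval (form_poly d c A) w
  = \sum_(m <- monomials d) c m * mono_value (pt3 (w *m A)) m.
Proof.
rewrite /feval raddf_sum; apply: eq_bigr => m _.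
by rewrite -feval_mono_value -fevalZ.
Qed.

Definition pullback A f : {mpoly K[3]} :=
  mmap (@mpolyC 3 K) (fun i : 'I_3 => nth 0 [:: lform A o0; lform A o1; lform A o2] i) f.

Lemma pullbackE A d f : f \is d.-homog ->
  pullback A f = form_poly d (fun m => f@_(mnm_of m)) A.
Proof.
move=> fd; rewrite /pullback -[[:: _; _; _]]/([:: (lforms A).1.1; (lforms A).1.2; (lforms A).2]).
by rewrite (homog_mmap _ fd); apply: eq_bigr => m _; rewrite mul_mpolyC.
Qed.

Lemma pullback_homog A d f : f \is d.-homog -> pullback A f \is d.-homog.
Proof. by move=> fd; rewrite (pullbackE _ fd) form_poly_homog. Qed.

Lemma feval_pullback A d f w : f \is d.-homog -> feval (pullback A f) w = feval f (w *m A).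
Proof. by move=> fd; rewrite (pullbackE _ fd) feval_form_poly (feval_homog _ fd). Qed.

Lemma pullback_comb A f g s s' :
  pullback A (s *: f + s' *: g) = s *: pullback A f + s' *: pullback A g.
Proof. by rewrite /pullback mmapD !mmapZ !mul_mpolyC. Qed.

Lemma size_chart_part A f d (e : nat -> nat * nat * nat) :
  (size (\poly_(i < d) (pullback A f)@_(mnm_of (e i))) <= d)%N.
Proof. exact: size_poly. Qed.

(* The cubic f in the frame given by the rows of A, without its term in x ^ 3. *)
Definition chart A f : chart_cubic K :=
  ChartCubic (size_chart_part A f 2 (fun i => (2, i, 1 - i)%N))
    (size_chart_part A f 3 (fun i => (1, i, 2 - i)%N))
    (size_chart_part A f 4 (fun i => (0, i, 3 - i)%N)).

Lemma ceval_chart A f u : f \is 3.-homog -> feval f (row o0 A) = 0 ->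
  ceval (chart A f) u = feval f (row3 u *m A).
Proof.
move=> fd f0; have e0 : row o0 A = row3 (1, 0, 0) *m A.
  by rewrite rowE; congr (_ *m _); apply/rowP; elim/ord3P; rewrite !mxE.
move: f0; rewrite e0 -!(feval_pullback _ _ fd) !(feval_homog _ (pullback_homog A fd)) !row3K.
set p := pullback A f; rewrite /monomials /= !big_cons !big_nil /mono_value /=.
rewrite !(expr1n, expr0n, expr0, expr1, mulr0, mulr1, mul0r, add0r, addr0) /= => p0.
rewrite /ceval /bform !big_ord_recl !big_ord0 /= !coef_poly /= -/p; clearbody p.
case: u => [[x y] z] /=; rewrite p0 /bump /=.
rewrite !subn0 !subnn -!/(1 - 0)%N; ring.
Qed.

Lemma chart_eq (h h' : chart_cubic K) : lin_part h = lin_part h' ->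
  quad_part h = quad_part h' -> cub_part h = cub_part h' -> h = h'.
Proof.
case: h h' => [L q n sL sq sn] [L' q' n' sL' sq' sn'] /= eL eq en.
by subst; congr ChartCubic; apply: eq_irrelevance.
Qed.

Lemma chart_comb A f g s s' :
  chart A (s *: f + s' *: g) = cubic_comb (chart A f) (chart A g) s s'.
Proof.
have E d (e : nat -> nat * nat * nat) :
    \poly_(i < d) (pullback A (s *: f + s' *: g))@_(mnm_of (e i))
    = s%:P * \poly_(i < d) (pullback A f)@_(mnm_of (e i))
      + s'%:P * \poly_(i < d) (pullback A g)@_(mnm_of (e i)).
  apply/polyP => i; rewrite coefD !coefCM !coef_poly; case: ifP; last by rewrite !mulr0 addr0.
  by rewrite pullback_comb mcoeffD !mcoeffZ.
by apply: chart_eq; rewrite /= !E.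
Qed.
End TernaryForms.

(** * The determinants in terms of the coefficients of the pencil *)

Lemma det_altsum (R : comNzRingType) (rows : seq (seq R)) (isz : R -> bool) :
  (forall x, isz x -> x = 0 :> R) ->
  \det (\matrix_(i < 5, j < 5) (nth [::] rows i)`_j)
  = altsum (det_step 0 rows) *%R (fun x y => x - y) isz 5 [::]
      [seq nat_of_ord i | i <- enum 'I_5] 1.
Proof.
move=> iszP; rewrite (altsumE _ iszP) mul1r; apply: eq_bigr => s _; congr (_ * _).
rewrite enum_ord_inord /= /det_step /= !big_ord_recl big_ord0 !mxE.
by do 5!(congr (_ * _); first by congr (_ `_ (s _)); apply: val_inj; rewrite /= inordK).
Qed.

Section DeterminantRelations.
Variable R : comNzRingType.
Implicit Types (q : 'I_5 -> R * R * R) (d : 'I_5 -> R) (G : seq (seq R)).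

Lemma row_det_mul (r r' : R * R * R -> seq R) q d G :
  (forall i j : 'I_5, d i * (r' (q i))`_j = \sum_(k < 5) (r (q i))`_k * (nth [::] G k)`_j) ->
  (\prod_i d i) * row_det r' q
  = row_det r q * \det (\matrix_(i < 5, j < 5) (nth [::] G i)`_j).
Proof.
move=> h; rewrite /row_det -det_mulmx.
have -> : \prod_i d i = \det (diag_mx (\row_i d i)).
  by rewrite det_diag; apply: eq_bigr => i _; rewrite mxE.
rewrite -det_mulmx; congr (\det _); apply/matrixP => i j.
by rewrite mul_diag_mx !mxE h; apply: eq_bigr => k _; rewrite !mxE.
Qed.

Lemma forall_ord5 (P : 'I_5 -> Prop) : P (@Ordinal 5 0 isT) -> P (@Ordinal 5 1 isT) ->
  P (@Ordinal 5 2 isT) -> P (@Ordinal 5 3 isT) -> P (@Ordinal 5 4 isT) -> forall i, P i.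
Proof.
by move=> p0 p1 p2 p3 p4 [[|[|[|[|[|//]]]]] i5];
  rewrite (bool_irrelevance i5 isT).
Qed.

Variables (q : 'I_5 -> R * R * R) (f2 f1 f0 f4 f3 g2 g1 g0 g4 g3 : R).
Hypothesis fq : forall i x y z, q i = (x, y, z) ->
  x * x * y + (f2 * (x * y * y) + f1 * (x * y * z) + f0 * (x * z * z) + f4 * (y * y * z)
   + f3 * (y * z * z)) = 0.
Hypothesis gq : forall i x y z, q i = (x, y, z) ->
  x * x * z + (g2 * (x * y * y) + g1 * (x * y * z) + g0 * (x * z * z) + g4 * (y * y * z)
   + g3 * (y * z * z)) = 0.

Let isz0 (x : R) : false -> x = 0. Proof. by []. Qed.

Lemma nodal_det_mul r' d G :
  (forall i (j : 'I_5), d i * (r' (q i))`_j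
    = \sum_(k < 5) (cubic_row (q i))`_k * (nth [::] G k)`_j) ->
  (\prod_i d i) * row_det r' q = nodal_det 0 q
    * altsum (det_step 0 G) *%R (fun x y => x - y) (fun=> false) 5 [::]
        [seq nat_of_ord i | i <- enum 'I_5] 1.
Proof. by move=> h; rewrite (row_det_mul h) (det_altsum _ isz0). Qed.

(** Multiplied by z, each monomial of a conic through (0, 0, 1) is an entry of [cubic_row] or x ^ 2
    z, and g reduces the latter. The matrix of this substitution has determinant g2. *)
Lemma conic_det2_eq : (\prod_i (q i).2) * conic_det 2 q = nodal_det 0 q * g2.
Proof.
rewrite (@nodal_det_mul _ _
  [:: [:: 0; 0; - g2; 0; 0]; [:: 0; 0; - g1; 1; 0]; [:: 1; 0; - g0; 0; 0];
      [:: 0; 0; - g4; 0; 1]; [:: 0; 1; - g3; 0; 0]]).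
  congr (_ * _); rewrite enum_ord_inord /= !inordK // /det_step /=; ring.
move=> i; case qi: (q i) => [[x y] z]; have /eqP := gq qi; rewrite addr_eq0 => /eqP e.
have E : z * (x * x) = - (g2 * (x * y * y) + g1 * (x * y * z) + g0 * (x * z * z)
  + g4 * (y * y * z) + g3 * (y * z * z)) by rewrite -e; ring.
by elim/forall_ord5; rewrite /= !big_ord_recl big_ord0 /= /bump /= ?E; ring.
Qed.

Lemma conic_det1_eq : (\prod_i (q i).1.2) * conic_det 1 q = nodal_det 0 q * f0.
Proof.
rewrite (@nodal_det_mul _ _
  [:: [:: 0; 1; 0; 0; - f2]; [:: 0; 0; 0; 1; - f1]; [:: 0; 0; 0; 0; - f0];
      [:: 1; 0; 0; 0; - f4]; [:: 0; 0; 1; 0; - f3]]).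
  congr (_ * _); rewrite enum_ord_inord /= !inordK // /det_step /=; ring.
move=> i; case qi: (q i) => [[x y] z]; have /eqP := fq qi; rewrite addr_eq0 => /eqP e.
have E : y * (x * x) = - (f2 * (x * y * y) + f1 * (x * y * z) + f0 * (x * z * z)
  + f4 * (y * y * z) + f3 * (y * z * z)) by rewrite -e; ring.
by elim/forall_ord5; rewrite /= !big_ord_recl big_ord0 /= /bump /= ?E; ring.
Qed.

(** The rotated cubic row contains x ^ 2 y and x ^ 2 z, which f and g express through [cubic_row].
    Together the four relations turn the extreme coefficients of the resultant into the determinants
    of the formula. *)
Lemma nodal_det1_eq : nodal_det 1 q = nodal_det 0 q * (f4 * g2 - f2 * g4).
Proof.
rewrite -[LHS]mul1r -[X in X * _](@big1_eq _ 1 *%R _ (index_enum 'I_5) xpredT).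
rewrite (@nodal_det_mul _ _
  [:: [:: 0; 0; - f2; 0; - g2]; [:: 0; 1; - f1; 0; - g1]; [:: 0; 0; - f0; 1; - g0];
      [:: 0; 0; - f4; 0; - g4]; [:: 1; 0; - f3; 0; - g3]]).
  congr (_ * _); rewrite enum_ord_inord /= !inordK // /det_step /=; ring.
move=> i; case qi: (q i) => [[x y] z]; have := fq qi; have /eqP := gq qi.
rewrite addr_eq0 => /eqP e /eqP; rewrite addr_eq0 => /eqP e'.
have E : z * x * x = - (g2 * (x * y * y) + g1 * (x * y * z) + g0 * (x * z * z)
  + g4 * (y * y * z) + g3 * (y * z * z)) by rewrite -e; ring.
have E' : y * x * x = - (f2 * (x * y * y) + f1 * (x * y * z) + f0 * (x * z * z)
  + f4 * (y * y * z) + f3 * (y * z * z)) by rewrite -e'; ring.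
by elim/forall_ord5; rewrite /= !big_ord_recl big_ord0 /= /bump /= ?E ?E'; ring.
Qed.

Lemma nodal_det2_eq : nodal_det 2 q = nodal_det 0 q * (f0 * g3 - g0 * f3).
Proof.
rewrite -[LHS]mul1r -[X in X * _](@big1_eq _ 1 *%R _ (index_enum 'I_5) xpredT).
rewrite (@nodal_det_mul _ _
  [:: [:: - g2; 0; 0; - f2; 1]; [:: - g1; 1; 0; - f1; 0]; [:: - g0; 0; 0; - f0; 0];
      [:: - g4; 0; 1; - f4; 0]; [:: - g3; 0; 0; - f3; 0]]).
  congr (_ * _); rewrite enum_ord_inord /= !inordK // /det_step /=; ring.
move=> i; case qi: (q i) => [[x y] z]; have := fq qi; have /eqP := gq qi.
rewrite addr_eq0 => /eqP e /eqP; rewrite addr_eq0 => /eqP e'.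
have E : z * x * x = - (g2 * (x * y * y) + g1 * (x * y * z) + g0 * (x * z * z)
  + g4 * (y * y * z) + g3 * (y * z * z)) by rewrite -e; ring.
have E' : x * x * y = - (f2 * (x * y * y) + f1 * (x * y * z) + f0 * (x * z * z)
  + f4 * (y * y * z) + f3 * (y * z * z)) by rewrite -e'; ring.
by elim/forall_ord5; rewrite /= !big_ord_recl big_ord0 /= /bump /= ?E ?E'; ring.
Qed.
End DeterminantRelations.

(** * Projective frames *)

Section Frames.
Variable K : fieldType.
Implicit Types (u v w : 'rV[K]_3) (B : 'M[K]_3).

Definition frame u v w : 'M[K]_3 := \matrix_(r < 3) tnth [tuple u; v; w] r.

Lemma row0_frame u v w : row o0 (frame u v w) = u.
Proof. by rewrite rowK. Qed.

Lemma row1_frame u v w : row o1 (frame u v w) = v.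
Proof. by rewrite rowK. Qed.

Lemma row2_frame u v w : row o2 (frame u v w) = w.
Proof. by rewrite rowK. Qed.

Lemma det_frame u v w : \det (frame u v w) = br (pt3 u) (pt3 v) (pt3 w).
Proof.
pose l (x : 'rV[K]_3) := [:: x 0 o0; x 0 o1; x 0 o2].
have -> : frame u v w = \matrix_(i, j) (nth [::] [:: l u; l v; l w] i)`_j.
  by apply/matrixP; elim/ord3P; elim/ord3P; rewrite !mxE.
rewrite (expand_det_row _ ord0) /cofactor !big_ord_recl !big_ord0.
rewrite !(expand_det_row _ ord0) /cofactor !big_ord_recl !big_ord0 !det_mx11 !mxE /br /=.
ring.
Qed.

Lemma row3_mul (x : K * K * K) B :
  row3 x *m B = x.1.1 *: row o0 B + x.1.2 *: row o1 B + x.2 *: row o2 B.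
Proof. by apply/rowP => j; rewrite !mxE sum_ord3 !mxE. Qed.

Lemma coordsK B w : B \in unitmx -> row3 (pt3 (w *m invmx B)) *m B = w.
Proof. by move=> Bu; rewrite pt3K mulmxKV. Qed.

Lemma row_coords B (x : K * K * K) : B \in unitmx -> pt3 (row3 x *m B *m invmx B) = x.
Proof. by move=> Bu; rewrite mulmxK ?row3K. Qed.

Lemma basis_pt_row B a : B \in unitmx -> (a < 3)%N ->
  forall i : 'I_3, i = a :> nat -> pt3 (row i B *m invmx B) = basis_pt K a.
Proof.
move=> Bu a3 i ia; rewrite rowE mulmxK // /pt3 /basis_pt !mxE -ia.
by rewrite ![_ == i]eq_sym.
Qed.

Definition par u v : Prop := exists2 c, c != 0 & v = c *: u.

Lemma par_sym u v : par u v -> par v u.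
Proof. by case=> c c0 ->; exists c^-1; rewrite ?invr_eq0 // scalerA mulVf ?scale1r. Qed.

Lemma par_trans u v w : par u v -> par v w -> par u w.
Proof.
by case=> c c0 -> [d d0 ->]; exists (d * c); rewrite ?mulf_neq0 // scalerA.
Qed.

Lemma parP u v : u != 0 -> v != 0 -> reflect (par u v) (u == v)%MS.
Proof.
move=> u0 v0; apply: (iffP idP) => [/andP[_ /sub_rVP[c e]]|[c c0 ->]].
  by exists c => //; apply: contraNneq v0 => c0; rewrite e c0 scale0r.
apply/andP; split; last exact: scalemx_sub.
by rewrite -[X in (X <= _)%MS]scale1r -(mulVf c0) -scalerA scalemx_sub.
Qed.

(** The determinants with a basis vector as third row are the coordinates of the cross product of u
    and v; if all vanish, u and v are proportional. *)
Lemma frame_exists2 u v : u != 0 -> v != 0 -> ~ par u v ->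
  exists w, frame u v w \in unitmx.
Proof.
move=> u0 v0 uv.
have [|n0] := boolP [exists k : 'I_3, \det (frame u v (delta_mx 0 k)) != 0].
  by case/existsP=> k dk; exists (delta_mx 0 k); rewrite unitmxE unitfE.
case: uv; move: n0; rewrite negb_exists => /forallP n0.
have h k : br (pt3 u) (pt3 v) (pt3 (delta_mx 0 k)) = 0.
  by have := n0 k; rewrite negbK det_frame => /eqP.
have e2 : u 0 o0 * v 0 o1 = u 0 o1 * v 0 o0.
  by apply/subr0_eq; rewrite -(h o2) /br /pt3 !mxE /=; ring.
have e1 : u 0 o0 * v 0 o2 = u 0 o2 * v 0 o0.
  by apply/subr0_eq; rewrite -[RHS]oppr0 -(h o1) /br /pt3 !mxE /=; ring.
have e0 : u 0 o1 * v 0 o2 = u 0 o2 * v 0 o1.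
  by apply/subr0_eq; rewrite -(h o0) /br /pt3 !mxE /=; ring.
have key k : u 0 k != 0 -> (forall j, u 0 k * v 0 j = u 0 j * v 0 k) -> par u v.
  move=> uk hk; have vE : v = (v 0 k / u 0 k) *: u.
    by apply/rowP => j; rewrite mxE; apply: (mulfI uk); rewrite hk; field.
  exists (v 0 k / u 0 k) => //; apply: contraNneq v0 => e; by rewrite vE e scale0r.
have : [|| u 0 o0 != 0, u 0 o1 != 0 | u 0 o2 != 0].
  rewrite -!negb_and; apply: contraNN u0 => /and3P[/eqP a /eqP b /eqP c].
  by apply/eqP/rowP; elim/ord3P; rewrite mxE.
by case/or3P=> uk; apply: (key _ uk); elim/ord3P; rewrite // mulrC [RHS]mulrC.
Qed.

Lemma frame_exists u : u != 0 -> exists v w, frame u v w \in unitmx.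
Proof.
move=> u0; have d0 k : delta_mx 0 k != 0 :> 'rV[K]_3.
  by apply/eqP => /rowP/(_ k)/eqP; rewrite !mxE !eqxx oner_eq0.
have [p0|np] := boolP (u == (delta_mx 0 o0 : 'rV[K]_3))%MS; last first.
  have np' : ~ par u (delta_mx 0 o0) by move/(introT (parP u0 (d0 o0))); apply/negP.
  by have [w hw] := frame_exists2 u0 (d0 o0) np'; exists (delta_mx 0 o0), w.
have [|w hw] := @frame_exists2 u (delta_mx 0 o1) u0 (d0 _); last by exists (delta_mx 0 o1), w.
move=> /(par_trans (par_sym (elimT (parP u0 (d0 o0)) p0)))[c _ /rowP/(_ o1)/eqP].
by rewrite !mxE /= mulr0 oner_eq0.
Qed.
End Frames.

Definition base (K : fieldType) (f g : {mpoly K[3]}) (v : 'rV[K]_3) : Prop :=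
  feval f v = 0 /\ feval g v = 0.

(** * Local multiplicities *)

Lemma rescale_eq (F : fieldType) (u f x l : F) : x != 0 -> l != 0 ->
  u * (f / l ^+ 3) = u * (x / l) ^+ 3 * (f / x ^+ 3).
Proof. by move=> x0 l0; field; rewrite x0 l0. Qed.

Lemma inv_expansion (F : fieldType) (h a b t : F) : h != 0 -> a != 0 ->
  h^-1 = a^-1 + - b * (a^-1 * a^-1) * t - a^-1 * a^-1 * (h^-1 * (h * (a - b * t) - a * a)).
Proof. by move=> h0 a0; field; rewrite h0 a0. Qed.

Lemma quotient_rescale (F : fieldType) (a b x : F) : b != 0 -> x != 0 ->
  a / b = (a / x) * (b / x)^-1.
Proof. by move=> b0 x0; field; rewrite b0 x0. Qed.

Lemma clear_denominators (F : fieldType) (k x1 x0 a b a' b' f g : F) :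
  b != 0 -> b' != 0 -> x0 != 0 ->
  k * (x1 / x0) = a / b * (f / x0 ^+ 3) + a' / b' * (g / x0 ^+ 3) ->
  k * x1 * (b * b' * x0 ^+ 2) = a * b' * f + a' * b * g.
Proof.
move=> b0 b'0 x00 E; transitivity (k * (x1 / x0) * (b * b' * x0 ^+ 3)); first by field.
by rewrite E; field; rewrite b0 b'0 x00.
Qed.

Lemma dehomogenize (F : fieldType) (x0 x1 x2 : F) a b c : x0 != 0 ->
  x0 ^+ a * x1 ^+ b * x2 ^+ c / x0 ^+ (a + b + c) = (x1 / x0) ^+ b * (x2 / x0) ^+ c.
Proof.
move=> x00; have h n : x0 ^+ n != 0 by rewrite expf_neq0.
by rewrite !expr_div_n !exprD; field; rewrite !h.
Qed.

Lemma collect_cubic (F : comNzRingType) (l1 l0 q2 q1 q0 n3 n2 n1 n0 x y : F) :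
  n0 * (x ^+ 0 * y ^+ 3) + (n1 * (x ^+ 1 * y ^+ 2) + (n2 * (x ^+ 2 * y ^+ 1)
  + (n3 * (x ^+ 3 * y ^+ 0) + (q0 * (x ^+ 0 * y ^+ 2) + (q1 * (x ^+ 1 * y ^+ 1)
  + (q2 * (x ^+ 2 * y ^+ 0) + (l0 * (x ^+ 0 * y ^+ 1) + (l1 * (x ^+ 1 * y ^+ 0)
  + (0 * (x ^+ 0 * y ^+ 0) + 0)))))))))
  = l1 * x + l0 * y + (q2 * x ^+ 2 + q1 * x * y + q0 * y ^+ 2)
    + (n3 * x ^+ 3 + n2 * x ^+ 2 * y + n1 * x * y ^+ 2 + n0 * y ^+ 3).
Proof. by ring. Qed.

Lemma split_linear (F : comNzRingType) (l1 l0 q2 q1 q0 n3 n2 n1 n0 x y : F) :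
  l1 * x + l0 * y + (q2 * x ^+ 2 + q1 * x * y + q0 * y ^+ 2)
    + (n3 * x ^+ 3 + n2 * x ^+ 2 * y + n1 * x * y ^+ 2 + n0 * y ^+ 3)
  = (l1 + (q2 + n3 * x + n2 * y) * x + (q1 + n1 * y) * y) * x
    + (l0 + 0 * x + (q0 + n0 * y) * y) * y.
Proof. by ring. Qed.

Lemma split_tangent (F : comNzRingType) (l0 q2 q1 q0 n3 n2 n1 n0 x y : F) :
  0 * x + l0 * y + (q2 * x ^+ 2 + q1 * x * y + q0 * y ^+ 2)
    + (n3 * x ^+ 3 + n2 * x ^+ 2 * y + n1 * x * y ^+ 2 + n0 * y ^+ 3)
  = (q2 + n3 * x + n2 * y) * (x * x) + (l0 + (q1 + n1 * y) * x + (q0 + n0 * y) * y) * y.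
Proof. by ring. Qed.

Lemma sum_monomials3 (V : nmodType) (F : nat * nat * nat -> V) :
  \sum_(m <- monomials 3) F m = F (0, 0, 3)%N + (F (0, 1, 2)%N + (F (0, 2, 1)%N + (F (0, 3, 0)%N
  + (F (1, 0, 2)%N + (F (1, 1, 1)%N + (F (1, 2, 0)%N + (F (2, 0, 1)%N + (F (2, 1, 0)%N
  + (F (3, 0, 0)%N + 0))))))))).
Proof. by rewrite !big_cons big_nil. Qed.

Section LocalRing.
Variable K : fieldType.
Hypothesis K0 : nat_faithful K.
Variable B : 'M[K]_3.
Hypothesis Bu : B \in unitmx.
Let R : 'rV[K]_3 := row o0 B.
Local Notation FF := {fraction {mpoly K[3]}}.
Local Notation local := (in_local_ring R).
Implicit Types (f g a b : {mpoly K[3]}) (h u v : FF) (c : K).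

Definition kappa c : FF := tofrac (c%:MP : {mpoly K[3]}).
Definition lcoord j : {mpoly K[3]} := lform (invmx B) j.

Lemma kappaD : {morph kappa : x y / x + y}.
Proof. by move=> x y; rewrite /kappa mpolyCD tofracD. Qed.
Lemma kappaM : {morph kappa : x y / x * y}.
Proof. by move=> x y; rewrite /kappa mpolyCM tofracM. Qed.
Lemma kappaN : {morph kappa : x / - x}.
Proof. by move=> x; rewrite /kappa mpolyCN tofracN. Qed.
Lemma kappa0 : kappa 0 = 0. Proof. by rewrite /kappa mpolyC0 tofrac0. Qed.
Lemma kappa1 : kappa 1 = 1. Proof. by rewrite /kappa mpolyC1 tofrac1. Qed.
Lemma kappa_eq0 c : (kappa c == 0) = (c == 0).
Proof. by rewrite /kappa tofrac_eq0 mpolyC_eq0. Qed.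

Lemma fevalC c w : feval (c%:MP : {mpoly K[3]}) w = c.
Proof. exact: mevalC. Qed.

Lemma homogC c : (c%:MP : {mpoly K[3]}) \is 0.-homog.
Proof. by rewrite -[c%:MP]mulr1 mul_mpolyC dhomogZ // dhomog1. Qed.

Lemma tofrac_neq0 b : feval b R != 0 -> tofrac b != 0.
Proof. by rewrite tofrac_eq0; apply: contraNneq => ->; rewrite /feval meval0. Qed.

(* Fractions regular at R, with the value of the numerator recorded. *)
Definition frac_at (h : FF) (x : K) : Prop :=
  exists d a b, [/\ a \is d.-homog, b \is d.-homog, feval b R != 0, h = tofrac a / tofrac b
    & feval a R = x * feval b R].

Lemma localP h : local h <-> exists x, frac_at h x.
Proof.
split=> [[d [a [b [ad bd /eqP bR ->]]]]|[x [d [a [b [ad bd bR -> _]]]]]].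
  by exists (feval a R / feval b R), d, a, b; split=> //; rewrite mulfVK.
by exists d, a, b; split=> //; apply/eqP.
Qed.

Lemma frac_at_local h x : frac_at h x -> local h.
Proof. by move=> hx; apply/localP; exists x. Qed.

Lemma frac_atC c : frac_at (kappa c) c.
Proof.
exists 0%N, c%:MP, 1; split; rewrite ?homogC ?dhomog1 //.
- by rewrite /feval meval1 oner_eq0.
- by rewrite tofrac1 divr1.
- by rewrite fevalC /feval meval1 mulr1.
Qed.

Lemma frac_atD h h' x x' : frac_at h x -> frac_at h' x' -> frac_at (h + h') (x + x').
Proof.
case=> d [a [b [ad bd bR -> e]]] [d' [a' [b' [ad' bd' bR' -> e']]]].
exists (d + d')%N, (a * b' + a' * b), (b * b'); split.
- by apply: rpredD; [| rewrite addnC]; apply: dhomogM.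
- exact: dhomogM.
- by rewrite fevalM mulf_neq0.
- by rewrite tofracD !tofracM addf_div ?tofrac_neq0.
- by rewrite fevalD !fevalM e e'; ring.
Qed.

Lemma frac_atM h h' x x' : frac_at h x -> frac_at h' x' -> frac_at (h * h') (x * x').
Proof.
case=> d [a [b [ad bd bR -> e]]] [d' [a' [b' [ad' bd' bR' -> e']]]].
exists (d + d')%N, (a * a'), (b * b'); split; rewrite ?dhomogM //.
- by rewrite fevalM mulf_neq0.
- by rewrite !tofracM mulf_div.
- by rewrite !fevalM e e'; ring.
Qed.

Lemma frac_atV h x : x != 0 -> frac_at h x -> frac_at h^-1 x^-1.
Proof.
move=> x0 [d [a [b [ad bd bR -> e]]]]; exists d, b, a; split=> //.
- by rewrite e mulf_neq0.
- by rewrite invf_div.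
- by rewrite e mulKf.
Qed.

Lemma frac_at_eq h x x' : frac_at h x -> frac_at h x' -> x = x'.
Proof.
case=> d [a [b [ad bd bR -> e]]] [d' [a' [b' [ad' bd' bR' E e']]]].
move/eqP: E; rewrite eqr_div ?tofrac_neq0 // -!tofracM.
rewrite tofrac_eq => /eqP /(congr1 (fun p => feval p R)); rewrite !fevalM e e'.
rewrite [x * _ * _]mulrAC -!mulrA => /(mulIf _) inj.
by apply: inj; rewrite mulf_neq0.
Qed.

Lemma localD h h' : local h -> local h' -> local (h + h').
Proof. by move=> /localP[x hx] /localP[y hy]; apply: frac_at_local (frac_atD hx hy). Qed.

Lemma localM h h' : local h -> local h' -> local (h * h').
Proof. by move=> /localP[x hx] /localP[y hy]; apply: frac_at_local (frac_atM hx hy). Qed.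

Lemma localC c : local (kappa c).
Proof. exact: frac_at_local (frac_atC c). Qed.

Lemma row0_coord j : (R *m invmx B) 0 j = (j == o0)%:R.
Proof. by rewrite /R rowE mulmxK // mxE eq_sym. Qed.

Lemma lcoord_homog j : lcoord j \is 1.-homog.
Proof. exact: lform_homog. Qed.

Lemma feval_lcoord j : feval (lcoord j) R = (j == o0)%:R.
Proof. by rewrite feval_lform row0_coord. Qed.

Lemma lcoord0_neq0 : tofrac (lcoord o0) != 0.
Proof. by apply: tofrac_neq0; rewrite feval_lcoord oner_eq0. Qed.

Definition affine j : FF := tofrac (lcoord j) / tofrac (lcoord o0).

Lemma frac_at_affine j : frac_at (affine j) (j == o0)%:R.
Proof.
exists 1%N, (lcoord j), (lcoord o0); rewrite !lcoord_homog !feval_lcoord eqxx.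
by split; rewrite ?oner_eq0 ?mulr1.
Qed.

Lemma local_affine j : local (affine j).
Proof. exact: frac_at_local (frac_at_affine j). Qed.

Definition local_eq f : FF := tofrac f / tofrac (lcoord o0) ^+ 3.

Lemma frac_at_local_eq f : f \is 3.-homog -> frac_at (local_eq f) (feval f R).
Proof.
move=> fd; exists 3%N, f, (lcoord o0 ^+ 3); split=> //.
- by have := dhomogMn 3 (lcoord_homog o0); rewrite mul1n.
- by rewrite /feval rmorphXn /= -/(feval _ R) feval_lcoord expf_neq0 // oner_eq0.
- by rewrite /local_eq -tofracXn.
- by rewrite [feval (_ ^+ _) _]rmorphXn /= -/(feval _ R) feval_lcoord expr1n mulr1.
Qed.

Lemma local_eq_comb s t f g : local_eq (s *: f + t *: g) = kappa s * local_eq f + kappa t * local_eq g.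
Proof. by rewrite /local_eq -!mul_mpolyC tofracD !tofracM mulrDl -!mulrA. Qed.

Section Ideal.
Variables f g : {mpoly K[3]}.
Hypotheses (fd : f \is 3.-homog) (gd : g \is 3.-homog).

Definition ideal h : Prop := exists u v, [/\ local u, local v & h = u * local_eq f + v * local_eq g].

(** Another choice of the linear form l multiplies a local equation by the cube of a unit, so l can
    be the first frame coordinate. *)
Lemma in_local_idealP h : in_local_ideal R 3 f 3 g h <-> ideal h.
Proof.
split=> [[l [u [v [ld /eqP lR lu lv ->]]]]|[u [v [lu lv ->]]]]; last first.
  exists (lcoord o0), u, v; split=> //; first exact: lcoord_homog.
  by rewrite /vanishes_at -/(feval _ R) feval_lcoord; apply/eqP/oner_neq0.
have lk : local (tofrac (lcoord o0) / tofrac l).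
  by exists 1%N, (lcoord o0), l; split; [exact: lcoord_homog | | apply/eqP |].
have lk3 : local ((tofrac (lcoord o0) / tofrac l) ^+ 3) by rewrite !exprS expr0 mulr1; exact: localM lk (localM lk lk).
have ln : tofrac l != 0 by exact: tofrac_neq0.
have xn := lcoord0_neq0.
exists (u * (tofrac (lcoord o0) / tofrac l) ^+ 3), (v * (tofrac (lcoord o0) / tofrac l) ^+ 3).
split; [exact: localM lu lk3 | exact: localM lv lk3 | rewrite /local_eq].
by rewrite (rescale_eq u (tofrac f) xn ln) (rescale_eq v (tofrac g) xn ln).
Qed.

Lemma idealM h h' : local h -> ideal h' -> ideal (h * h').
Proof.
move=> lh [u [v [lu lv ->]]]; exists (h * u), (h * v).
by split; [exact: localM | exact: localM | ring].
Qed.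

Lemma idealD h h' : ideal h -> ideal h' -> ideal (h + h').
Proof.
move=> [u [v [lu lv ->]]] [u' [v' [lu' lv' ->]]]; exists (u + u'), (v + v').
by split; [exact: localD | exact: localD | ring].
Qed.

Lemma idealC c h : ideal h -> ideal (kappa c * h).
Proof. exact/idealM/localC. Qed.

Lemma idealN h : ideal h -> ideal (- h).
Proof. by move/(idealC (-1)); rewrite kappaN kappa1 mulN1r. Qed.

Lemma ideal0 : ideal 0.
Proof.
exists (kappa 0), (kappa 0); split; rewrite ?kappa0 ?mul0r ?addr0 //; by rewrite -kappa0; apply: localC.
Qed.

Lemma ideal_comb s t : ideal (local_eq (s *: f + t *: g)).
Proof. by rewrite local_eq_comb; exists (kappa s), (kappa t); split=> //; apply: localC. Qed.

(** Cramer's rule in the local ring: a determinant with nonzero value at R is a unit. *)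
Lemma ideal_cramer (a11 a12 a21 a22 z1 z2 : FF) (d : K) : d != 0 ->
  local a11 -> local a12 -> local a21 -> local a22 ->
  frac_at (a11 * a22 - a12 * a21) d ->
  ideal (a11 * z1 + a12 * z2) -> ideal (a21 * z1 + a22 * z2) -> ideal z1 /\ ideal z2.
Proof.
move=> d0 l11 l12 l21 l22 dD i1 i2; set D := _ - _ in dD.
have lD := frac_at_local (frac_atV d0 dD).
have D0 : D != 0.
  apply/eqP => De; case/eqP: d0; rewrite De -kappa0 in dD.
  exact: frac_at_eq dD (frac_atC 0).
split.
  have -> : z1 = D^-1 * (a22 * (a11 * z1 + a12 * z2) + - (a12 * (a21 * z1 + a22 * z2))).
    by apply: (mulfI D0); rewrite mulrA divff // mul1r /D; ring.
  by apply: idealM => //; apply: idealD; [| apply: idealN]; apply: idealM.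
have -> : z2 = D^-1 * (a11 * (a21 * z1 + a22 * z2) + - (a21 * (a11 * z1 + a12 * z2))).
  by apply: (mulfI D0); rewrite mulrA divff // mul1r /D; ring.
by apply: idealM => //; apply: idealD; [| apply: idealN]; apply: idealM.
Qed.

Lemma ideal_full h : feval f R != 0 -> local h -> ideal h.
Proof.
move=> fR lh; exists (h * (local_eq f)^-1), (kappa 0); split.
- by apply: localM => //; apply: frac_at_local (frac_atV fR (frac_at_local_eq fd)).
- exact: localC.
rewrite kappa0 mul0r addr0 mulfVK // /local_eq mulf_neq0 ?tofrac_neq0 //.
by rewrite invr_neq0 // expf_neq0 // lcoord0_neq0.
Qed.

Hypothesis fg0 : base f g R.

Lemma ideal_value h : ideal h -> frac_at h 0.
Proof.
case=> u [v [/localP[x ux] /localP[y vy] ->]]; case: fg0 => f0 g0.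
have := frac_at_local_eq fd; have := frac_at_local_eq gd; rewrite f0 g0 => hg hf.
by have := frac_atD (frac_atM ux hf) (frac_atM vy hg); rewrite !mulr0 addr0.
Qed.

Section Generator.
Variable tau : FF.
Hypothesis ltau : local tau.
Hypothesis tau2 : ideal (tau * tau).
Hypothesis tau0 : frac_at tau 0.

(** The subspace K + K tau + ideal. It is a ring and contains the inverses of its units, so it is
    the whole local ring as soon as it contains both affine coordinates. *)
Definition span_tau h : Prop :=
  exists c0 c1 i, ideal i /\ h = kappa c0 + kappa c1 * tau + i.

Lemma span_tau_ideal h : ideal h -> span_tau h.
Proof. by move=> ih; exists 0, 0, h; rewrite kappa0 mul0r !add0r. Qed.

Lemma span_tauC c : span_tau (kappa c).
Proof. by exists c, 0, 0; rewrite kappa0 mul0r !addr0; split=> //; apply: ideal0. Qed.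

Lemma span_tauD h h' : span_tau h -> span_tau h' -> span_tau (h + h').
Proof.
move=> [a [b [i [ii ->]]]] [a' [b' [i' [ii' ->]]]].
by exists (a + a'), (b + b'), (i + i'); split; [exact: idealD | rewrite !kappaD; ring].
Qed.

Lemma local_span h : span_tau h -> local h.
Proof.
move=> [a [b [i [ii ->]]]]; apply: localD; last exact: frac_at_local (ideal_value ii).
by apply: localD; [exact: localC | apply: localM; [exact: localC|]].
Qed.

Lemma span_tauM h h' : span_tau h -> span_tau h' -> span_tau (h * h').
Proof.
move=> sh [a' [b' [i' [ii' ->]]]]; have lh := local_span sh.
move: sh => [a [b [i [ii hE]]]].
exists (a * a'), (a * b' + b * a'),
  (kappa (b * b') * (tau * tau) + i * (kappa a' + kappa b' * tau) + h * i'); split.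
  apply: idealD; last exact: idealM.
  apply: idealD; first exact: idealC.
  rewrite mulrC; apply: idealM => //; apply: localD; first exact: localC.
  by apply: localM => //; apply: localC.
by rewrite hE !(kappaM, kappaD); ring.
Qed.

(** For h = a + b tau + i the product h (a - b tau) is a ^ 2 modulo the ideal, which yields the
    inverse. *)
Lemma span_tauV h : span_tau h -> local h^-1 -> h != 0 -> span_tau h^-1.
Proof.
move=> sh lV h0; have [a [b [i [ii hE]]]] := sh.
have a0 : a != 0.
  apply/eqP => a0; have h00 : frac_at h 0.
    rewrite hE -[X in frac_at _ X]addr0; apply: frac_atD (ideal_value ii).
    have := frac_atD (frac_atC a) (frac_atM (frac_atC b) tau0).
    by rewrite a0 mulr0 addr0.
  have [x hx] := (localP _).1 lV.
  have := frac_atM hx h00; rewrite mulVf // mulr0 -kappa1 => /(frac_at_eq (frac_atC 1))/eqP.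
  by rewrite oner_eq0.
pose j := i * (kappa a - kappa b * tau) - kappa (b * b) * (tau * tau).
have ij : ideal j.
  apply: idealD; last by apply: idealN; apply: idealC.
  rewrite mulrC; apply: idealM => //; apply: localD; first exact: localC.
  by rewrite -mulNr -kappaN; apply: localM => //; apply: localC.
exists a^-1, (- b / (a * a)), (- (kappa (a * a)^-1 * (h^-1 * j))); split.
  by apply: idealN; apply: idealC; apply: idealM.
have E : h * (kappa a - kappa b * tau) = kappa a * kappa a + j.
  by rewrite /j hE kappaM; ring.
have ka0 : kappa a != 0 by rewrite kappa_eq0.
have kV : kappa a^-1 = (kappa a)^-1.
  by apply: (mulfI ka0); rewrite -kappaM !divff // kappa1.
have kV2 : kappa (a * a)^-1 = (kappa a)^-1 * (kappa a)^-1.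
  by rewrite invfM kappaM kV.
rewrite kappaM kappaN kV2 kV.
have jE : j = h * (kappa a - kappa b * tau) - kappa a * kappa a by rewrite E; ring.
rewrite jE; exact: (inv_expansion (kappa b) tau h0 ka0).
Qed.

Hypothesis sx1 : span_tau (affine o1).
Hypothesis sx2 : span_tau (affine o2).

Lemma span_tau_var i : span_tau (tofrac ('X_i : {mpoly K[3]}) / tofrac (lcoord o0)).
Proof.
have E : 'X_i = B o0 i *: lcoord o0 + B o1 i *: lcoord o1 + B o2 i *: lcoord o2 :> {mpoly K[3]}.
  apply: (homog_fun_inj K0 (d := 1)).
  - by rewrite dhomogX; apply/eqP/mdeg1.
  - by rewrite !dhomogD ?dhomogZ ?lcoord_homog.
  move=> w; rewrite !fevalD !fevalZ !feval_lform /feval mevalXU -{1}[w](mulmxKV Bu) mxE sum_ord3.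
  by rewrite ![_ * B _ _]mulrC.
rewrite E -!mul_mpolyC !tofracD !tofracM !mulrDl -!mulrA -!/(kappa _) divff ?lcoord0_neq0 // mulr1.
by apply: span_tauD; [apply: span_tauD; [exact: span_tauC|]|];
  apply: span_tauM => //; apply: span_tauC.
Qed.

Lemma span_tauX h n : span_tau h -> span_tau (h ^+ n).
Proof.
move=> sh; elim: n => [|n IHn]; first by rewrite expr0 -kappa1; apply: span_tauC.
by rewrite exprS; apply: span_tauM.
Qed.

Lemma span_tau_homog d p : p \is d.-homog -> span_tau (tofrac p / tofrac (lcoord o0) ^+ d).
Proof.
move=> pd; rewrite (homog_expand pd) big_seq rmorph_sum /= mulr_suml.
elim/big_rec: _ => [|m x mM sx]; first by rewrite -kappa0; apply: span_tauC.
apply: span_tauD => //; rewrite -mul_mpolyC tofracM -mulrA -/(kappa _).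
apply: span_tauM; first exact: span_tauC.
have := mdeg_mnm_of mM; rewrite mdegE sum_ord3 => <-.
have -> : tofrac 'X_[(mnm_of m)] = \prod_(i < 3) tofrac ('X_i : {mpoly K[3]}) ^+ mnm_of m i.
  by rewrite mpolyXE_id rmorph_prod; apply: eq_bigr => i _; rewrite rmorphXn.
rewrite !big_ord_recl big_ord0 mulr1 !exprD.
have e1 : lift ord0 ord0 = o1 by apply: val_inj.
have e2 : lift ord0 (lift ord0 ord0) = o2 by apply: val_inj.
have e0 : ord0 = o0 by apply: val_inj.
rewrite e2 e1 e0; set x0 := tofrac (lcoord o0).
have -> : forall y0 y1 y2 : FF, y0 * (y1 * y2) / (x0 ^+ mnm_of m o0 * x0 ^+ mnm_of m o1 * x0 ^+ mnm_of m o2)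
  = (y0 / x0 ^+ mnm_of m o0) * (y1 / x0 ^+ mnm_of m o1) * (y2 / x0 ^+ mnm_of m o2).
  by move=> *; rewrite !invfM; ring.
by rewrite -!expr_div_n; apply: span_tauM; [apply: span_tauM|]; apply/span_tauX/span_tau_var.
Qed.

Lemma local_span_tau h : local h -> span_tau h.
Proof.
case=> d [a [b [ad bd /eqP bR ->]]].
have x0 : tofrac (lcoord o0) ^+ d != 0 by rewrite expf_neq0 // lcoord0_neq0.
have b0 : tofrac b != 0 by exact: tofrac_neq0.
rewrite (quotient_rescale (tofrac a) b0 x0).
apply: span_tauM; first exact: span_tau_homog.
have sb := span_tau_homog bd; apply: (span_tauV sb); last exact: (mulf_neq0 b0 (invr_neq0 x0)).
rewrite invf_div; exists d, (lcoord o0 ^+ d), b; split=> //; last by rewrite tofracXn.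
  by have := dhomogMn d (lcoord_homog o0); rewrite mul1n.
exact/eqP.
Qed.
End Generator.

Lemma kappaB : {morph kappa : x y / x - y}.
Proof. by move=> x y; rewrite kappaD kappaN. Qed.

Lemma intersection_mult1 : span_tau 0 (affine o1) -> span_tau 0 (affine o2) ->
  intersection_mult R 3 f 3 g 1.
Proof.
move=> s1 s2; exists (fun _ => 1); split=> [_|h lh]; first by rewrite -kappa1; apply: localC.
(* With tau = 0 the constants span the quotient. *)
have l0 : frac_at 0 0 by rewrite -kappa0; apply: frac_atC.
have i0 : ideal (0 * 0) by rewrite mul0r; apply: ideal0.
have [c [c' [i [ii hE]]]] := local_span_tau (frac_at_local l0) i0 l0 s1 s2 lh.
rewrite mulr0 addr0 in hE; exists (const_mx c); split.
  by apply/in_local_idealP; rewrite big_ord1 mxE mulr1 -/(kappa c) hE addrC addKr.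
move=> e /in_local_idealP; rewrite big_ord1 mulr1 -/(kappa _) => ie.
apply/rowP => j; rewrite (ord1 j) mxE; apply: subr0_eq.
apply: (frac_at_eq (frac_atC _)); rewrite kappaB; apply: ideal_value.
have -> : kappa c - kappa (e 0 0) = (h - kappa (e 0 0)) + - i by rewrite hE addrAC addrK.
by apply: idealD ie _; apply: idealN.
Qed.

Definition line_eval (p : {mpoly K[3]}) : {poly K} :=
  mmap (@polyC K) (fun i => (B o0 i)%:P + 'X * (B o1 i)%:P) p.

Lemma line_evalE p t : (line_eval p).[t] = feval p (R + t *: row o1 B).
Proof.
rewrite /feval mevalE /line_eval /mmap horner_sum; apply: eq_bigr => m _.
rewrite hornerM hornerC; congr (_ * _); rewrite /mmap1 horner_prod; apply: eq_bigr => i _.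
by rewrite horner_exp hornerD hornerM !hornerC hornerX !mxE.
Qed.

Lemma line_divisible p : p \is 3.-homog -> feval p R = 0 -> (lin_part (chart B p))`_1 = 0 ->
  exists r : {poly K}, forall t, feval p (R + t *: row o1 B) = t ^+ 2 * r.[t].
Proof.
move=> pd p0 L1; exists (((quad_part (chart B p))`_2)%:P + (cub_part (chart B p))`_3 *: 'X) => t.
have -> : R + t *: row o1 B = row3 (1, t, 0) *m B.
  by rewrite row3_mul /= scale1r scale0r addr0.
rewrite -ceval_chart //; move: (chart B p) L1 => [L q n sL sq sn] /= L1.
by rewrite /ceval /= !bform_inf L1 hornerD hornerZ hornerC hornerX; ring.
Qed.

(** The quotient is spanned by 1 and [affine o1]. These are independent because f and g, restricted
    to the line through the rows 0 and 1 of B, have a double zero at R, whereas [affine o1] has a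
    simple one. *)
Lemma intersection_mult2 : ideal (affine o1 * affine o1) -> ideal (affine o2) ->
  (lin_part (chart B f))`_1 = 0 -> (lin_part (chart B g))`_1 = 0 ->
  intersection_mult R 3 f 3 g 2.
Proof.
move=> i1 i2 Lf Lg; have [f0 g0] := fg0.
have lx := local_affine o1; have x0 := frac_at_affine o1.
have s1 : span_tau (affine o1) (affine o1).
  by exists 0, 1, 0; rewrite kappa0 kappa1 add0r mul1r addr0; split=> //; apply: ideal0.
exists (fun i : 'I_2 => if i == ord0 then 1 else affine o1); split=> [i|h lh].
  by case: ifP => // _; rewrite -kappa1; apply: localC.
have sumE (e : 'rV[K]_2) : \sum_(i < 2) tofrac ((e 0 i)%:MP : {mpoly K[3]}) *
    (if i == ord0 then 1 else affine o1) = kappa (e 0 ord0) + kappa (e 0 ord_max) * affine o1.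
  rewrite big_ord_recl big_ord1 /= mulr1; congr (kappa _ + kappa (e 0 _) * _); exact: val_inj.
have [c [c' [i [ii hE]]]] := local_span_tau lx i1 x0 s1 (span_tau_ideal _ i2) lh.
exists (\row_j if j == ord0 then c else c'); split.
  by apply/in_local_idealP; rewrite sumE !mxE /= hE addrAC subrr add0r.
move=> e /in_local_idealP; rewrite sumE => ie.
have {ie ii} ii : ideal (kappa (c - e 0 ord0) + kappa (c' - e 0 ord_max) * affine o1).
  have -> : kappa (c - e 0 ord0) + kappa (c' - e 0 ord_max) * affine o1
    = (h - (kappa (e 0 ord0) + kappa (e 0 ord_max) * affine o1)) + - i.
    by rewrite hE !kappaB; ring.
  by apply: idealD ie _; apply: idealN.
have c0 : c - e 0 ord0 = 0.
  have := ideal_value ii; apply: frac_at_eq.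
  by have := frac_atD (frac_atC (c - e 0 ord0)) (frac_atM (frac_atC (c' - e 0 ord_max)) x0);
    rewrite mulr0 addr0.
suff c'0 : c' - e 0 ord_max = 0.
  apply/rowP => j; rewrite mxE; case: eqP => [->|/eqP j0]; first exact: subr0_eq.
  by rewrite (subr0_eq c'0); congr (e 0 _); apply: val_inj; case: j j0 => [[|[|]]].
move: ii; rewrite c0 kappa0 add0r; move: (c' - _) => k {c0 s1 sumE hE}.
case=> u [v [[d [a [b [_ _ /eqP bR ->]]]] [d' [a' [b' [_ _ /eqP bR' ->]]]] E]].
have {}E : k *: lcoord o1 * (b * b' * lcoord o0 ^+ 2) = a * b' * f + a' * b * g.
  apply/eqP; rewrite -tofrac_eq; apply/eqP; rewrite -mul_mpolyC tofracD 3!tofracM tofracXn !tofracM.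
  exact: clear_denominators (tofrac_neq0 bR) (tofrac_neq0 bR') lcoord0_neq0 E.
have [r1 hf] := line_divisible fd f0 Lf; have [r2 hg] := line_divisible gd g0 Lg.
have coordE j t : feval (lcoord j) (R + t *: row o1 B) = (j == o0)%:R + t * (j == o1)%:R.
  rewrite feval_lform mulmxDl -scalemxAl mxE row0_coord [in X in _ + X]mxE; congr (_ + _ * _).
  by rewrite rowE mulmxK // mxE eq_sym.
(* The restriction of the cleared equation to the line, divided by the parameter; its value at 0 is
   k times a nonzero number. *)
pose p := k *: (line_eval b * line_eval b')
  - 'X * (line_eval a * line_eval b' * r1 + line_eval a' * line_eval b * r2).
have Xp0 : 'X * p = 0.
  apply: poly_fun_eq0 => // n; have := congr1 (fun q => feval q (R + n%:R *: row o1 B)) E.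
  rewrite /p !(hornerE, line_evalE) !fevalD !fevalM fevalZ hf hg !coordE /= => E'.
  by move/eqP: E'; rewrite -subr_eq0 => /eqP E'; rewrite -[RHS]E'; ring.
have p0 : p = 0 by apply/eqP; have /eqP := Xp0; rewrite mulf_eq0 polyX_eq0.
have pE : p.[0] = k * (feval b R * feval b' R).
  by rewrite /p !(hornerE, line_evalE) scale0r addr0; ring.
have bb : feval b R * feval b' R != 0 by rewrite mulf_neq0.
by apply: (mulIf bb); rewrite mul0r -pE p0 horner0.
Qed.
End Ideal.

Lemma intersection_mult0 f g : f \is 3.-homog -> g \is 3.-homog ->
  ~ base f g R -> intersection_mult R 3 f 3 g 0.
Proof.
move=> fd gd nb; have full h : local h -> ideal f g h.
  move=> lh; have [fR|fR] := eqVneq (feval f R) 0; last exact: ideal_full.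
  have [gR|gR] := eqVneq (feval g R) 0; first by case: nb.
  have [u [v [lu lv ->]]] := ideal_full f gd gR lh.
  by exists v, u; split=> //; rewrite addrC.
exists (fun _ => 0); split=> [[]//|h lh]; exists 0; split=> [|c _].
  by apply/in_local_idealP; rewrite big_ord0 subr0; apply: full.
by apply/rowP => -[].
Qed.

Lemma local_eq_chart f : f \is 3.-homog -> feval f R = 0 ->
  let k := fun p : {poly K} => fun i => kappa p`_i in
  let L := lin_part (chart B f) in let q := quad_part (chart B f) in
  let n := cub_part (chart B f) in let x := affine o1 in let y := affine o2 in
  local_eq f = k L 1%N * x + k L 0%N * y + (k q 2%N * x ^+ 2 + k q 1%N * x * y + k q 0%N * y ^+ 2)
    + (k n 3%N * x ^+ 3 + k n 2%N * x ^+ 2 * y + k n 1%N * x * y ^+ 2 + k n 0%N * y ^+ 3).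
Proof.
move=> fd f0 /=; pose p := pullback B f.
have fE : f = form_poly 3 (fun m => p@_(mnm_of m)) (invmx B).
  apply: (homog_fun_inj K0 fd (form_poly_homog _ _ _)) => w.
  rewrite feval_form_poly -(feval_homog _ (pullback_homog B fd)) (feval_pullback _ _ fd).
  by rewrite mulmxKV.
have pE : p = pullback B f by []; clearbody p.
have p0 : p@_(mnm_of (3, 0, 0)) = 0.
  have := f0; rewrite fE feval_form_poly (_ : pt3 _ = (1, 0, 0)); last by rewrite /pt3 !row0_coord.
  rewrite (bigD1_seq (3, 0, 0)%N) ?uniq_monomials //= big_seq_cond big1 => [|m /andP[mM m3]].
    by rewrite /mono_value /= expr1n !expr0 !mulr1 addr0.
  have := mdeg_mnm_of mM; rewrite mdegE sum_ord3 !mnmE /= /mono_value /=.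
  case: m m3 {mM} => [[a [|b]] [|c]] //= m3; rewrite ?exprS ?(mul0r, mulr0) //.
  by move=> e; case/eqP: m3; rewrite -[a]addn0 -[(a + 0)%N]addn0 -[X in (X, _, _)]/(a + 0 + 0)%R e.
have [c cE] : exists c : nat * nat * nat -> FF, forall m, c m = kappa p@_(mnm_of m).
  by exists (fun m => kappa p@_(mnm_of m)).
have E : local_eq f = \sum_(m <- monomials 3) c m * (affine o1 ^+ m.1.2 * affine o2 ^+ m.2).
  rewrite /local_eq {1}fE /form_poly rmorph_sum /= mulr_suml; apply: eq_big_seq => m mM.
  rewrite cE -mul_mpolyC tofracM -mulrA -/(kappa _); congr (_ * _).
  have := mdeg_mnm_of mM; rewrite mdegE sum_ord3 !mnmE /= => e.
  have -> : tofrac (lcoord o0) ^+ 3 = tofrac (lcoord o0) ^+ (m.1.1 + m.1.2 + m.2) by rewrite -[X in _ ^+ X = _]e.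
  rewrite /mono_value /= 2!tofracM !tofracXn; exact: dehomogenize lcoord0_neq0.
have lE i : (i < 2)%N -> kappa (lin_part (chart B f))`_i = c (2, i, 1 - i)%N.
  by move=> i2; rewrite coef_poly i2 cE pE.
have qE i : (i < 3)%N -> kappa (quad_part (chart B f))`_i = c (1, i, 2 - i)%N.
  by move=> i3; rewrite coef_poly i3 cE pE.
have nE i : (i < 4)%N -> kappa (cub_part (chart B f))`_i = c (0, i, 3 - i)%N.
  by move=> i4; rewrite coef_poly i4 cE pE.
have c0 : c (3, 0, 0)%N = 0 by rewrite cE p0 kappa0.
rewrite E sum_monomials3 c0 (lE 0%N) // (lE 1%N) // (qE 0%N) // (qE 1%N) // (qE 2%N) //.
rewrite (nE 0%N) // (nE 1%N) // (nE 2%N) // (nE 3%N) //.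
exact: collect_cubic.
Qed.

Lemma frac_at_lead c u v : local u -> local v ->
  frac_at (kappa c + u * affine o1 + v * affine o2) c.
Proof.
move=> /localP[x ux] /localP[y vy].
have := frac_atD (frac_atD (frac_atC c) (frac_atM ux (frac_at_affine o1)))
  (frac_atM vy (frac_at_affine o2)).
by rewrite !mulr0 !addr0.
Qed.

Lemma local_eq_linear f : f \is 3.-homog -> feval f R = 0 ->
  exists a1 a0 : FF, [/\ frac_at a1 (lin_part (chart B f))`_1, frac_at a0 (lin_part (chart B f))`_0
    & local_eq f = a1 * affine o1 + a0 * affine o2].
Proof.
move=> fd f0; have lx := local_affine; rewrite (local_eq_chart fd f0) /= split_linear.
rewrite -kappa0; do 2!eexists; split; last reflexivity; apply: frac_at_lead;
  repeat first [exact: localC | exact: lx | apply: localD | apply: localM].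
Qed.

Lemma local_eq_tangent f : f \is 3.-homog -> feval f R = 0 -> (lin_part (chart B f))`_1 = 0 ->
  exists a1 a0 : FF, [/\ frac_at a1 (quad_part (chart B f))`_2, frac_at a0 (lin_part (chart B f))`_0
    & local_eq f = a1 * (affine o1 * affine o1) + a0 * affine o2].
Proof.
move=> fd f0; have lx := local_affine; have := local_eq_chart fd f0.
case: (chart B f) => L q n sL sq sn /= -> L1; rewrite L1 kappa0 split_tangent.
do 2!eexists; split; last reflexivity; apply: frac_at_lead;
  repeat first [exact: localC | exact: lx | apply: localD | apply: localM].
Qed.

Section Multiplicities.
Variables f g : {mpoly K[3]}.
Hypotheses (fd : f \is 3.-homog) (gd : g \is 3.-homog) (fg0 : base f g R).

Lemma frac_at_det (a11 a12 a21 a22 : FF) c11 c12 c21 c22 :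
  frac_at a11 c11 -> frac_at a12 c12 -> frac_at a21 c21 -> frac_at a22 c22 ->
  frac_at (a11 * a22 - a12 * a21) (c11 * c22 - c12 * c21).
Proof.
move=> h11 h12 h21 h22; have := frac_atD (frac_atM h11 h22) (frac_atM (frac_atC (-1)) (frac_atM h12 h21)).
by rewrite kappaN kappa1 !mulN1r.
Qed.

Lemma transversal_mult1 :
  (lin_part (chart B f))`_1 * (lin_part (chart B g))`_0
    - (lin_part (chart B f))`_0 * (lin_part (chart B g))`_1 != 0 ->
  intersection_mult R 3 f 3 g 1.
Proof.
move=> d; have [f0 g0] := fg0.
have [a11 [a12 [h11 h12 fE]]] := local_eq_linear fd f0.
have [a21 [a22 [h21 h22 gE]]] := local_eq_linear gd g0.
have [||i1 i2] := ideal_cramer (f := f) (g := g) d (frac_at_local h11) (frac_at_local h12)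
  (frac_at_local h21) (frac_at_local h22) (frac_at_det h11 h12 h21 h22) (z1 := affine o1) (z2 := affine o2).
- by rewrite -fE; have := ideal_comb f g 1 0; rewrite scale1r scale0r addr0.
- by rewrite -gE; have := ideal_comb f g 0 1; rewrite scale1r scale0r add0r.
by apply: intersection_mult1 => //; apply: span_tau_ideal.
Qed.

(** The smooth members have their tangent line through row 1 of B. The singular member s and the
    smooth member t form a 2 by 2 system for the square of [affine o1] and for [affine o2] whose
    determinant is a unit. *)
Lemma nodal_mult2 s t :
  (lin_part (chart B f))`_1 = 0 -> (lin_part (chart B g))`_1 = 0 ->
  (lin_part (chart B (s.1 *: f + s.2 *: g)))`_0 = 0 ->
  (quad_part (chart B (s.1 *: f + s.2 *: g)))`_2 != 0 ->
  (lin_part (chart B (t.1 *: f + t.2 *: g)))`_0 != 0 ->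
  intersection_mult R 3 f 3 g 2.
Proof.
move=> Lf Lg Ls qs Lt; have [f0 g0] := fg0.
have tangent (x y : K) : [/\ x *: f + y *: g \is 3.-homog, feval (x *: f + y *: g) R = 0
    & (lin_part (chart B (x *: f + y *: g)))`_1 = 0].
  rewrite fevalD !fevalZ f0 g0 !mulr0 addr0 chart_comb /= coefD !coefCM Lf Lg !mulr0 addr0.
  by split; rewrite // rpredD ?dhomogZ.
have [sd s0 Ls1] := tangent s.1 s.2; have [td t0 Lt1] := tangent t.1 t.2.
have [a11 [a12 [h11 h12 fE]]] := local_eq_tangent sd s0 Ls1.
have [a21 [a22 [h21 h22 gE]]] := local_eq_tangent td t0 Lt1.
have d : (quad_part (chart B (s.1 *: f + s.2 *: g)))`_2 * (lin_part (chart B (t.1 *: f + t.2 *: g)))`_0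
  - (lin_part (chart B (s.1 *: f + s.2 *: g)))`_0 * (quad_part (chart B (t.1 *: f + t.2 *: g)))`_2 != 0.
  by rewrite Ls mul0r subr0 mulf_neq0.
have [||i1 i2] := ideal_cramer (f := f) (g := g) d (frac_at_local h11) (frac_at_local h12)
  (frac_at_local h21) (frac_at_local h22) (frac_at_det h11 h12 h21 h22) (z1 := affine o1 * affine o1) (z2 := affine o2).
- by rewrite -fE; apply: ideal_comb.
- by rewrite -gE; apply: ideal_comb.
exact: intersection_mult2.
Qed.
End Multiplicities.
End LocalRing.

(** * Pencils of cubics through eight points *)

Section GeneralPosition.
Variable K : fieldType.
Hypothesis K0 : nat_faithful K.
Variable P : 'I_8 -> 'rV[K]_3.
Hypothesis P_neq0 : forall i, P i != 0.
Hypothesis P_distinct : forall i j, i != j -> ~~ (P i == P j)%MS.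
Hypothesis no3_on_line : no_on_curve 3 1 P.
Hypothesis no6_on_conic : no_on_curve 6 2 P.
Implicit Types (f g h : {mpoly K[3]}) (u v w : 'rV[K]_3) (B : 'M[K]_3).

Lemma P_par i j : par (P i) (P j) -> i = j.
Proof.
move=> h; apply/eqP/negPn/negP => /P_distinct/negP[].
exact/(parP (P_neq0 i) (P_neq0 j)).
Qed.

Lemma no_on_curve_eq0 n d (A : {set 'I_8}) f : no_on_curve n d P -> (n <= #|A|)%N ->
  f \is d.-homog -> (forall i, i \in A -> feval f (P i) = 0) -> f = 0.
Proof.
move=> no nA fd fA; apply/eqP/negP => /negP f0.
have : (#|[set B : {set 'I_8} | B \subset A & #|B| == n]| != 0)%N.
  by rewrite cards_draws -lt0n bin_gt0.
rewrite cards_eq0 => /set0Pn[B]; rewrite inE => /andP[/subsetP BA /eqP Bn].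
by apply: (no B Bn); exists f; split => // i /BA; apply: fA.
Qed.

Definition cubic0 f : Prop := f \is 3.-homog /\ forall i, feval f (P i) = 0.

Lemma cubic0_comb f g s s' : cubic0 f -> cubic0 g -> cubic0 (s *: f + s' *: g).
Proof.
case=> fd f0 [gd g0]; split; first by rewrite dhomogD ?dhomogZ.
by move=> i; rewrite fevalD !fevalZ f0 g0 !mulr0 addr0.
Qed.

(** Of the eight points at least three lie on the line or at least six on the conic, so one of the
    factors is zero. *)
Lemma factorable_eq0 f B : cubic0 f -> B \in unitmx -> feval f (row o0 B) = 0 ->
  factorable (chart B f) -> f = 0.
Proof.
move=> [fd f0] Bu fB [l0 [c0 [m [a0 [b0 [[sm sa sb] lc eL eq en]]]]]].
pose c1 (k : nat * nat * nat) := if k.1.1 is 0%N then m`_k.1.2 else l0.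
pose c2 (k : nat * nat * nat) :=
  if k.1.1 is 0%N then b0`_k.1.2 else if k.1.1 is 1%N then a0`_k.1.2 else c0.
pose g1 := form_poly 1 c1 (invmx B); pose g2 := form_poly 2 c2 (invmx B).
have fg w : feval f w = feval g1 w * feval g2 w.
  rewrite -(coordsK w Bu) -ceval_chart // coordsK // !feval_form_poly.
  rewrite /ceval eL eq en bformD !bformC bformD !bformC.
  rewrite (bformM (d := 1) (e := 1) _ _ sm sa) (bformM (d := 1) (e := 2) _ _ sm sb).
  case: (pt3 _) => [[x y] z]; rewrite /monomials /= !big_cons !big_nil /mono_value /=.
  rewrite /bform !big_ord_recl !big_ord0 /= /bump /=.
  transitivity ((l0 * x + (m`_0 * z + m`_1 * y)) * (c0 * x ^+ 2
    + x * (a0`_0 * z + a0`_1 * y) + (b0`_0 * z ^+ 2 + b0`_1 * y * z + b0`_2 * y ^+ 2))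
    - l0 * c0 * x ^+ 3); first ring.
  by rewrite lc /c1 /c2 /=; ring.
have : g1 = 0 \/ g2 = 0.
  pose A1 := [set i | feval g1 (P i) == 0]; pose A2 := [set i | feval g2 (P i) == 0].
  have cA : (8 <= #|A1| + #|A2|)%N.
    rewrite -cardsUI (leq_trans _ (leq_addr _ _)) // -[X in (X <= _)%N](card_ord 8) -cardsT.
    apply/subset_leq_card/subsetP => i _; rewrite !inE -mulf_eq0 -fg f0 eqxx //.
  case: (leqP 3 #|A1|) => [h|h]; [left | right].
    apply: (no_on_curve_eq0 no3_on_line h (form_poly_homog _ _ _)) => i.
    by rewrite inE => /eqP.
  have {}h : (6 <= #|A2|)%N by lia.
  apply: (no_on_curve_eq0 no6_on_conic h (form_poly_homog _ _ _)) => i.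
  by rewrite inE => /eqP.
move=> g0; apply: (homog_fun_eq0 K0 fd) => w; rewrite fg.
by case: g0 => ->; rewrite /feval meval0 ?mul0r ?mulr0.
Qed.

Definition pencil f g : Prop :=
  [/\ cubic0 f, cubic0 g & forall s s', (s, s') != (0, 0) -> s *: f + s' *: g != 0].

Lemma base_P f g i : pencil f g -> base f g (P i).
Proof. by case=> [[_ f0] [_ g0] _]. Qed.

Lemma base_scale f g c v : pencil f g -> base f g v -> base f g (c *: v).
Proof.
by case=> [[fd _] [gd _] _] [fv gv]; split; rewrite (feval_scale _ _ fd, feval_scale _ _ gd) ?fv ?gv mulr0.
Qed.

Lemma comb_eq0 (s s' t t' x y : K) : s * t' - s' * t != 0 ->
  s * x + s' * y = 0 -> t * x + t' * y = 0 -> x = 0 /\ y = 0.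
Proof.
move=> d e1 e2; split; apply: (mulfI d); rewrite mulr0.
  transitivity (t' * (s * x + s' * y) - s' * (t * x + t' * y)); first ring.
  by rewrite e1 e2 !mulr0 subrr.
transitivity (s * (t * x + t' * y) - t * (s * x + s' * y)); first ring.
by rewrite e1 e2 !mulr0 subrr.
Qed.

Lemma pencil_change f g s s' t t' : pencil f g -> s * t' - s' * t != 0 ->
  pencil (s *: f + s' *: g) (t *: f + t' *: g) /\
  (forall v, base f g v <-> base (s *: f + s' *: g) (t *: f + t' *: g) v).
Proof.
case=> fP gP fg d; split.
  split; [exact: cubic0_comb | exact: cubic0_comb | move=> x y xy].
  rewrite !scalerDr !scalerA addrACA -!scalerDl; apply: fg.
  apply: contraNneq xy; rewrite ![x * _]mulrC ![y * _]mulrC => -[e1 e2].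
  by have [|-> ->] := comb_eq0 _ e1 e2; rewrite // [t * _]mulrC.
move=> v; rewrite /base !fevalD !fevalZ; split=> [[-> ->]|[e1 e2]].
  by rewrite !mulr0 !addr0.
exact: comb_eq0 d e1 e2.
Qed.

Lemma pencil_complete f g s : pencil f g -> s != (0, 0) ->
  exists t, [/\ s.1 * t.2 - s.2 * t.1 != 0,
    pencil (s.1 *: f + s.2 *: g) (t.1 *: f + t.2 *: g)
    & forall v, base f g v <-> base (s.1 *: f + s.2 *: g) (t.1 *: f + t.2 *: g) v].
Proof.
move=> fg s0; pose t : K * K := if s.1 == 0 then (1, 0) else (0, 1).
have d : s.1 * t.2 - s.2 * t.1 != 0.
  rewrite /t; have [s10|s1] := eqVneq s.1 0; last by rewrite /= mulr1 mulr0 subr0.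
  rewrite s10 mulr0 mulr1 sub0r oppr_eq0; apply: contraNneq s0 => s20.
  by rewrite [s]surjective_pairing s10 s20.
by exists t; have [h1 h2] := pencil_change fg d; split.
Qed.

Section InFrame.
Variables (f g : {mpoly K[3]}) (B : 'M[K]_3).
Hypothesis fg : pencil f g.
Hypothesis Bu : B \in unitmx.
Hypothesis B0 : base f g (row o0 B).

Lemma chart_irr s s' : (s, s') != (0, 0) ->
  ~ factorable (cubic_comb (chart B f) (chart B g) s s').
Proof.
case: fg => fP gP fg0 /fg0/eqP ss; rewrite -chart_comb => fac; apply: ss.
apply: (factorable_eq0 _ Bu _ fac); first exact: cubic0_comb.
by case: B0 => f0 g0; rewrite fevalD !fevalZ f0 g0 !mulr0 addr0.
Qed.

Lemma ceval_coords h w : cubic0 h -> feval h (row o0 B) = 0 ->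
  ceval (chart B h) (pt3 (w *m invmx B)) = feval h w.
Proof. by move=> [hd _] h0; rewrite ceval_chart // coordsK. Qed.

Lemma base_coords w : base f g w <-> base_pt (chart B f) (chart B g) (pt3 (w *m invmx B)).
Proof. by case: B0 fg => f0 g0 [fP gP _]; rewrite /base_pt !ceval_coords. Qed.

Lemma coords_row0 c x : pt3 (c *: row o0 B *m invmx B) = x -> x = (c, 0, 0).
Proof.
move=> <-; rewrite rowE -scalemxAl mulmxK // /pt3 !mxE /=.
by rewrite mulr1 !mulr0.
Qed.

Lemma dir_neq0 w : w != 0 -> ~ par (row o0 B) w -> dir (pt3 (w *m invmx B)) != (0, 0).
Proof.
move=> w0 nw; apply/negP => /eqP; case E: (pt3 _) => [[x y] z]; rewrite /dir /= => -[y0 z0].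
apply: nw; have wE : w = x *: row o0 B.
  by rewrite -(coordsK w Bu) E row3_mul /= y0 z0 !scale0r !addr0.
by exists x => //; apply: contraNneq w0 => x0; rewrite wE x0 scale0r.
Qed.

Lemma dir_indep w w' : base f g w -> base f g w' -> w != 0 -> w' != 0 ->
  ~ par (row o0 B) w -> ~ par (row o0 B) w' -> ~ par w w' ->
  indep2 (dir (pt3 (w *m invmx B))) (dir (pt3 (w' *m invmx B))).
Proof.
move=> bw bw' w0 w'0 nw nw' ww'; apply: contraT => /(indep2N (dir_neq0 w0 nw))[c e]; case: ww'.
have c0 : c != 0 by apply: contraNneq (dir_neq0 w'0 nw') => c0; rewrite e c0 !mul0r.
have bcw := base_scale c fg bw.
have wE : pt3 (c *: w *m invmx B) = (c * (pt3 (w *m invmx B)).1.1, c * (pt3 (w *m invmx B)).1.2,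
    c * (pt3 (w *m invmx B)).2).
  by rewrite -scalemxAl /pt3 !mxE.
exists c => //; rewrite -(coordsK w' Bu) -(coordsK (c *: w) Bu); congr (row3 _ *m _).
move: bcw bw' e (dir_neq0 w'0 nw') => /base_coords + /base_coords; rewrite wE.
case: (pt3 (w' *m _)) => [[x y] z]; case: (pt3 (w *m _)) => [[x' y'] z'] /=.
rewrite /dir /= => h h' [ey ez] yz; rewrite -ey -ez in h *.
by rewrite (base_pt_dir_inj chart_irr yz h h').
Qed.

Lemma dirs_indep ws : {in ws, forall w, [/\ base f g w, w != 0 & ~ par (row o0 B) w]} ->
  pairwise (fun u v => ~~ (u == v)%MS) ws ->
  let us := [seq pt3 (w *m invmx B) | w <- ws] in
  [/\ {in us, forall x, base_pt (chart B f) (chart B g) x},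
      pairwise (@indep2 K) (map (@dir K) us), (0, 0) \notin map (@dir K) us & size us = size ws].
Proof.
move=> hw pw us; split; last by rewrite size_map.
- by move=> _ /mapP[w /hw[bw _ _] ->]; apply/base_coords.
- rewrite !pairwise_map; move: pw; apply: (sub_in_pairwise (P := fun w => w \in ws)); last exact/allP.
  move=> w w' /hw[bw w0 nw] /hw[bw' w'0 nw'] /= ww'; apply: dir_indep => //.
  by move/(introT (parP w0 w'0)); apply/negP.
by apply/mapP => -[_ /mapP[w /hw[_ w0 nw] ->]] /esym/eqP; apply/negP/dir_neq0.
Qed.
End InFrame.

Lemma P_pairwise (s : seq 'I_8) : uniq s -> pairwise (fun u v => ~~ (u == v)%MS) (map P s).
Proof.
rewrite uniq_pairwise pairwise_map; apply: sub_pairwise => i j; exact: P_distinct.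
Qed.

(** For a cubic form h the left side is twice the differential of h at v applied to w, plus 2 h(w).
    So the condition says that the differential at v is zero, without derivatives or a choice of
    coordinates. *)
Definition sing h v : Prop :=
  forall w, feval h (v + w) - feval h (v - w) = 2%:R * feval h w.

Lemma sing_scale h c v : h \is 3.-homog -> c != 0 -> sing h v -> sing h (c *: v).
Proof.
move=> hd c0 hv w; have [w' ->] : exists w', w = c *: w'.
  by exists (c^-1 *: w); rewrite scalerA divff ?scale1r.
by rewrite -scalerDr -scalerBr !(feval_scale _ _ hd) -mulrBr hv mulrCA.
Qed.

Lemma chart_tangent B h y z : h \is 3.-homog -> feval h (row o0 B) = 0 -> forall x,
  let w := row3 (x, y, z) *m B in
  feval h (row o0 B + w) - feval h (row o0 B - w)
  = 2%:R * feval h w + 2%:R * bform 1 (lin_part (chart B h)) y z.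
Proof.
move=> hd h0 x w; rewrite {}/w; have rB (a b c : K) :
    row3 (a, b, c) *m B = a *: row o0 B + b *: row o1 B + c *: row o2 B by rewrite row3_mul.
have -> : row o0 B + row3 (x, y, z) *m B = row3 (1 + x, y, z) *m B.
  by rewrite !rB scalerDl scale1r !addrA.
have -> : row o0 B - row3 (x, y, z) *m B = row3 (1 - x, - y, - z) *m B.
  by rewrite !rB !opprD -!scaleNr scalerDl scale1r !addrA.
rewrite -!ceval_chart //; case: (chart B h) => L q n sL sq sn.
by rewrite /ceval /= /bform !big_ord_recl !big_ord0 /= /bump /=; ring.
Qed.

Lemma sing_chart B h : h \is 3.-homog -> B \in unitmx -> feval h (row o0 B) = 0 ->
  (sing h (row o0 B) <-> lin_part (chart B h) = 0).
Proof.
move=> hd Bu h0; have E x y z := chart_tangent y z hd h0 x.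
have n2 : 2%:R != 0 :> K by rewrite K0.
split=> [hs|L0 w]; last first.
  by rewrite -(coordsK w Bu); case: (pt3 _) => [[x y] z]; rewrite E L0 bform0 mulr0 addr0.
have b0 y z : bform 1 (lin_part (chart B h)) y z = 0.
  have := hs (row3 (0, y, z) *m B); rewrite E => /eqP.
  by rewrite -subr_eq0 addrAC subrr add0r mulf_eq0 (negbTE n2) => /eqP.
apply/polyP => i; rewrite coef0; case: i => [|[|i]].
- rewrite -[RHS](b0 0 1); move: (lin_part _) => L.
  by rewrite /bform !big_ord_recl big_ord0 /= /bump /=; ring.
- rewrite -[RHS](b0 1 0); move: (lin_part _) => L.
  by rewrite /bform !big_ord_recl big_ord0 /= /bump /=; ring.
by rewrite nth_default // (leq_trans (size_lin_part _)).
Qed.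

Definition singular_at f g v : Prop :=
  exists2 s : K * K, s != (0, 0) & sing (s.1 *: f + s.2 *: g) v.

Lemma singular_change f g s s' t t' v : s * t' - s' * t != 0 ->
  singular_at (s *: f + s' *: g) (t *: f + t' *: g) v -> singular_at f g v.
Proof.
move=> d [x x0]; rewrite !scalerDr !scalerA addrACA -!scalerDl => hx.
exists (x.1 * s + x.2 * t, x.1 * s' + x.2 * t') => //.
apply: contraNneq x0; rewrite ![x.1 * _]mulrC ![x.2 * _]mulrC [x in x == _]surjective_pairing.
by case=> e1 e2; have [|-> ->] := comb_eq0 _ e1 e2; rewrite // [t * _]mulrC.
Qed.

Lemma pencil_comb_base f g s s' v : base f g v -> feval (s *: f + s' *: g) v = 0.
Proof. by case=> fv gv; rewrite fevalD !fevalZ fv gv !mulr0 addr0. Qed.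

(** Projection from v, with the singular member as first generator, reduces this to
    [nodal_size_le]. *)
Lemma singular_base_le f g v (ws : seq 'rV[K]_3) : pencil f g -> v != 0 ->
  base f g v -> singular_at f g v ->
  {in ws, forall w, [/\ base f g w, w != 0 & ~ par v w]} ->
  pairwise (fun u v => ~~ (u == v)%MS) ws -> (3 < size ws)%N -> (size ws <= 7)%N.
Proof.
move=> fg v0 bv [s s0 hs] hw pw w3; have [u [w Bu]] := frame_exists v0.
have [t [d fg1 bE]] := pencil_complete fg s0; set B := frame v u w in Bu.
have B0 : row o0 B = v by exact: row0_frame.
move: (fg1) bE hs; set f1 := _ + _; set g1 := _ + _ => -[[f1d _] _ _] bE hs.
have b1 : base f1 g1 (row o0 B) by rewrite B0; apply/bE.
have L0 : lin_part (chart B f1) = 0 by apply/(sing_chart f1d Bu b1.1); rewrite B0.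
have [|us1 us2 us3 us4] := dirs_indep fg1 Bu b1 _ pw.
  by move=> x /hw[/bE bx x0 nx]; rewrite B0.
rewrite -us4 in w3 *.
exact: (nodal_size_le (chart_irr fg1 Bu b1) L0 us1 us2 us3 w3).
Qed.

Definition others i : seq 'rV[K]_3 := [seq P j | j <- rem i (enum 'I_8)].

Lemma size_others i : size (others i) = 7%N.
Proof. by rewrite size_map size_rem ?mem_enum // size_enum_ord. Qed.

Lemma others_pairwise i : pairwise (fun u v => ~~ (u == v)%MS) (others i).
Proof. by apply: P_pairwise; rewrite rem_uniq ?enum_uniq. Qed.

Lemma othersP f g i : pencil f g ->
  {in others i, forall w, [/\ base f g w, w != 0 & ~ par (P i) w]}.
Proof.
move=> fg _ /mapP[j + ->]; rewrite mem_rem_uniq ?enum_uniq // inE => /andP[ji _].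
by split; [exact: base_P | exact: P_neq0 | move/P_par => e; rewrite e eqxx in ji].
Qed.

Lemma par_P_dec v : v != 0 -> (exists i, par (P i) v) \/ (forall i, ~ par (P i) v).
Proof.
move=> v0; have [/existsP[i /(parP (P_neq0 i) v0)]|/existsPn n] := boolP [exists i, (P i == v)%MS].
  by left; exists i.
by right=> i /(introT (parP (P_neq0 i) v0)); apply/negP/n.
Qed.

(** Otherwise all eight P i are further base points beside the singular one, one too many. *)
Lemma singular_in_P f g v : pencil f g -> v != 0 -> base f g v -> singular_at f g v ->
  exists i, par (P i) v.
Proof.
move=> fg v0 bv sv; have [//|n] := par_P_dec v0.
have := @singular_base_le f g v (map P (enum 'I_8)) fg v0 bv sv _ (P_pairwise (enum_uniq _)).
rewrite size_map size_enum_ord => /(_ _ isT) h.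
suff: (8 <= 7)%N by [].
apply: h => _ /mapP[i _ ->].
by split; [exact: base_P | exact: P_neq0 | move/par_sym; apply: n].
Qed.

(** A base point v outside P and the seven other points would be eight base points beside P i. *)
Lemma singular_P_base f g i v : pencil f g -> singular_at f g (P i) -> v != 0 ->
  base f g v -> exists j, par (P j) v.
Proof.
move=> fg si v0 bv; have [//|n] := par_P_dec v0.
have := @singular_base_le f g (P i) (v :: others i) fg (P_neq0 i) (base_P i fg) si.
rewrite /= size_others others_pairwise andbT => h.
suff: (8 <= 7)%N by [].
apply: h => // [w|].
  by rewrite inE => /predU1P[->|/(othersP fg)].
apply/allP => _ /mapP[j _ ->]; apply/negP => /(parP v0 (P_neq0 j))/par_sym; exact: n.
Qed.

Lemma sing_row2 h B : h \is 3.-homog -> B \in unitmx ->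
  feval h (row o0 B) = 0 -> feval h (row o2 B) = 0 -> sing h (row o2 B) ->
  [/\ (quad_part (chart B h))`_0 = 0, (cub_part (chart B h))`_0 = 0 & (cub_part (chart B h))`_1 = 0].
Proof.
move=> hd Bu h0 h2 hs; have rB (a b c : K) :
    row3 (a, b, c) *m B = a *: row o0 B + b *: row o1 B + c *: row o2 B by rewrite row3_mul.
have n2 : 2%:R != 0 :> K by rewrite K0.
have E x y : ceval (chart B h) (x, y, 1) - ceval (chart B h) (- x, - y, 1)
    - 2%:R * ceval (chart B h) (x, y, 0) = 0.
  apply/subr0_eq; rewrite subr0 !ceval_chart // -hs; apply/eqP; rewrite subr_eq0; apply/eqP.
  congr (feval _ _ - feval _ _).
    by rewrite !rB scale1r scale0r addr0 addrC.
  by rewrite !rB scale1r scale0r addr0 !scaleNr -opprD addrC.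
have c2 : ceval (chart B h) (0, 0, 1) = 0.
  by rewrite ceval_chart // rB !scale0r !add0r scale1r.
move: (E 1 0) (E 0 1) c2; case: (chart B h) => L q n sL sq sn.
rewrite /ceval /bform !big_ord_recl !big_ord0 /= /bump /= => e1 e2 e3.
have {}e3 : n`_0 = 0 by rewrite -[RHS]e3; ring.
by split=> //; apply: (mulfI n2); rewrite mulr0; [rewrite -[RHS]e1 | rewrite -[RHS]e2]; ring.
Qed.

Lemma singular_unique f g i j : pencil f g ->
  singular_at f g (P i) -> singular_at f g (P j) -> i = j.
Proof.
move=> fg [s s0 hs] [t t0 ht]; apply/eqP/negPn/negP => /eqP ij.
(* The point P j has to be the last row, since [nodal_unique] is stated for (0, 0, 1). *)
have [w Bu] : exists w, frame (P i) w (P j) \in unitmx.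
  have [|w] := frame_exists2 (P_neq0 i) (P_neq0 j); first by move/P_par.
  rewrite unitmxE unitfE det_frame => h; exists w; rewrite unitmxE unitfE det_frame.
  by apply: contraNneq h => e; rewrite -oppr0 -e /br; apply/eqP; ring.
set B := frame _ _ _ in Bu; have B0 : row o0 B = P i by exact: row0_frame.
have B2 : row o2 B = P j by exact: row2_frame.
have [fP gP _] := fg; have hP := cubic0_comb s.1 s.2 fP gP; have h'P := cubic0_comb t.1 t.2 fP gP.
set h := _ + _ in hs hP; set h' := _ + _ in ht h'P.
have L0 : lin_part (chart B h) = 0.
  by apply/(sing_chart hP.1 Bu); rewrite B0 ?hP.2.
have row2 k : cubic0 k -> sing k (P j) ->
  [/\ (quad_part (chart B k))`_0 = 0, (cub_part (chart B k))`_0 = 0 & (cub_part (chart B k))`_1 = 0].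
  by move=> kP ks; apply: sing_row2; rewrite ?B0 ?B2 //; case: kP.
(* If the two members are proportional, one cubic is singular at both points and contains the line
   that joins them; otherwise [nodal_unique] applies. *)
have [/eqP d|/(indep2N s0)[c tE]] := boolP (indep2 s t); last first.
  have c0 : c != 0 by apply: contraNneq t0 => c0; rewrite tE c0 !mul0r.
  have hE : h' = c *: h by rewrite /h' /h tE /= scalerDr !scalerA.
  have [||q0 n0 n1] := row2 h; first exact: hP.
    have e v : feval h' v = c * feval h v by rewrite hE fevalZ.
    by move=> v; apply: (mulfI c0); rewrite mulrBr -!e ht e; ring.
  have s0' : (s.1, s.2) != (0, 0) by rewrite -surjective_pairing.
  apply: (chart_irr fg Bu _ s0'); first by rewrite B0; apply: base_P.
  rewrite -chart_comb -/h; apply: (@line_factor _ _ 0 1).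
  - by rewrite xpair_eqE oner_eq0 andbF.
  - by rewrite L0 bform0.
  - by rewrite /bform !big_ord_recl big_ord0 q0 /=; ring.
  - by rewrite /bform !big_ord_recl big_ord0 n0 /=; ring.
move: d => /eqP; rewrite -subr_eq0 => d.
have [fg1 _] := pencil_change fg d; rewrite -/h -/h' in fg1.
have b0 : base h h' (row o0 B) by rewrite B0; apply: base_P.
pose ws := P j :: map P (rem j (rem i (enum 'I_8))).
have ui : uniq (rem i (enum 'I_8)) by rewrite rem_uniq ?enum_uniq.
have ji : j \in rem i (enum 'I_8) by rewrite mem_rem_uniq ?enum_uniq // inE mem_enum andbT; apply/eqP => /esym.
have wsE : ws = map P (j :: rem j (rem i (enum 'I_8))) by [].
have hws : {in ws, forall w, [/\ base h h' w, w != 0 & ~ par (row o0 B) w]}.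
  rewrite wsE => _ /mapP[l lj ->]; rewrite B0.
  split; [exact: base_P | exact: P_neq0 | move/P_par => il].
  move: lj; rewrite -il inE (negbTE (introN eqP ij)) /=.
  by move/mem_rem; rewrite mem_rem_uniq ?enum_uniq // inE eqxx.
have pws : pairwise (fun u v => ~~ (u == v)%MS) ws.
  by rewrite wsE; apply: P_pairwise; rewrite /= rem_uniq // mem_rem_uniq // inE eqxx.
have [us1 us2 us3 us4] := dirs_indep fg1 Bu b0 hws pws.
have s7 : size [seq pt3 (w *m invmx B) | w <- ws] = 7%N.
  by rewrite us4 wsE size_map /= size_rem // size_rem ?mem_enum // size_enum_ord.
have [q0 n0 n1] := row2 h' h'P ht.
apply: (nodal_unique (chart_irr fg1 Bu b0) L0 us1 us2 us3 _ s7 _ q0 n0 n1); first by rewrite s7.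
by rewrite /= -B2 (@basis_pt_row _ _ 2).
Qed.

(** If no member is singular at the centre, the linear parts of f and g are independent, so suitable
    members have the linear parts y and z. *)
Lemma pencil_normalize f g B : pencil f g -> B \in unitmx ->
  base f g (row o0 B) -> ~ singular_at f g (row o0 B) ->
  exists s t : K * K, [/\ s.1 * t.2 - s.2 * t.1 != 0,
    lin_part (chart B (s.1 *: f + s.2 *: g)) = 'X &
    lin_part (chart B (t.1 *: f + t.2 *: g)) = 1].
Proof.
move=> fg Bu b0 ns; have [fP gP _] := fg.
pose a := lin_part (chart B f); pose b := lin_part (chart B g).
have linE s s' : lin_part (chart B (s *: f + s' *: g)) = s%:P * a + s'%:P * b.
  by rewrite chart_comb.
have lin_neq0 (s s' : K) : (s, s') != (0, 0) -> s%:P * a + s'%:P * b = 0 -> False.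
  move=> ss; rewrite -linE => L0; apply: ns; exists (s, s') => //=.
  apply/(sing_chart (B := B)) => //; first by case: (cubic0_comb s s' fP gP).
  exact: pencil_comb_base.
clearbody a b; have coef s s' (i : nat) : (s%:P * a + s'%:P * b)`_i = s * a`_i + s' * b`_i.
  by rewrite coefD !coefCM.
have two (p : {poly K}) : (size p <= 2)%N -> p = (p`_0)%:P + p`_1 *: 'X.
  move=> sp; apply/polyP => i; rewrite coefD coefZ coefC coefX.
  case: i => [|[|i]] /=; rewrite ?mulr0 ?addr0 ?mulr1 ?add0r //.
  by rewrite nth_default // (leq_trans sp).
have sab (s s' : K) : (size (s%:P * a + s'%:P * b)%R <= 2)%N.
  by rewrite -linE; apply: size_lin_part.
have zero (s s' : K) : s * a`_0 + s' * b`_0 = 0 -> s * a`_1 + s' * b`_1 = 0 ->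
    s%:P * a + s'%:P * b = 0.
  by move=> e0 e1; rewrite (two _ (sab s s')) !coef e0 e1 scale0r addr0.
pose D := a`_1 * b`_0 - a`_0 * b`_1.
have D0 : D != 0.
  apply/eqP => D0.
  have [/eqP|ab1] := eqVneq (b`_1, - a`_1) (0, 0); last first.
    apply: (lin_neq0 _ _ ab1); apply: zero; last by ring.
    by apply/eqP; rewrite -oppr_eq0; apply/eqP; rewrite -[RHS]D0 /D; ring.
  rewrite xpair_eqE oppr_eq0 => /andP[/eqP b1 /eqP a1].
  have [/eqP|ab0] := eqVneq (b`_0, - a`_0) (0, 0); last first.
    by apply: (lin_neq0 _ _ ab0); apply: zero; rewrite ?a1 ?b1; ring.
  rewrite xpair_eqE oppr_eq0 => /andP[/eqP b0' /eqP a0].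
  apply: (lin_neq0 1 0); first by rewrite xpair_eqE oner_eq0.
  by apply: zero; rewrite ?a1 ?a0; ring.
exists (b`_0 / D, - a`_0 / D), (- b`_1 / D, a`_1 / D); split.
- rewrite /= (_ : _ - _ = D^-1) ?invr_eq0 //.
  by rewrite /D; field.
- have e0 : b`_0 / D * a`_0 + - a`_0 / D * b`_0 = 0 by ring.
  have e1 : b`_0 / D * a`_1 + - a`_0 / D * b`_1 = 1 by rewrite /D; field.
  by rewrite linE (two _ (sab _ _)) !coef e0 e1 add0r scale1r.
- have e0 : - b`_1 / D * a`_0 + a`_1 / D * b`_0 = 1 by rewrite /D; field.
  have e1 : - b`_1 / D * a`_1 + a`_1 / D * b`_1 = 0 by ring.
  by rewrite linE (two _ (sab _ _)) !coef e0 e1 scale0r addr0.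
Qed.

(** Projected from v, the point w and the eight P i would be nine base points in distinct
    directions, but the resultant has degree 8. *)
Lemma transversal_unique f g v w : pencil f g -> ~ singular_at f g v ->
  v != 0 -> w != 0 -> base f g v -> base f g w ->
  (forall i, ~ par (P i) v) -> (forall i, ~ par (P i) w) -> par v w.
Proof.
move=> fg ns v0 w0 bv bw nv nw; apply/(parP v0 w0)/negPn/negP => /negP vw.
have [u [x Bu]] := frame_exists v0; set B := frame v u x in Bu.
have B0 : row o0 B = v by exact: row0_frame.
have [||s [t [d lf lg]]] := @pencil_normalize f g B fg Bu; rewrite ?B0 //.
have [fg1 bE] := pencil_change fg d.
have b1 : base (s.1 *: f + s.2 *: g) (t.1 *: f + t.2 *: g) (row o0 B) by rewrite B0; apply/bE.
have hws : {in w :: map P (enum 'I_8), forall y, [/\ base (s.1 *: f + s.2 *: g) (t.1 *: f + t.2 *: g) y,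
    y != 0 & ~ par (row o0 B) y]}.
  move=> y; rewrite B0 inE => /predU1P[->|/mapP[i _ ->]].
    by split=> //; [apply/bE | move/(introT (parP v0 w0))].
  by split; [apply: base_P | apply: P_neq0 | move/par_sym; apply: nv].
have pws : pairwise (fun u v => ~~ (u == v)%MS) (w :: map P (enum 'I_8)).
  rewrite /= P_pairwise ?enum_uniq // andbT; apply/allP => _ /mapP[i _ ->].
  by apply/negP => /(parP w0 (P_neq0 i))/par_sym; apply: nw.
have [us1 us2 us3 us4] := dirs_indep fg1 Bu b1 hws pws.
have := transversal_size_le (chart_irr fg1 Bu b1) lf lg us1 us2 us3.
by rewrite us4 /= size_map size_enum_ord.
Qed.

(** On the line through P i and P j a cubic through both has only the two coefficients l and q. If
    they vanish, the line splits off and the cubic is zero. So l and q are coordinates on the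
    cubics, and Cramer's rule finds the combination. *)
Lemma cubic0_span f g h : pencil f g -> cubic0 h -> exists s s', h = s *: f + s' *: g.
Proof.
move=> fg hP; have [fP gP fg0] := fg.
pose i : 'I_8 := inord 0; pose j : 'I_8 := inord 1.
have ij : ~ par (P i) (P j) by move/P_par/(congr1 val); rewrite /= !inordK.
have [w Bu] := frame_exists2 (P_neq0 i) (P_neq0 j) ij; set B := frame _ _ _ in Bu.
have B0 : row o0 B = P i by exact: row0_frame.
have B1 : row o1 B = P j by exact: row1_frame.
pose l k := bform 1 (lin_part (chart B k)) 1 0; pose q k := bform 2 (quad_part (chart B k)) 1 0.
have lE s s' k k' : l (s *: k + s' *: k') = s * l k + s' * l k'.
  by rewrite /l chart_comb /= bformD !bformC.
have qE s s' k k' : q (s *: k + s' *: k') = s * q k + s' * q k'.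
  by rewrite /q chart_comb /= bformD !bformC.
have key k : cubic0 k -> l k = 0 -> q k = 0 -> k = 0.
  move=> kP lk qk; apply: (factorable_eq0 kP Bu); first by rewrite B0 kP.2.
  apply: (@line_factor _ _ 1 0) => //; first by rewrite xpair_eqE oner_eq0.
  have : ceval (chart B k) (0, 1, 0) = 0.
    by rewrite ceval_chart ?B0 ?kP.2 ?kP.1 // row3_mul !scale0r add0r addr0 scale1r B1 kP.2.
  by rewrite /ceval /= expr0n !mul0r !add0r.
clearbody l q; pose D := l f * q g - l g * q f.
have D0 : D != 0.
  apply/eqP => D0.
  have [/eqP|n1] := eqVneq (l g, - l f) (0, 0); last first.
    case/eqP: (fg0 _ _ n1); apply: key; first exact: cubic0_comb.
      by rewrite lE; ring.
    by rewrite qE; apply/eqP; rewrite -oppr_eq0; apply/eqP; rewrite -[RHS]D0 /D; ring.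
  rewrite xpair_eqE oppr_eq0 => /andP[/eqP lg0 /eqP lf0].
  have [/eqP|n1] := eqVneq (q g, - q f) (0, 0); last first.
    by case/eqP: (fg0 _ _ n1); apply: key; rewrite ?lE ?qE ?lg0 ?lf0; [exact: cubic0_comb | ring..].
  rewrite xpair_eqE oppr_eq0 => /andP[_ /eqP qf0].
  have n : (1, 0) != (0, 0) :> K * K by rewrite xpair_eqE oner_eq0.
  case/eqP: (fg0 1 0 n); apply: key; rewrite ?lE ?qE ?lg0 ?lf0 ?qf0; [exact: cubic0_comb | ring..].
pose s := (l h * q g - l g * q h) / D; pose s' := (l f * q h - l h * q f) / D.
exists s, s'; apply/eqP; rewrite -subr_eq0 -[h]scale1r -scaleN1r; apply/eqP; apply: key.
- by apply: cubic0_comb => //; apply: cubic0_comb.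
- by rewrite !lE /s /s' /D; field.
- by rewrite !qE /s /s' /D; field.
Qed.

Lemma form_poly_eq0 d (c : nat * nat * nat -> K) B : B \in unitmx ->
  form_poly d c B = 0 -> {in monomials d, forall m, c m = 0}.
Proof.
move=> Bu c0 m mM; pose p : {mpoly K[3]} := \sum_(m <- monomials d) c m *: 'X_[mnm_of m].
have pc k : k \in monomials d -> p@_(mnm_of k) = c k.
  move=> kM; rewrite raddf_sum (bigD1_seq k) ?uniq_monomials //= mcoeffZ mcoeffX eqxx mulr1.
  by rewrite big1 ?addr0 // => l lk; rewrite mcoeffZ mcoeffX (inj_eq mnm_of_inj) (negbTE lk) mulr0.
have pd : p \is d.-homog.
  rewrite /p big_seq; apply: rpred_sum => k /mdeg_mnm_of kd.
  by apply: dhomogZ; rewrite dhomogX; apply/eqP.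
suff p0 : p = 0 by rewrite -pc // p0 mcoeff0.
apply: (homog_fun_eq0 K0 pd) => w; rewrite -[RHS](meval0 (fun i => (w *m invmx B) 0 i)) -c0.
rewrite -/(feval _ _) feval_form_poly mulmxKV // (feval_homog _ pd).
by apply: eq_big_seq => k /pc ->.
Qed.

Lemma cubic_dx_dy_sing h B x t : cubic0 h -> B \in unitmx -> feval h (row o0 B) = 0 ->
  ceval (chart B h) (x, t, 1) = 0 -> cubic_dx (chart B h) x t = 0 ->
  cubic_dy (chart B h) x t = 0 -> sing h (row3 (x, t, 1) *m B).
Proof.
move=> [hd _] Bu h0 c0 dx dy w; rewrite -(coordsK w Bu); case: (pt3 _) => [[a b] c].
have rB (r : K) : row3 (x, t, 1) *m B + r *: (row3 (a, b, c) *m B)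
    = row3 (x + r * a, t + r * b, 1 + r * c) *m B.
  rewrite scalemxAl -mulmxDl; congr (_ *m _).
  by apply/rowP; elim/ord3P; rewrite !mxE.
rewrite -scaleN1r -[X in feval h (_ + X)]scale1r !rB -!ceval_chart //.
apply/eqP; rewrite -subr_eq0; apply/eqP.
(* Euler's relation replaces the derivative in z, which explains the factor 3. *)
transitivity (2%:R * ((a - x * c) * cubic_dx (chart B h) x t
   + (b - t * c) * cubic_dy (chart B h) x t + 3%:R * c * ceval (chart B h) (x, t, 1))); last first.
  by rewrite dx dy c0 !mulr0 !addr0 mulr0.
case: (chart B h) => L q n sL sq sn; rewrite /ceval /cubic_dx /cubic_dy /=.
have dE d (p : {poly K}) : (size p <= d.+2)%N -> p^`().[t] = \sum_(i < d.+1) p`_i.+1 *+ i.+1 * t ^+ i.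
  move=> sp; rewrite (horner_coef_wide (n := d.+1)).
    by apply: eq_bigr => i _; rewrite coef_deriv.
  by apply/leq_sizeP => j dj; rewrite coef_deriv nth_default ?mul0rn // (leq_trans sp).
rewrite -(bform1 _ sL) -(bform1 _ sq) (dE 0%N) // (dE 1%N) // (dE 2%N) // /bform !big_ord_recl !big_ord0 /= /bump /=.
ring.
Qed.

(** The relabelling e allows any P i to become the first frame point. The vectors are not rescaled,
    so bracket sums can be compared exactly. *)
Definition framing B (e : 'I_8 -> 'I_8) (q : 'I_5 -> K * K * K) : Prop :=
  [/\ B \in unitmx, injective e & forall l, pt3 (P (e l) *m invmx B) = framed q l].

Lemma framing_pt B e q l : framing B e q -> P (e l) = row3 (framed q l) *m B.
Proof. by case=> Bu _ <-; rewrite coordsK. Qed.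

Lemma framing_row B e q (a : 'I_3) : framing B e q -> row a B = P (e (lshift 5 a)).
Proof.
move=> fr; rewrite (framing_pt _ fr) framed_lshift rowE; congr (_ *m _).
by apply/rowP; elim/ord3P; rewrite !mxE /=; elim/ord3P: a.
Qed.

(** Rotating the frame transfers statements about the first frame point to the two others. *)
Definition rot_index (l : 'I_8) : 'I_8 :=
  match split (l : 'I_(3 + 5)) with inl a => lshift 5 (ordS a) | inr b => rshift 3 b end.

Lemma rot_index_inj : injective rot_index.
Proof.
move=> i j; rewrite /rot_index.
have [[a ->]|[a ->]] := ord8_split i; have [[b ->]|[b ->]] := ord8_split j;
  rewrite ?(unsplitK (inl _)) ?(unsplitK (inr _)).
- by move=> /(@lshift_inj 3 5)/ordS_inj ->.
- by move/eqP; rewrite eq_lrshift35.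
- by move/esym/eqP; rewrite eq_lrshift35.
- by move=> /(@rshift_inj 3 5) ->.
Qed.

Definition rot_frame B := frame (row o1 B) (row o2 B) (row o0 B).

Lemma rot_frame_unit B : B \in unitmx -> rot_frame B \in unitmx.
Proof.
have BE : frame (row o0 B) (row o1 B) (row o2 B) = B.
  by apply/row_matrixP; elim/ord3P; rewrite rowK.
rewrite !unitmxE !unitfE -{1}BE !det_frame; congr (_ != _).
rewrite /br; ring.
Qed.

Lemma rot_frame_coords B w : B \in unitmx ->
  pt3 (w *m invmx (rot_frame B)) = pt_rot (pt3 (w *m invmx B)).
Proof.
move=> Bu; rewrite -{1}(coordsK w Bu); case: (pt3 (w *m _)) => [[x y] z].
have -> : row3 (x, y, z) *m B = row3 (y, z, x) *m rot_frame B.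
  by rewrite !row3_mul /= row0_frame row1_frame row2_frame [RHS]addrC addrA.
by rewrite row_coords // rot_frame_unit.
Qed.

Lemma framing_rot B e q : framing B e q ->
  framing (rot_frame B) (e \o rot_index) (@pt_rot K \o q).
Proof.
case=> Bu ei h; split; first exact: rot_frame_unit.
  exact: inj_comp rot_index_inj.
move=> l; rewrite rot_frame_coords // h /rot_index.
have [[a ->]|[b ->]] := ord8_split l; rewrite ?(unsplitK (inl _)) ?(unsplitK (inr _)).
  by rewrite !framed_lshift; elim/ord3P: a.
by rewrite !framed_rshift.
Qed.

Lemma nodal_det_rot k (q : 'I_5 -> K * K * K) : nodal_det k (@pt_rot K \o q) = nodal_det k.+1 q.
Proof. by congr (\det _); apply/matrixP => i j; rewrite !mxE iterSr. Qed.

Lemma conic_det_rot k (q : 'I_5 -> K * K * K) : conic_det k (@pt_rot K \o q) = conic_det k.+1 q.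
Proof. by congr (\det _); apply/matrixP => i j; rewrite !mxE iterSr. Qed.

Lemma nodal_det3 k (q : 'I_5 -> K * K * K) : nodal_det k.+3 q = nodal_det k q.
Proof.
by congr (\det _); apply/matrixP => i j; rewrite !mxE -[k.+3]addn3 iterD; case: (q i) => [[]].
Qed.

(** A kernel vector is the coefficient vector of a nonzero form that vanishes at the five points. *)
Lemma row_det_eq0 (r : K * K * K -> seq K) (q : 'I_5 -> K * K * K) :
  row_det r q = 0 <-> exists2 v : 'rV[K]_5, v != 0 &
    forall i, \sum_j v 0 j * (r (q i))`_j = 0.
Proof.
rewrite /row_det -det_tr; split=> [/eqP/det0P[v v0 e]|[v v0 e]].
  exists v => // i; have := congr1 (fun u : 'rV[K]_5 => u 0 i) e; rewrite !mxE => E.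
  by rewrite -[RHS]E; apply: eq_bigr => j _; rewrite !mxE.
apply/eqP/det0P; exists v => //; apply/rowP => i; rewrite !mxE -[RHS](e i).
by apply: eq_bigr => j _; rewrite !mxE.
Qed.

Lemma framing_vanish B e q d f : framing B e q -> f \is d.-homog ->
  (forall l, feval f (row3 (framed q l) *m B) = 0) -> forall i, feval f (P i) = 0.
Proof.
move=> fr fd h i; have [_ ei _] := fr.
by have := h (invF ei i); rewrite -(framing_pt _ fr) f_invF.
Qed.

Definition form_of n d (s : seq (nat * nat * nat)) (v : 'rV[K]_n) B : {mpoly K[3]} :=
  form_poly d (fun m => \sum_(j < n) (m == nth (0, 0, 0)%N s j)%:R * v 0 j) B.

Section FormOf.
Variables (n d : nat) (s : seq (nat * nat * nat)) (v : 'rV[K]_n) (B : 'M[K]_3).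
Hypothesis us : uniq s.
Hypothesis sn : size s = n.
Hypothesis sd : {subset s <= monomials d}.

Lemma feval_form_of w : feval (form_of d s v B) w
  = \sum_(j < n) v 0 j * mono_value (pt3 (w *m B)) (nth (0, 0, 0)%N s j).
Proof.
rewrite feval_form_poly; under eq_bigr => m _ do rewrite mulr_suml.
rewrite exchange_big; apply: eq_bigr => j _ /=.
rewrite (bigD1_seq (nth (0, 0, 0)%N s j)) ?uniq_monomials //=; last first.
  by apply/sd/mem_nth; rewrite sn.
by rewrite eqxx mul1r big1 ?addr0 // => m /negbTE ->; rewrite !mul0r.
Qed.

Lemma form_of_eq0 : B \in unitmx -> form_of d s v B = 0 -> v = 0.
Proof.
move=> Bu f0; apply/rowP => j; rewrite mxE.
have sj : nth (0, 0, 0)%N s j \in monomials d by apply/sd/mem_nth; rewrite sn.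
have := form_poly_eq0 Bu f0 sj; rewrite (bigD1 j) //= eqxx mul1r big1 ?addr0 // => k kj.
by rewrite nth_uniq ?sn // (inj_eq val_inj) eq_sym (negbTE kj) mul0r.
Qed.
End FormOf.

Definition conic_monos : seq (nat * nat * nat) :=
  [:: (1, 1, 0); (1, 0, 1); (0, 2, 0); (0, 1, 1); (0, 0, 2)]%N.
Definition cubic_monos : seq (nat * nat * nat) :=
  [:: (1, 2, 0); (1, 1, 1); (1, 0, 2); (0, 2, 1); (0, 1, 2)]%N.

Lemma conic_monosE (x : K * K * K) (j : 'I_5) :
  mono_value x (nth (0, 0, 0)%N conic_monos j) = (conic_row x)`_j.
Proof. by case: x => [[x y] z]; elim/forall_ord5: j; rewrite /mono_value /=; ring. Qed.

Lemma cubic_monosE (x : K * K * K) (j : 'I_5) :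
  mono_value x (nth (0, 0, 0)%N cubic_monos j) = (cubic_row x)`_j.
Proof. by case: x => [[x y] z]; elim/forall_ord5: j; rewrite /mono_value /=; ring. Qed.

Lemma conic_monos_sub : {subset conic_monos <= monomials 2}.
Proof. by apply/allP. Qed.

Lemma cubic_monos_sub : {subset cubic_monos <= monomials 3}.
Proof. by apply/allP. Qed.

Lemma conic_det0_neq0 B e q : framing B e q -> conic_det 0 q != 0.
Proof.
move=> fr; have [Bu ei h] := fr; apply/eqP => /row_det_eq0[v /eqP v0 hv]; apply: v0.
have iBu : invmx B \in unitmx by rewrite unitmx_inv.
apply: (@form_of_eq0 5 2 conic_monos v _ isT erefl conic_monos_sub iBu).
pose A := [set e l | l in ~: [set lshift 5 o1; lshift 5 o2] : {set 'I_8}].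
apply: (no_on_curve_eq0 (A := A) no6_on_conic) => [||i /imsetP[l + ->]].
- by rewrite card_imset // cardsCs setCK cards2 card_ord.
- exact: form_poly_homog.
rewrite !inE => nl; rewrite (@feval_form_of 5 2 conic_monos v _ erefl conic_monos_sub) h.
under eq_bigr => j _ do rewrite conic_monosE.
have [[a la]|[b ->]] := ord8_split l; last by rewrite framed_rshift hv.
move: nl; rewrite la !(inj_eq (@lshift_inj 3 5)) framed_lshift; elim/ord3P: a {la} => // _.
by rewrite big1 // => j _; elim/forall_ord5: j; rewrite /= ?mulr0 ?mul0r ?mulr0.
Qed.

(** A kernel vector of the determinant is a cubic through all eight points that is singular at the
    first frame point; by [cubic0_span] it belongs to the pencil. *)
Lemma nodal_det0_singular B e q f g : framing B e q -> pencil f g ->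
  nodal_det 0 q = 0 <-> singular_at f g (P (e (lshift 5 o0))).
Proof.
move=> fr fg; have [Bu ei hq] := fr.
have iBu : invmx B \in unitmx by rewrite unitmx_inv.
have B0 : row o0 B = P (e (lshift 5 o0)) by exact: framing_row fr.
have B1 : row o1 B = P (e (lshift 5 o1)) by exact: framing_row fr.
have B2 : row o2 B = P (e (lshift 5 o2)) by exact: framing_row fr.
split=> [/row_det_eq0[v v0 hv]|[s s0]].
  pose h := form_of 3 cubic_monos v (invmx B).
  have hE (x : K * K * K) : feval h (row3 x *m B) = \sum_j v 0 j * (cubic_row x)`_j.
    rewrite (@feval_form_of 5 3 cubic_monos v _ erefl cubic_monos_sub) row_coords //.
    by apply: eq_bigr => j _; rewrite cubic_monosE.
  have hP : cubic0 h.
    split; first exact: form_poly_homog.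
    apply: (framing_vanish fr); first exact: form_poly_homog.
    move=> l; rewrite hE; have [[a ->]|[b ->]] := ord8_split l; last by rewrite framed_rshift hv.
    rewrite framed_lshift big1 // => j _.
    by elim/ord3P: a; elim/forall_ord5: j; rewrite /= ?(mulr0, mul0r).
  have [x [y hxy]] := cubic0_span fg hP.
  exists (x, y); rewrite /= -?hxy.
    apply: contraNneq v0 => -[x0 y0]; apply/eqP.
    apply: (@form_of_eq0 5 3 cubic_monos v _ isT erefl cubic_monos_sub iBu).
    by rewrite -/h hxy x0 y0 !scale0r addr0.
  move=> w; rewrite -B0 -(coordsK w Bu); case: (pt3 (w *m _)) => [[a b] c].
  have -> : row o0 B + row3 (a, b, c) *m B = row3 (1 + a, b, c) *m B.
    by rewrite !row3_mul /= scalerDl scale1r !addrA.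
  have -> : row o0 B - row3 (a, b, c) *m B = row3 (1 - a, - b, - c) *m B.
    by rewrite !row3_mul /= !opprD -!scaleNr scalerDl scale1r !addrA.
  rewrite !hE !big_ord_recl !big_ord0 /= /bump /=.
  by move: (v 0 _) (v 0 _) (v 0 _) (v 0 _) (v 0 _) => *; ring.
have [fP gP fg0] := fg; have hP := cubic0_comb s.1 s.2 fP gP.
have s0' : (s.1, s.2) != (0, 0) -> s.1 *: f + s.2 *: g != 0 by exact: fg0.
move: hP s0'; set h := _ + _ => hP h0; rewrite -surjective_pairing in h0.
move: (h0 s0) => {}h0 hs.
have L0 : lin_part (chart B h) = 0.
  by apply/(sing_chart hP.1 Bu); rewrite B0 ?hP.2.
have cE w : ceval (chart B h) (pt3 (w *m invmx B)) = feval h w.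
  by apply: (ceval_coords Bu _ hP); rewrite B0 hP.2.
have vP l : ceval (chart B h) (framed q l) = 0 by rewrite -hq cE hP.2.
move: cE L0 (vP (lshift 5 o1)) (vP (lshift 5 o2)) (fun i => vP (rshift 3 i)) => {vP}.
case: (chart B h) => L q' n sL sq sn /= cE L0; rewrite !framed_lshift => n3 n0 vP.
have {}n3 : n`_3 = 0.
  by rewrite -[RHS]n3 /ceval /= L0 /bform !big_ord_recl !big_ord0 /= /bump /= !coef0; ring.
have {}n0 : n`_0 = 0.
  by rewrite -[RHS]n0 /ceval /= L0 /bform !big_ord_recl !big_ord0 /= /bump /= !coef0; ring.
have cE' x : ceval (ChartCubic sL sq sn) x = x.1.1 * (q'`_2 * x.1.2 ^+ 2 + q'`_1 * x.1.2 * x.2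
    + q'`_0 * x.2 ^+ 2) + n`_2 * x.1.2 ^+ 2 * x.2 + n`_1 * x.1.2 * x.2 ^+ 2.
  by rewrite /ceval /= L0 /bform !big_ord_recl !big_ord0 /= /bump /= !coef0 n0 n3; ring.
apply/row_det_eq0; exists (\row_j [:: q'`_2; q'`_1; q'`_0; n`_2; n`_1]`_j).
  apply: contraNneq h0 => /rowP v0; apply/eqP; apply: (homog_fun_eq0 K0 hP.1) => w.
  have z0 := v0 (@Ordinal 5 0 isT); have z1 := v0 (@Ordinal 5 1 isT).
  have z2 := v0 (@Ordinal 5 2 isT); have z3 := v0 (@Ordinal 5 3 isT).
  have z4 := v0 (@Ordinal 5 4 isT); rewrite !mxE /= in z0 z1 z2 z3 z4.
  by rewrite -cE cE' z0 z1 z2 z3 z4; ring.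
move=> i; have := vP i; rewrite framed_rshift cE' => E.
rewrite -[RHS]E !big_ord_recl big_ord0 !mxE /= /bump /=; case: (q i) => [[x y] z] /=; ring.
Qed.

Lemma pt3_scale c w B : pt3 (c *: w *m B) = pt_scale c (pt3 (w *m B)).
Proof. by rewrite -scalemxAl /pt3 !mxE. Qed.

Lemma framing_dets_neq0 B e q f g k : framing B e q -> pencil f g ->
  (forall i, ~ singular_at f g (P i)) -> (k < 3)%N -> conic_det k q != 0 /\ nodal_det k q != 0.
Proof.
elim: k B e q => [|k IHk] B e q fr fg ns k3.
  by split; [apply: conic_det0_neq0 fr | apply/eqP => /(nodal_det0_singular fr fg)/ns].
by rewrite -conic_det_rot -nodal_det_rot; apply: IHk (framing_rot fr) fg ns (ltnW k3).
Qed.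

(** The last root of the resultant lifts to a base point R. If R were one of the P i, the root would
    be double and some member would be singular there. *)
Lemma ninth_direction B e q f g : framing B e q -> pencil f g ->
  (forall i, ~ singular_at f g (P i)) ->
  exists R, [/\ R != 0, base f g R, forall i, ~ par (P i) R &
    let c := pt3 (R *m invmx B) in
    c.1.2 * (conic_det 2 q * nodal_det 1 q) = c.2 * (conic_det 1 q * nodal_det 2 q)].
Proof.
move=> fr fg ns; have [Bu ei hq] := fr.
have B0 : row o0 B = P (e (lshift 5 o0)) by exact: framing_row fr.
have b0 : base f g (row o0 B) by rewrite B0; apply: base_P.
have ns0 : ~ singular_at f g (row o0 B) by rewrite B0.
have [s [t [d lf lg]]] := pencil_normalize fg Bu b0 ns0.
have [fg1 bE] := pencil_change fg d.
have sE v := @singular_change f g s.1 s.2 t.1 t.2 v d.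
move: fg1 bE sE lf lg; set f1 := _ + _; set g1 := _ + _ => fg1 bE sE lf lg.
have {}b0 : base f1 g1 (row o0 B) by apply/bE.
have irr := chart_irr fg1 Bu b0.
have bC w := base_coords fg1 Bu b0 w.
have bq l : base_pt (chart B f1) (chart B g1) (framed q l).
  by rewrite -hq; apply/bC; apply: base_P.
have indep (l l' : 'I_8) : l != l' -> l != lshift 5 o0 -> l' != lshift 5 o0 ->
    indep2 (dir (framed q l)) (dir (framed q l')).
  have np a b : a != b -> ~ par (P (e a)) (P (e b)) by move/eqP=> ab /P_par/ei.
  move=> ll' l0 l'0; rewrite -!hq; apply: (dir_indep fg1 Bu b0); rewrite ?B0 //;
    do ?[exact: base_P]; by apply: np; rewrite // eq_sym.
have rl b (k : 'I_3) : rshift 3 b != lshift 5 k :> 'I_8 by rewrite eq_sym eq_lrshift35.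
have z0 b : (q b).2 != 0.
  have := indep _ _ (rl b o1) (rl b o0) isT.
  by rewrite framed_rshift framed_lshift /indep2 /= mulr0 mulr1 eq_sym.
have y0 b : (q b).1.2 != 0.
  have := indep _ _ (rl b o2) (rl b o0) isT.
  by rewrite framed_rshift framed_lshift /indep2 /= mulr0 mulr1.
pose ts := [seq (q b).1.2 / (q b).2 | b <- enum 'I_5].
have s5 : size ts = 5%N by rewrite size_map size_enum_ord.
have uts : uniq ts.
  rewrite map_inj_uniq ?enum_uniq // => b b' e1; apply/eqP; apply: contraT => bb'.
  have := indep (rshift 3 b) (rshift 3 b') _ (rl b o0) (rl b' o0).
  rewrite eq_rshift35 bb' !framed_rshift => /(_ isT).
  rewrite /indep2 /= => /negP[]; rewrite -subr_eq0.
  have -> : (q b).1.2 = (q b').1.2 / (q b').2 * (q b).2 by rewrite -e1 mulfVK.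
  by apply/eqP; field; rewrite z0.
have ts0 : 0 \notin ts.
  apply/mapP => -[b _ /esym/eqP]; by rewrite mulf_eq0 invr_eq0 (negbTE (y0 b)) (negbTE (z0 b)).
have bts : {in ts, forall t, exists x, base_pt (chart B f1) (chart B g1) (x, t, 1)}.
  move=> _ /mapP[b _ ->]; exists ((q b).1.1 / (q b).2).
  have := base_scale (q b).2^-1 fg1 (base_P (e (rshift 3 b)) fg1).
  move/bC; rewrite pt3_scale hq framed_rshift /pt_scale mulVf // ![_^-1 * _]mulrC.
  by [].
have [C1 _] := @framing_dets_neq0 B e q f g 1 fr fg ns isT.
have [C2 _] := @framing_dets_neq0 B e q f g 2 fr fg ns isT.
have [_ D0] := @framing_dets_neq0 B e q f g 0 fr fg ns isT.
have [_ D1] := @framing_dets_neq0 B e q f g 1 fr fg ns isT.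
have [_ D2] := @framing_dets_neq0 B e q f g 2 fr fg ns isT.
(* Y / Z is the ratio of the last two coordinates of [ninth_pt], after cancelling the common factor
   [nodal_det 0 q]. *)
pose Y := conic_det 1 q * nodal_det 2 q; pose Z := conic_det 2 q * nodal_det 1 q.
have Z0 : Z != 0 by rewrite mulf_neq0.
have Y0 : Y != 0 by rewrite mulf_neq0.
suff [r0 rd] : (pencil_res (chart B f1) (chart B g1)).[Y / Z] = 0 /\
    (Y / Z \in ts -> (pencil_res (chart B f1) (chart B g1))^`().[Y / Z] = 0).
  have [x bx] := pencil_res_root irr lf lg r0.
  have bR : base f1 g1 (row3 (x, Y / Z, 1) *m B) by apply/bC; rewrite row_coords.
  exists (row3 (x, Y / Z, 1) *m B); rewrite row_coords //; split.
  - apply/negP => /eqP R0; have := row_coords (x, Y / Z, 1) Bu.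
    by rewrite R0 mul0mx /pt3 !mxE => -[_ _ /esym/eqP]; rewrite oner_eq0.
  - exact/bE.
  - move=> i; have := f_invF ei i; move: (invF ei i) => l <- [c c0 RE].
    have := row_coords (x, Y / Z, 1) Bu; rewrite RE pt3_scale hq => cE.
    have [[a la]|[b lb]] := ord8_split l.
      move: cE; rewrite la framed_lshift; elim/ord3P: a {la} => -[_ e1 e2].
      - by move/esym/eqP: e2; rewrite mulr0 oner_eq0.
      - by move/esym/eqP: e2; rewrite mulr0 oner_eq0.
      - by move/esym/eqP: e1; rewrite mulr0 mulf_eq0 invr_eq0 (negbTE Y0) (negbTE Z0).
    have tin : Y / Z \in ts.
      apply/mapP; exists b; rewrite ?mem_enum //; move: cE; rewrite lb framed_rshift => -[_ <- e2].
      by rewrite (_ : c = (q b).2^-1) 1?mulrC // -[RHS]mul1r -e2 mulfK.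
    have [s' s'0 [dx dy]] := pencil_res_double irr lf lg bx (rd tin).
    rewrite -chart_comb in dx dy.
    apply: (ns (e l)); apply: sE; exists s' => //.
    have hP : cubic0 (s'.1 *: f1 + s'.2 *: g1) by case: fg1 => h1 h2 _; apply: cubic0_comb.
    rewrite -[P _]scale1r -(mulVf c0) -scalerA -RE; apply: sing_scale (invr_neq0 c0) _; first by case: hP.
    apply: cubic_dx_dy_sing => //; first exact: pencil_comb_base.
    by rewrite chart_comb ceval_comb; case: bx => -> ->; rewrite !mulr0 addr0.
  - by rewrite /= mul1r -/Y -/Z mulfVK.
have nF k : base_pt (chart B f1) (chart B g1) k -> ceval (chart B f1) k = 0 by case.
have nG k : base_pt (chart B f1) (chart B g1) k -> ceval (chart B g1) k = 0 by case.
have q1 : framed q (lshift 5 o1) = (0, 1, 0) by rewrite framed_lshift.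
have q2 : framed q (lshift 5 o2) = (0, 0, 1) by rewrite framed_lshift.
have := bq (lshift 5 o1); have := bq (lshift 5 o2); rewrite {}q1 {}q2.
have := fun b => bq (rshift 3 b).
move: lf lg bts; clear - fr D0 z0 s5 uts ts0 Z0.
case: (chart B f1) => L1 q1 n1 sL1 sq1 sn1; case: (chart B g1) => L2 q2 n2 sL2 sq2 sn2.
rewrite /= => lf lg bts bq b2 b1.
have F3 : n1`_3 = 0.
  by case: b1 => + _; rewrite /ceval /bform !big_ord_recl !big_ord0 /= /bump /= => E; rewrite -[RHS]E; ring.
have G3 : n2`_3 = 0.
  by case: b1 => _ +; rewrite /ceval /bform !big_ord_recl !big_ord0 /= /bump /= => E; rewrite -[RHS]E; ring.
have F0 : n1`_0 = 0.
  by case: b2 => + _; rewrite /ceval /bform !big_ord_recl !big_ord0 /= /bump /= => E; rewrite -[RHS]E; ring.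
have G0 : n2`_0 = 0.
  by case: b2 => _ +; rewrite /ceval /bform !big_ord_recl !big_ord0 /= /bump /= => E; rewrite -[RHS]E; ring.
have fq i x y z : q i = (x, y, z) ->
  x * x * y + (q1`_2 * (x * y * y) + q1`_1 * (x * y * z) + q1`_0 * (x * z * z)
   + n1`_2 * (y * y * z) + n1`_1 * (y * z * z)) = 0.
  move=> qi; have := bq i; rewrite framed_rshift qi => -[+ _].
  rewrite /ceval /= lf bform_X /bform !big_ord_recl !big_ord0 /= /bump /= F0 F3 => E.
  by rewrite -[RHS]E; ring.
have gq i x y z : q i = (x, y, z) ->
  x * x * z + (q2`_2 * (x * y * y) + q2`_1 * (x * y * z) + q2`_0 * (x * z * z)
   + n2`_2 * (y * y * z) + n2`_1 * (y * z * z)) = 0.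
  move=> qi; have := bq i; rewrite framed_rshift qi => -[_ +].
  rewrite /ceval /= lg bform_1 /bform !big_ord_recl !big_ord0 /= /bump /= G0 G3 => E.
  by rewrite -[RHS]E; ring.
apply: last_direction => //=.
have e1 := conic_det2_eq gq; have e2 := conic_det1_eq fq.
have e3 := nodal_det1_eq fq gq; have e4 := nodal_det2_eq fq gq.
have pz : \prod_i (q i).2 != 0 by apply/prodf_neq0.
have -> : \prod_(t <- ts) t = (\prod_i (q i).1.2) / \prod_i (q i).2.
  by rewrite big_map big_enum prodf_div.
move: pz D0 e1 e2 e3 e4; rewrite /Y /Z; clear.
move: (\prod_i _) (\prod_i _) (nodal_det 0 q) (nodal_det 1 q) (nodal_det 2 q) (conic_det 1 q) (conic_det 2 q).
move: (q1`_2) (q1`_0) (q2`_2) (q2`_0) (n1`_2) (n1`_1) (n2`_2) (n2`_1).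
move=> F2 F0 G2 G0 f4 f3 g4 g3 py pz D0 D1 D2 C1 C2 pz0 D00 e1 e2 e3 e4.
apply: (mulfI (mulf_neq0 (mulf_neq0 D00 D00) pz0)).
transitivity ((D0 * G2) * (D0 * (f4 * G2 - F2 * g4)) * py * (C1 * D2)); first by field.
rewrite -e1 -e3.
transitivity ((D0 * F0) * (D0 * (F0 * g3 - G0 * f3)) * (C2 * D1) * pz); last by ring.
by rewrite -e2 -e4; ring.
Qed.

Definition ninth_row B (q : 'I_5 -> K * K * K) : 'rV[K]_3 :=
  row3 (ninth_pt 0 q, ninth_pt 1 q, ninth_pt 2 q) *m B.

(** The frame gives a base point with known ratio of y and z, the rotated frame one with known ratio
    of z and x. By [transversal_unique] both are the same point, and the two ratios determine it. *)
Lemma ninth_row_base B e q f g : framing B e q -> pencil f g ->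
  (forall i, ~ singular_at f g (P i)) ->
  [/\ ninth_row B q != 0, base f g (ninth_row B q) & forall i, ~ par (P i) (ninth_row B q)].
Proof.
move=> fr fg ns; have [Bu _ _] := fr.
have [R [R0 bR nR]] := ninth_direction fr fg ns.
have [R' [R'0 bR' nR']] := ninth_direction (framing_rot fr) fg ns.
have [c c0 ->] : par R R'.
  by apply: (transversal_unique fg _ R0 R'0 bR bR' nR nR') => /(singular_in_P fg R0 bR)[i /nR].
rewrite rot_frame_coords // pt3_scale !conic_det_rot !nodal_det_rot !nodal_det3.
have -> : conic_det 3 q = conic_det 0 q.
  by congr (\det _); apply/matrixP => i j; rewrite !mxE; case: (q i) => [[]].
have [C2 _] := @framing_dets_neq0 B e q f g 2 fr fg ns isT.
have [_ D0] := @framing_dets_neq0 B e q f g 0 fr fg ns isT.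
have [_ D1] := @framing_dets_neq0 B e q f g 1 fr fg ns isT.
case E: (pt3 (R *m _)) => [[x y] z] /= e1 e2.
have {}e1 : z * (conic_det 0 q * nodal_det 2 q) = x * (conic_det 2 q * nodal_det 0 q).
  by apply: (mulfI c0); move: e1; rewrite !mulrA.
have N2 : ninth_pt 2 q != 0.
  by rewrite /ninth_pt -[3%N]/(0.+3)%N -[4%N]/(1.+3)%N !nodal_det3 !mulf_neq0.
have nE : z *: ninth_row B q = ninth_pt 2 q *: R.
  rewrite -[in RHS](coordsK R Bu) E !scalemxAl; congr (_ *m _).
  apply/rowP; elim/ord3P; rewrite !mxE /= /ninth_pt -?[3%N]/(0.+3)%N -?[4%N]/(1.+3)%N !nodal_det3.
  - transitivity (z * (conic_det 0 q * nodal_det 2 q) * nodal_det 1 q); first ring.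
    by rewrite e1; ring.
  - transitivity (z * (conic_det 1 q * nodal_det 2 q) * nodal_det 0 q); first ring.
    by rewrite -e2; ring.
  - by ring.
have z0 : z != 0.
  apply: contraNneq R0 => z0; have /eqP := nE; rewrite z0 scale0r eq_sym scaler_eq0.
  by rewrite (negbTE N2).
have par_RN : par R (ninth_row B q).
  exists (ninth_pt 2 q / z); first by rewrite mulf_neq0 ?invr_neq0.
  by rewrite mulrC -scalerA -nE scalerA mulVf // scale1r.
have [k k0 NE] := par_RN; rewrite NE; split.
- by rewrite scaler_eq0 negb_or k0.
- exact: base_scale fg bR.
by move=> i /par_trans/(_ (par_sym _)) h; apply: (nR i); apply: h; exists k.
Qed.

(** The first nodal determinant is a factor of the last two coordinates. By [singular_unique] the
    other two nodal determinants are nonzero, so the first coordinate survives. *)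
Lemma ninth_row_singular B e q f g : framing B e q -> pencil f g ->
  singular_at f g (P (e (lshift 5 o0))) -> par (P (e (lshift 5 o0))) (ninth_row B q).
Proof.
move=> fr fg sg; have [_ ei _] := fr.
have D k : (0 < k < 3)%N -> nodal_det k q != 0.
  have ne a B' q' : framing B' a q' -> a (lshift 5 o0) != e (lshift 5 o0) -> nodal_det 0 q' != 0.
    move=> fr' ae; apply: contraNneq ae => /(nodal_det0_singular fr' fg) sa.
    by rewrite (singular_unique fg sa sg).
  have fr1 := framing_rot fr; have fr2 := framing_rot fr1.
  case: k => [|[|[|]]] // _.
    rewrite -nodal_det_rot; apply: (ne _ _ _ fr1).
    by rewrite (inj_eq ei) /rot_index (unsplitK (inl _)) (inj_eq (@lshift_inj 3 5)).
  rewrite -2!nodal_det_rot; apply: (ne _ _ _ fr2).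
  by rewrite /= (inj_eq ei) /rot_index !(unsplitK (inl _)) (inj_eq (@lshift_inj 3 5)).
have D0 : nodal_det 0 q = 0 by apply/(nodal_det0_singular fr fg).
exists (ninth_pt 0 q).
  by rewrite /ninth_pt !mulf_neq0 ?D //; apply: conic_det0_neq0 fr.
rewrite -(framing_row _ fr) /ninth_row row3_mul /= /ninth_pt -[3%N]/(0.+3)%N -[4%N]/(1.+3)%N.
by rewrite !nodal_det3 D0 !(mulr0, mul0r) !scale0r !addr0.
Qed.

(** * The bracket formula in a frame *)

Lemma br_mul B (x y z : K * K * K) :
  br (pt3 (row3 x *m B)) (pt3 (row3 y *m B)) (pt3 (row3 z *m B)) = br x y z * \det B.
Proof.
rewrite -det_frame -[x in RHS]row3K -[y in RHS]row3K -[z in RHS]row3K -det_frame -det_mulmx.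
congr (\det _); apply/row_matrixP; elim/ord3P; rewrite row_mul !rowK //.
Qed.

Lemma coord_pt3 k (w : 'rV[K]_3) (i : 'I_3) : i = k :> nat -> coord k (pt3 w) = w 0 i.
Proof. by elim/ord3P: i => /= <-. Qed.

(** Each of the 21 brackets contributes a factor [\det B], and the point outside the brackets is
    transformed linearly. *)
Lemma bracket_sum_mul B (u : 'I_8 -> K * K * K) (i : 'I_3) :
  bracket_sum i (fun l => pt3 (row3 (u l) *m B))
  = \det B ^+ 21 * \sum_(j < 3) bracket_sum j u * B j i.
Proof.
rewrite /bracket_sum; under [in RHS]eq_bigr => j _ do rewrite mulr_suml.
rewrite exchange_big mulr_sumr; apply: eq_bigr => s _ /=.
rewrite /bracket_term /= (coord_pt3 _ erefl).
under eq_bigr => t _ do rewrite br_mul; rewrite big_split /=.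
have -> : \prod_(t <- triples) \det B = \det B ^+ 21.
  by rewrite /triples !big_cons big_nil; ring.
rewrite mxE !sum_ord3 !mxE; case: (u _) => [[x y] z] /=.
move: ((-1) ^+ s) (\prod_(t <- _) _) (\det B ^+ 21) => a b c; ring.
Qed.

Definition bracket_pt : 'rV[K]_3 :=
  \sum_(s : 'S_8) ((-1) ^+ s * F P s) *: P (s (idx 8)).

Lemma bracket_pt_framing B e q : framing B e q ->
  exists2 c, c != 0 & bracket_pt = c *: ninth_row B q.
Proof.
move=> fr; have [Bu ei hq] := fr; pose p l := pt3 (P l).
(* [F] lists the outer point as 8, [triples] gives it the index 0; the cyclic shift [ord_pred]
   translates and costs only the sign of [L] below. *)
have lab0 : ord_pred (inord 0 : 'I_8) = idx 8.
  by apply: val_inj; rewrite /= /idx !inordK.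
have lab k : (0 < k < 8)%N -> ord_pred (inord k : 'I_8) = idx k.
  case: k => // k /= k8; apply: val_inj; rewrite /idx /= (inordK k8) inordK ?(ltnW k8) //.
  by rewrite addSn /= modnDr modn_small // ltnW.
have brE i j k : bracket P i j k = br (p i) (p j) (p k) by rewrite -det_frame.
have FE (s : 'S_8) : F P s = \prod_(t <- triples)
    br (p (s (ord_pred (inord t.1.1)))) (p (s (ord_pred (inord t.1.2)))) (p (s (ord_pred (inord t.2)))).
  by rewrite /F !brE /triples !big_cons big_nil /= !lab0 !lab //; ring.
pose L := perm (@ord_pred_inj 8); pose E := perm ei.
have QE (i : 'I_3) : bracket_pt 0 i = (-1) ^+ L * bracket_sum i p.
  rewrite /bracket_pt summxE /bracket_sum mulr_sumr (reindex_inj (mulgI L^-1%g)) /=.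
  apply: eq_bigr => s _; rewrite [LHS]mxE FE -lab0.
  have LE x : (L^-1 * s)%g (ord_pred x) = s x by rewrite permM -(permE (@ord_pred_inj 8)) permK.
  under eq_bigr => t _ do rewrite !LE.
  by rewrite LE odd_permM odd_permV signr_addb /bracket_term /= (coord_pt3 _ erefl) !mulrA.
have bE (i : 'I_3) : bracket_sum i p = (-1) ^+ E * (\det B ^+ 21 * (840%:R * ninth_row B q 0 i)).
  have -> : bracket_sum i p = (-1) ^+ E * bracket_sum i (p \o E).
    by rewrite bracket_sum_perm mulrA -expr2 sqrr_sign mul1r.
  congr (_ * _); rewrite -(@eq_bracket_sum _ _ (fun l => pt3 (row3 (framed q l) *m B))); last first.
    by move=> l; rewrite /= permE /p (framing_pt _ fr).
  rewrite bracket_sum_mul mxE mulr_sumr; congr (_ * _); apply: eq_bigr => j _.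
  have := @defect_eq0 K j q K0 (ltn_ord j); rewrite /defect => /eqP.
  by rewrite subr_eq0 => /eqP ->; rewrite mulrA; congr (_ * _ * _); elim/ord3P: j; rewrite mxE.
exists ((-1) ^+ L * ((-1) ^+ E * (\det B ^+ 21 * 840%:R))).
  have dB : \det B != 0 by move: Bu; rewrite unitmxE unitfE.
  have n840 : 840%:R != 0 :> K by rewrite K0.
  apply: mulf_neq0; first by rewrite signr_eq0.
  by apply: mulf_neq0; [rewrite signr_eq0 | apply: mulf_neq0 n840; exact: expf_neq0].
by apply/rowP => i; rewrite QE bE [RHS]mxE !mulrA.
Qed.

Lemma framing_exists (e : 'I_8 -> 'I_8) : injective e -> exists B q, framing B e q.
Proof.
move=> ei; pose B := frame (P (e (lshift 5 o0))) (P (e (lshift 5 o1))) (P (e (lshift 5 o2))).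
have Brow a : row a B = P (e (lshift 5 a)) by rewrite rowK; elim/ord3P: a.
suff Bu : B \in unitmx.
  exists B, (fun b => pt3 (P (e (rshift 3 b)) *m invmx B)); split=> // l.
  have [[a ->]|[b ->]] := ord8_split l; last by rewrite framed_rshift.
  by rewrite framed_lshift -Brow (@basis_pt_row _ _ a).
rewrite unitmxE unitfE -det_tr; apply/negP => /det0P[v v0 vB].
pose A : 'M[K]_3 := \matrix_(i, j) v 0 i; have lE w : feval (lform A o0) w = (v *m w^T) 0 0.
  by rewrite feval_lform !mxE; apply: eq_bigr => i _; rewrite !mxE mulrC.
have l0 : lform A o0 = 0.
  pose S : {set 'I_8} := e @: [set lshift 5 a | a : 'I_3].
  apply: (no_on_curve_eq0 (A := S) no3_on_line).
  - by rewrite !card_imset ?card_ord //; apply: (@lshift_inj 3 5).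
  - exact: lform_homog.
  move=> _ /imsetP[_ /imsetP[a _ ->] ->]; rewrite -Brow lE tr_row colE mulmxA vB mul0mx mxE //.
case/eqP: v0; apply/rowP => i; have := lE (delta_mx 0 i); rewrite l0 /feval meval0.
by rewrite trmx_delta -colE !mxE => <-.
Qed.

Lemma framing_at i : exists B e q, framing B e q /\ e (lshift 5 o0) = i.
Proof.
have [B [q fr]] := framing_exists (@perm_inj _ (tperm (lshift 5 o0 : 'I_8) i)).
by exists B, (tperm (lshift 5 o0 : 'I_8) i), q; rewrite tpermL.
Qed.

Lemma bracket_pt_base f g : pencil f g -> (forall i, ~ singular_at f g (P i)) ->
  [/\ bracket_pt != 0, base f g bracket_pt & forall i, ~ par (P i) bracket_pt].
Proof.
move=> fg ns; have [B [e [q [fr _]]]] := framing_at ord0.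
have [c c0 ->] := bracket_pt_framing fr; have [N0 bN nN] := ninth_row_base fr fg ns.
split; [by rewrite scaler_eq0 negb_or c0 | exact: base_scale fg bN | move=> i hi].
by apply: (nN i); apply: par_trans hi (par_sym _); exists c.
Qed.

Lemma bracket_pt_singular f g i : pencil f g -> singular_at f g (P i) -> par (P i) bracket_pt.
Proof.
have [B [e [q [fr <-]]]] := framing_at i => fg si.
have [c c0 ->] := bracket_pt_framing fr.
by apply: par_trans (ninth_row_singular fr fg si) _; exists c.
Qed.

Lemma form_of_comb n d s (v w : 'rV[K]_n) (B : 'M[K]_3) (x y : K) :
  x *: form_of d s v B + y *: form_of d s w B = form_of d s (x *: v + y *: w) B.
Proof.
rewrite /form_of /form_poly !scaler_sumr -big_split; apply: eq_bigr => m _ /=.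
rewrite !scalerA -scalerDl; congr (_ *: _); rewrite !mulr_sumr -big_split.
by apply: eq_bigr => j _; rewrite !mxE mulrDr; congr (_ + _); apply: mulrCA.
Qed.

(** Ten coefficients against eight linear conditions. *)
Lemma pencil_exists : exists f g, pencil f g.
Proof.
pose V : 'M[K]_(10, 8) := \matrix_(j, i) mono_value (pt3 (P i)) (nth (0, 0, 0)%N (monomials 3) j).
have r2 : (1 < \rank (kermx V))%N.
  by rewrite mxrank_ker; have := rank_leq_col V; case: (\rank V) => // n; lia.
pose i0 : 'I_(\rank (kermx V)) := Ordinal (ltnW r2); pose i1 := Ordinal r2.
pose form i := form_of 3 (monomials 3) (row i (row_base (kermx V))) 1%:M.
have fP i : cubic0 (form i).
  split=> [|l]; first exact: form_poly_homog.
  rewrite (@feval_form_of 10 3 (monomials 3) _ _ erefl (fun _ mM => mM)) mulmx1.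
  have : row i (row_base (kermx V)) *m V = 0.
    by apply/sub_kermxP; rewrite (submx_trans (row_sub _ _)) // eq_row_base.
  move/(congr1 (fun w : 'rV[K]_8 => w 0 l)); rewrite mxE [RHS]mxE => E; rewrite -[RHS]E.
  by apply: eq_bigr => j _; rewrite [V _ _]mxE.
exists (form i0), (form i1); split=> // s s'; apply: contraNneq.
rewrite form_of_comb => /(@form_of_eq0 10 3 (monomials 3) _ _ (uniq_monomials 3) erefl (fun _ mM => mM) (unitmx1 _ _)).
rewrite !rowE !scalemxAl -mulmxDl => E0.
have := row_free_inj (row_base_free (kermx V)) (etrans E0 (esym (mul0mx _ _))) => /rowP E.
have := E i0; have := E i1; rewrite !mxE /= !mulr1 !mulr0 addr0 add0r => -> ->.
by [].
Qed.

(** * Intersection multiplicities of the cubics *)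

Lemma transversal_mult f g R : pencil f g -> R != 0 -> base f g R -> ~ singular_at f g R ->
  intersection_mult R 3 f 3 g 1.
Proof.
move=> fg R0 bR ns; have [[fd _] [gd _] _] := fg.
have [v [w Bu]] := frame_exists R0; set B := frame R v w in Bu.
have BR : row o0 B = R by exact: row0_frame.
rewrite -BR in bR ns *; apply: (transversal_mult1 K0 Bu fd gd bR).
have [s [t [d lf lg]]] := pencil_normalize fg Bu bR ns.
move: lf lg; rewrite !chart_comb; clear; move: (chart B f) (chart B g) => F G /= lf lg.
move: (congr1 (fun p : {poly K} => p`_0) lf) (congr1 (fun p : {poly K} => p`_1) lf).
move: (congr1 (fun p : {poly K} => p`_0) lg) (congr1 (fun p : {poly K} => p`_1) lg).
rewrite !coefD !coefCM !coefX !coef1 /=; clear.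
move: ((lin_part F)`_0) ((lin_part F)`_1) ((lin_part G)`_0) ((lin_part G)`_1) => a0 a1 b0 b1 e1 e2 e3 e4.
have : (a1 * b0 - a0 * b1) * (s.1 * t.2 - s.2 * t.1) = 1.
  transitivity ((s.1 * a1 + s.2 * b1) * (t.1 * a0 + t.2 * b0)
    - (s.1 * a0 + s.2 * b0) * (t.1 * a1 + t.2 * b1)); first by ring.
  by rewrite e1 e2 e3 e4; ring.
by move=> E; apply/eqP => D; move/eqP: E; rewrite D mul0r eq_sym oner_eq0.
Qed.

(** If all members were singular at P i, one of them would contain the line from P i to another P
    j. *)
Lemma nodal_lin_neq0 f g B i : pencil f g -> B \in unitmx -> row o0 B = P i ->
  lin_part (chart B f) = 0 -> lin_part (chart B g) <> 0.
Proof.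
move=> fg Bu Bi Lf Lg; have b0 : base f g (row o0 B) by rewrite Bi; apply: base_P.
pose j : 'I_8 := if i == ord0 then ord_max else ord0.
have ij : ~ par (row o0 B) (P j).
  by rewrite Bi => /P_par; rewrite /j; case: (eqVneq i ord0) => [->|/eqP].
have := dir_neq0 Bu (P_neq0 j) ij; have /(base_coords fg Bu b0) := base_P j fg.
have := chart_irr fg Bu b0; move: Lf Lg; move: (chart B f) (chart B g) => F G Lf Lg irr.
case: (pt3 _) => [[x y] z] [fx gx]; rewrite /dir /= => yz.
pose qf := bform 2 (quad_part F) y z; pose qg := bform 2 (quad_part G) y z.
have [s s0 sq] : exists2 s : K * K, s != (0, 0) & s.1 * qf + s.2 * qg = 0.
  have [qf0|qf0] := eqVneq qf 0.
    by exists (1, 0); rewrite /= ?qf0 ?mulr0 ?mul0r ?addr0 // xpair_eqE oner_eq0.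
  exists (qg, - qf); last by rewrite /=; ring.
  by apply: contraNneq qf0 => -[_ /eqP]; rewrite oppr_eq0.
have s0' : (s.1, s.2) != (0, 0) by rewrite -surjective_pairing.
apply: (irr _ _ s0'); apply: (line_factor yz).
- by rewrite /= Lf Lg !mulr0 addr0 bform0.
- by rewrite /= bformD !bformC.
rewrite /= bformD !bformC; move: fx gx; rewrite /ceval /= Lf Lg !bform0 !mulr0 !add0r -/qf -/qg.
move=> /eqP; rewrite addrC addr_eq0 => /eqP -> /eqP; rewrite addrC addr_eq0 => /eqP ->.
transitivity (- x * (s.1 * qf + s.2 * qg)); first by ring.
by rewrite sq mulr0.
Qed.

Lemma singular_mult f g i : pencil f g -> singular_at f g (P i) ->
  intersection_mult (P i) 3 f 3 g 2.
Proof.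
move=> fg [s s0 hs]; have [t [d fg1 bE]] := pencil_complete fg s0.
have [[fd _] [gd _] _] := fg; have [[hd h0] [kd k0] _] := fg1.
set h := _ + _ in fg1 bE hs hd h0; set k := _ + _ in fg1 bE kd k0.
have [v [w Au]] := frame_exists (P_neq0 i); set A := frame (P i) v w in Au.
have AR : row o0 A = P i by exact: row0_frame.
have sing_lin (B : 'M[K]_3) : B \in unitmx -> row o0 B = P i -> lin_part (chart B h) = 0.
  by move=> Bu BR; apply/(sing_chart hd Bu); rewrite BR ?h0.
pose L := lin_part (chart A k).
have L0 : L != 0 by apply/eqP; apply: (nodal_lin_neq0 fg1 Au AR); apply: sing_lin.
(* The linear part of k vanishes in this direction, so S lies on the tangent line of k at P i; it
   becomes row 1 of the frame B. *)
pose x : K * K * K := (0, L`_0, - L`_1); pose S := row3 x *m A.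
have LS : bform 1 L x.1.2 x.2 = 0.
  have bL (l : {poly K}) : bform 1 l l`_0 (- l`_1) = 0.
    by rewrite /bform !big_ord_recl big_ord0 /= /bump /=; ring.
  exact: bL.
have xS : pt3 (S *m invmx A) = x by rewrite row_coords.
have x0 : dir x != (0, 0).
  apply: contra L0 => /eqP[l0 /eqP]; rewrite oppr_eq0 => /eqP l1; apply/eqP/polyP => n.
  by rewrite coef0; case: n => [|[|n]] //; rewrite nth_default // (leq_trans (size_lin_part _)).
have S0 : S != 0.
  by apply: contraNneq x0 => S0; rewrite -xS S0 mul0mx /pt3 !mxE.
have PS : ~ par (P i) S.
  move=> [c _ SE]; have := xS; rewrite SE -AR => /(coords_row0 Au) xE.
  by move: x0; rewrite xE eqxx.
have [u Bu] := frame_exists2 (P_neq0 i) S0 PS; set B := frame (P i) S u in Bu.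
have BR : row o0 B = P i by exact: row0_frame.
have BS : row o1 B = S by exact: row1_frame.
have k0' (C : 'M[K]_3) : row o0 C = P i -> feval k (row o0 C) = 0 by move->; rewrite k0.
(* Tangency is carried from the frame A to B by [chart_tangent], whose left side depends only on the
   vectors involved. *)
have Lk : bform 1 (lin_part (chart B k)) 1 0 = 0.
  have e1 := chart_tangent 1 0 kd (k0' B BR) 0.
  have e2 := chart_tangent L`_0 (- L`_1) kd (k0' A AR) 0.
  cbv zeta in e1, e2; rewrite -/x -/S AR in e2.
  have wB : row3 (0, 1, 0) *m B = S by rewrite row3_mul BS !scale0r scale1r add0r addr0.
  rewrite wB BR in e1; have n2 : 2%:R != 0 :> K by rewrite K0.
  apply: (mulfI n2); rewrite mulr0; apply: (@addrI _ (2%:R * feval k S)).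
  by rewrite addr0 -e1 e2 [bform _ _ _ _]LS mulr0 addr0.
have Bb : base h k (row o0 B) by rewrite BR; apply: base_P.
have LhB := sing_lin B Bu BR.
have hws : {in others i, forall w, [/\ base h k w, w != 0 & ~ par (row o0 B) w]}.
  by rewrite BR; apply: othersP.
have [us1 us2 us3 us4] := dirs_indep fg1 Bu Bb hws (others_pairwise i).
rewrite size_others in us4.
have n10 : (1, 0) != (0, 0) :> K * K by rewrite xpair_eqE oner_eq0.
have qh : (quad_part (chart B h))`_2 != 0.
  have := nodal_tangent (chart_irr fg1 Bu Bb) LhB us1 us2 us3 _ us4 n10 Lk.
  by rewrite us4 bform_inf expr1n mulr1; apply.
rewrite bform_inf expr1n mulr1 in Lk.
have Lk0 : (lin_part (chart B k))`_0 != 0.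
  apply/eqP => l0; apply: (nodal_lin_neq0 fg1 Bu BR LhB); apply/polyP => n; rewrite coef0.
  by case: n => [|[|n]] //; rewrite nth_default // (leq_trans (size_lin_part _)).
have linE y z : (lin_part (chart B (y *: f + z *: g)))`_1
    = y * (lin_part (chart B f))`_1 + z * (lin_part (chart B g))`_1.
  by rewrite chart_comb; move: (chart B f) (chart B g) => F G; rewrite coefD !coefCM.
have [Lf Lg] : (lin_part (chart B f))`_1 = 0 /\ (lin_part (chart B g))`_1 = 0.
  by apply: (comb_eq0 d); rewrite -linE // -/h LhB coef0.
rewrite -BR; apply: (nodal_mult2 K0 Bu fd gd _ (s := s) (t := t) Lf Lg _ qh Lk0).
  by rewrite BR; apply: base_P.
by rewrite -/h LhB coef0.
Qed.

Lemma bracket_pt_cases f g : pencil f g ->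
  (exists2 i, singular_at f g (P i) & par (P i) bracket_pt)
  \/ [/\ forall i, ~ singular_at f g (P i), bracket_pt != 0, base f g bracket_pt
       & forall i, ~ par (P i) bracket_pt].
Proof.
(* Singularity at P i is decided by testing a nodal determinant. *)
move=> fg; have dec i : exists b : bool, b <-> singular_at f g (P i).
  have [B [e [q [fr <-]]]] := framing_at i; exists (nodal_det 0 q == 0).
  by rewrite -(nodal_det0_singular fr fg); split=> /eqP.
have [b bE] := fin_all_exists dec.
have [/existsP[i /bE si]|/existsPn n] := boolP [exists i, b i].
  by left; exists i => //; apply: bracket_pt_singular fg si.
have ns i : ~ singular_at f g (P i) by move/bE; apply/negP.
by right; have [] := bracket_pt_base fg ns.
Qed.

Lemma bracket_pt_basic f g : pencil f g -> bracket_pt != 0 /\ base f g bracket_pt.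
Proof.
move=> fg; have [[i _ [c c0 ->]]|[_ Q0 bQ _]] := bracket_pt_cases fg; last by [].
split; last by apply: base_scale fg (base_P i fg).
by rewrite scaler_eq0 negb_or c0 P_neq0.
Qed.

Lemma singular_par f g v w : pencil f g -> par v w -> singular_at f g v -> singular_at f g w.
Proof.
move=> fg [c c0 ->] [s s0 hs]; exists s => //; apply: sing_scale => //.
by have [fP gP _] := fg; case: (cubic0_comb s.1 s.2 fP gP).
Qed.

Lemma vanishes_par d f v w : f \is d.-homog -> par v w -> ~ vanishes_at f v -> ~ vanishes_at f w.
Proof.
move=> fd [c c0 ->] nv; rewrite /vanishes_at -/(feval f _) (feval_scale _ _ fd) => /eqP.
by rewrite mulf_eq0 expf_eq0 (negbTE c0) andbF => /eqP.
Qed.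

Lemma in_local_ring_par v w x : par v w -> in_local_ring v x -> in_local_ring w x.
Proof.
move=> vw [d [a [b [ad bd nb ->]]]]; exists d, a, b; split=> //.
exact: vanishes_par bd vw nb.
Qed.

Lemma in_local_ideal_par d e f g v w x : par v w ->
  in_local_ideal v d f e g x -> in_local_ideal w d f e g x.
Proof.
move=> vw [l [a [b [ld nl la lb ->]]]]; exists l, a, b; split=> //.
- exact: vanishes_par ld vw nl.
- exact: in_local_ring_par vw la.
- exact: in_local_ring_par vw lb.
Qed.

Lemma intersection_mult_par d e f g m v w : par v w ->
  intersection_mult v d f e g m -> intersection_mult w d f e g m.
Proof.
move=> vw [b [lb hb]]; exists b; split=> [i|x /(in_local_ring_par (par_sym vw))/hb[c [ic uc]]].
  exact: in_local_ring_par vw (lb i).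
exists c; split=> [|c' /(in_local_ideal_par (par_sym vw))]; last exact: uc.
exact: in_local_ideal_par vw ic.
Qed.

Lemma bracket_pt_mult f g R : pencil f g -> R != 0 ->
  intersection_mult R 3 f 3 g (#|[set i | (P i == R)%MS]| + (bracket_pt == R)%MS)%N.
Proof.
move=> fg R0; have [Q0 bQ] := bracket_pt_basic fg.
have [[fd _] [gd _] _] := fg.
have parE v : v != 0 -> (v == R)%MS <-> par v R by move=> v0; split=> /(parP v0 R0).
have [/andP[/eqP fR /eqP gR]|nb] := boolP ((feval f R == 0) && (feval g R == 0)); last first.
  have {}nb : ~ base f g R by move=> [fR gR]; case/negP: nb; rewrite fR gR eqxx.
  have -> : [set i | (P i == R)%MS] = set0.
    apply/setP => i; rewrite !inE; apply/negP => /(parE _ (P_neq0 i))[c c0 e].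
    by apply: nb; rewrite e; apply: base_scale fg (base_P i fg).
  have -> : (bracket_pt == R)%MS = false.
    by apply/negP => /(parE _ Q0)[c c0 e]; apply: nb; rewrite e; apply: base_scale fg bQ.
  rewrite cards0; have [v [w Bu]] := frame_exists R0.
  by have := intersection_mult0 Bu fd gd; rewrite row0_frame; apply.
have bR : base f g R by [].
have [[i iR]|n] := par_P_dec R0.
  have -> : [set j | (P j == R)%MS] = [set i].
    apply/setP => j; rewrite !inE; apply/idP/eqP => [/(parE _ (P_neq0 j)) jR|->].
      by apply: P_par; apply: par_trans jR (par_sym iR).
    by apply/parE.
  rewrite cards1.
  have [[j sj jQ]|[ns _ _ nQ]] := bracket_pt_cases fg; last first.
    have -> : (bracket_pt == R)%MS = false.
      by apply/negP => /(parE _ Q0) QR; apply: (nQ i); exact: par_trans iR (par_sym QR).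
    apply: transversal_mult => // sR; apply: (ns i); exact: singular_par fg (par_sym iR) sR.
  have [ij|ij] := eqVneq i j.
    have -> : (bracket_pt == R)%MS.
      by apply/(parE _ Q0); apply: par_trans iR; apply: par_sym; rewrite ij.
    by apply: (intersection_mult_par iR); apply: singular_mult; rewrite ?ij.
  have -> : (bracket_pt == R)%MS = false.
    apply/negP => /(parE _ Q0) QR; case/eqP: ij; apply: P_par.
    exact: par_trans iR (par_sym (par_trans jQ QR)).
  apply: transversal_mult => // sR; case/eqP: ij.
  exact: singular_unique fg (singular_par fg (par_sym iR) sR) sj.
have -> : [set j | (P j == R)%MS] = set0.
  by apply/setP => j; rewrite !inE; apply/negP => /(parE _ (P_neq0 j)); apply: n.
have nsR : ~ singular_at f g R by move/(singular_in_P fg R0 bR) => [i /n].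
(* R is a base point outside P. This is impossible if some P j is singular; otherwise it is the only
   such point, [bracket_pt]. *)
have [[j sj _]|[ns _ _ nQ]] := bracket_pt_cases fg.
  by have [k /n] := singular_P_base fg sj R0 bR.
have -> : (bracket_pt == R)%MS.
  apply/(parE _ Q0); apply: (transversal_unique fg _ Q0 R0 bQ bR nQ n).
  by move/(singular_in_P fg Q0 bQ) => [i /nQ].
by rewrite cards0; apply: transversal_mult.
Qed.

Lemma cubic_throughP f : cubic_through P f <-> f != 0 /\ cubic0 f.
Proof. by split=> [[[fd f0] fP]|[f0 [fd fP]]]; [split; [|split] | split; [split|]]. Qed.

Lemma distinct_pencil f g : cubic_through P f -> cubic_through P g ->
  distinct_curves f g -> pencil f g.
Proof.
move=> /cubic_throughP[f0 fP] /cubic_throughP[g0 gP] fg; split=> // s s' ss'.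
apply/eqP => e; have s0 : s != 0.
  apply: contraNneq ss' => s0; move/eqP: e; rewrite s0 scale0r add0r scaler_eq0 (negbTE g0) orbF.
  by move/eqP ->.
have s'0 : s' != 0.
  apply: contraNneq ss' => s'0; move/eqP: e; rewrite s'0 scale0r addr0 scaler_eq0 (negbTE f0) orbF.
  by move/eqP ->.
apply: (fg (- s' / s)); first by rewrite mulf_neq0 ?oppr_eq0 ?invr_eq0.
apply: (scalerI s0); rewrite scalerA mulrCA divff // mulr1 scaleNr.
by apply/eqP; rewrite -addr_eq0 e.
Qed.

Lemma bracket_pt_cayley_bacharach : is_cayley_bacharach_point P bracket_pt.
Proof.
have [f0 [g0 fg0]] := pencil_exists; have [Q0 bQ] := bracket_pt_basic fg0; split=> //.
  move=> f /cubic_throughP[_ /(cubic0_span fg0)[s [s' ->]]].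
  exact: pencil_comb_base.
by move=> f g fP gP /(distinct_pencil fP gP) fg R R0; apply: bracket_pt_mult.
Qed.
End GeneralPosition.

Theorem theorem6 (K : fieldType) (charK : [pchar K] =i pred0)
    (P : 'I_8 -> 'rV[K]_3)
    (P_neq0 : forall i, P i != 0)
    (P_distinct : forall i j, i != j -> ~~ (P i == P j)%MS)
    (no3_on_line : no_on_curve 3 1 P)
    (no6_on_conic : no_on_curve 6 2 P) :
  is_cayley_bacharach_point P
    (\sum_(s : 'S_8) ((-1) ^+ s * F P s) *: P (s (idx 8))).
Proof.
have K0 : nat_faithful K by apply/pcharf0P.
exact: (bracket_pt_cayley_bacharach K0).
Qed.
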